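(* Let $m,n\in\mathbb{R}$. If $a\in G_h^m$ and $b\in G_h^n$, then $a\# b\in G_h^{m+n}$ and $$a\# b(z)\sim\sum_{j=0}^\infty h^{2j}\,\frac{(i\sigma(D)/2)^j}{j!}\,(a\otimes b)_{h^{-1}}\Big|_{h(z,z)},$$ where $\sim$ is the asymptotic expansion in the sense that, for every integer $N\ge1$, $$a\# b(z)-\sum_{j=0}^{N-1}h^{2j}\,\frac{(i\sigma(D)/2)^j}{j!}\,(a\otimes b)_{h^{-1}}\Big|_{h(z,z)}\in h^{2N}G_h^{m+n-2N}.$$
   Context: Symbol class: for $m\in\mathbb{R}$, $G_h^m$ is the space of $a=a(z;h)\in C^\infty(\mathbb{R}^{2d}\times(0,1])$ such that for every $\alpha\in\mathbb{N}^{2d}$ there is $C_\alpha>0$ with $|\partial_z^\alpha a(z;h)|\le C_\alpha h^{|\alpha|}\langle hz\rangle^{m-|\alpha|}$ for all $z\in\mathbb{R}^{2d}$, $h\in(0,1]$, where $\langle z\rangle=(1+|z|^2)^{1/2}$. $h^kG_h^m$ denotes the set of symbols $h^k a$ with $a\in G_h^m$. Weyl quantization (for each fixed $h$): $a^w(x,D)u(x)=(2\pi)^{-d}\int_{\mathbb{R}^{2d}}e^{i(x-y)\cdot\xi}a\big(\tfrac{x+y}{2},\xi\big)u(y)\,dy\,d\xi$ (as an oscillatory integral) for $u\in\mathscr{S}(\mathbb{R}^d)$, a continuous operator on $\mathscr{S}(\mathbb{R}^d)$ that extends to $\mathscr{S}'(\mathbb{R}^d)$. The Weyl product $a\# b$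 is defined by $(a\# b)^w(x,D)=a^w(x,D)\,b^w(x,D)$. Notation: $(a\otimes b)(z,w)=a(z)b(w)$ for $z,w\in\mathbb{R}^{2d}$ (with $h$ fixed, $a=a(\cdot;h)$, $b=b(\cdot;h)$), and $(a\otimes b)_{h^{-1}}(X)=(a\otimes b)(h^{-1}X)$, $X\in\mathbb{R}^{4d}$. Writing the variables of $\mathbb{R}^{4d}$ as $(y,\eta;t,\theta)$ with $y,\eta,t,\theta\in\mathbb{R}^d$ and $D=-i\partial$, $$\sigma(D)=D_\eta\cdot D_t-D_y\cdot D_\theta=\sum_{k=1}^d\big(\partial_{y_k}\partial_{\theta_k}-\partial_{\eta_k}\partial_{t_k}\big).$$ The notation $|_{h(z,z)}$ means that the differential operator is applied first and the result is then evaluated at the point $(hz,hz)\in\mathbb{R}^{4d}$.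
   Formalization: Symbols in G_h^m are taken smooth in z for each fixed h, with bounds uniform in h, instead of jointly smooth in (z,h), in both hypotheses and conclusion: without control of h-derivatives, a#b need not be smooth in h, so the claim with joint smoothness is false. *)

(* Defs.v *)
From HB Require Import structures.
From mathcomp Require Import all_boot all_order all_algebra.
From mathcomp Require Import complex.
From mathcomp Require Import all_classical all_reals all_analysis.
Import numFieldNormedType.Exports.
Import Order.TTheory GRing.Theory Num.Theory.

Set Implicit Arguments.
Unset Strict Implicit.
Unset Printing Implicit Defensive.

Local Open Scope classical_set_scope.
Local Open Scope ring_scope.
Local Open Scope complex_scope.

(* Phase space R^(2d) is 'rV[R]_(d + d), with z = row_mx x xi. *)

(* The library norm on 'rV is the sup norm, hence these Euclidean notions. *)
Definition dotv {R : realType} {n : nat} (x y : 'rV[R]_n) : R :=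
  \sum_(k < n) x ord0 k * y ord0 k.

Definition japan {R : realType} {n : nat} (z : 'rV[R]_n) : R :=
  Num.sqrt (1 + dotv z z).

Definition cmod {R : realType} (w : R[i]) : R := Normc.normc w.

Definition expi {R : realType} (t : R) : R[i] := cos t +i* sin t.

(* R[i] is not a normed module over R in the library, so derivatives and
   integrals of complex-valued functions are taken componentwise. *)

Definition basis_vec {R : realType} {n : nat} (k : 'I_n) : 'rV[R]_n :=
  delta_mx ord0 k.

Definition partial {R : realType} {n : nat} (k : 'I_n)
    (f : 'rV[R]_n -> R[i]) : 'rV[R]_n -> R[i] :=
  fun x => 'D_(basis_vec k) (fun y => complex.Re (f y)) x
        +i* 'D_(basis_vec k) (fun y => complex.Im (f y)) x.

Definition partials {R : realType} {n : nat} (s : seq 'I_n)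
    (f : 'rV[R]_n -> R[i]) : 'rV[R]_n -> R[i] :=
  foldr partial f s.

Definition smooth {R : realType} {n : nat} (f : 'rV[R]_n -> R[i]) : Prop :=
  forall s : seq 'I_n,
    [/\ continuous (fun x => complex.Re (partials s f x)),
        continuous (fun x => complex.Im (partials s f x)) &
        forall (k : 'I_n) (x : 'rV[R]_n),
          derivable (fun y => complex.Re (partials s f y)) x (basis_vec k) /\
          derivable (fun y => complex.Im (partials s f y)) x (basis_vec k)].

Definition mabs {n : nat} (alpha : 'I_n -> nat) : nat :=
  (\sum_(k < n) alpha k)%N.

Definition dmulti {R : realType} {n : nat} (alpha : 'I_n -> nat)
    (f : 'rV[R]_n -> R[i]) : 'rV[R]_n -> R[i] :=
  foldr (fun k g => iter (alpha k) (partial k) g) f (enum 'I_n).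

Definition schwartz {R : realType} {n : nat} (f : 'rV[R]_n -> R[i]) : Prop :=
  smooth f /\
  forall (alpha : 'I_n -> nat) (p : nat), exists C : R,
    forall x, japan x ^+ p * cmod (dmulti alpha f x) <= C.

(* G_h^m.  Smoothness is in z, for each fixed h: h is a parameter. *)
Definition Gsym {R : realType} {d : nat} (m : R)
    (a : R -> 'rV[R]_(d + d) -> R[i]) : Prop :=
  (forall h : R, 0 < h <= 1 -> smooth (a h)) /\
  forall alpha : 'I_(d + d) -> nat, exists2 C : R, 0 < C &
    forall (h : R) (z : 'rV[R]_(d + d)), 0 < h <= 1 ->
      cmod (dmulti alpha (a h) z)
        <= C * h ^+ mabs alpha * japan (h *: z) `^ (m - (mabs alpha)%:R).

(* h^k G_h^m *)
Definition hGsym {R : realType} {d : nat} (k : nat) (m : R)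
    (a : R -> 'rV[R]_(d + d) -> R[i]) : Prop :=
  exists2 a' : R -> 'rV[R]_(d + d) -> R[i], Gsym m a' &
    forall (h : R) (z : 'rV[R]_(d + d)), 0 < h <= 1 ->
      a h z = (h ^+ k)%:C * a' h z.

(* Lebesgue integral over R^n as an iterated integral.  It is applied below
   only to continuous, rapidly decreasing integrands (a Schwartz cutoff times a
   function of polynomial growth), for which this is the n-dimensional
   Lebesgue integral by Fubini. *)
Fixpoint integral_rV {R : realType} (n : nat) : ('rV[R]_n -> R) -> R :=
  match n return ('rV[R]_n -> R) -> R with
  | 0 => fun f => f 0
  | n'.+1 => fun f =>
      Rintegral (@lebesgue_measure R) setT (fun t : R =>
        @integral_rV R n' (fun v => f (row_mx (const_mx t : 'rV[R]_1) v)))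
  end.

Definition cintegral_rV {R : realType} {n : nat} (f : 'rV[R]_n -> R[i]) : R[i] :=
  integral_rV (fun x => complex.Re (f x))
    +i* integral_rV (fun x => complex.Im (f x)).

(* The oscillatory integral of f exists and equals v: regularization by
   chi(eps X) for an arbitrary Schwartz cutoff chi with chi(0) = 1, the limit
   being the same for all of them. *)
Definition is_osc_integral {R : realType} {n : nat} (f : 'rV[R]_n -> R[i])
    (v : R[i]) : Prop :=
  forall chi : 'rV[R]_n -> R[i], schwartz chi -> chi 0 = 1 ->
    cmod (cintegral_rV (fun X => chi (eps *: X) * f X) - v)
      @[eps --> (0 : R)^'+] --> (0 : R).

(* a^w(x,D) u = v; the integration variable is (y, xi) = row_mx y xi. *)
Definition is_weyl {R : realType} {d : nat} (a : 'rV[R]_(d + d) -> R[i])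
    (u v : 'rV[R]_d -> R[i]) : Prop :=
  forall x : 'rV[R]_d,
    is_osc_integral
      (fun Y : 'rV[R]_(d + d) =>
         let y := lsubmx Y in
         let xi := rsubmx Y in
         expi (dotv (x - y) xi) * a (row_mx (2^-1 *: (x + y)) xi) * u y)
      (((2 * pi) ^+ d)%:C * v x).

(* Smooth functions all of whose derivatives are O(<z>^M) with a common M: an
   order-independent class of Weyl symbols.  It contains a(.;h) for a in any
   G_h^m, and is where the Weyl product is looked for. *)
Definition weyl_symbol {R : realType} {n : nat} (c : 'rV[R]_n -> R[i]) : Prop :=
  smooth c /\
  exists M : R, forall alpha : 'I_n -> nat, exists C : R,
    forall z, cmod (dmulti alpha c z) <= C * japan z `^ M.

(* c = a # b, i.e. c^w = a^w b^w as operators on the Schwartz space. *)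
Definition is_weyl_product {R : realType} {d : nat}
    (a b c : 'rV[R]_(d + d) -> R[i]) : Prop :=
  weyl_symbol c /\
  forall u : 'rV[R]_d -> R[i], schwartz u ->
    exists v w : 'rV[R]_d -> R[i],
      [/\ schwartz v, schwartz w, is_weyl b u v, is_weyl a v w & is_weyl c u w].

Definition tensor {R : realType} {n : nat} (a b : 'rV[R]_n -> R[i]) :
    'rV[R]_(n + n) -> R[i] :=
  fun X => a (lsubmx X) * b (rsubmx X).

(* F_s(X) = F(s X) *)
Definition dilate {R : realType} {n : nat} (s : R) (F : 'rV[R]_n -> R[i]) :
    'rV[R]_n -> R[i] :=
  fun X => F (s *: X).

(* D = -i d *)
Definition Dop {R : realType} {n : nat} (k : 'I_n) (F : 'rV[R]_n -> R[i]) :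
    'rV[R]_n -> R[i] :=
  fun X => - 'i%C * partial k F X.

(* Coordinates (y, eta; t, theta) on R^(4d). *)
Definition ix_y {d : nat} (k : 'I_d) : 'I_((d + d) + (d + d)) :=
  lshift (d + d) (lshift d k).
Definition ix_eta {d : nat} (k : 'I_d) : 'I_((d + d) + (d + d)) :=
  lshift (d + d) (rshift d k).
Definition ix_t {d : nat} (k : 'I_d) : 'I_((d + d) + (d + d)) :=
  rshift (d + d) (lshift d k).
Definition ix_theta {d : nat} (k : 'I_d) : 'I_((d + d) + (d + d)) :=
  rshift (d + d) (rshift d k).

(* sigma(D) = D_eta . D_t - D_y . D_theta *)
Definition sigmaD {R : realType} {d : nat}
    (F : 'rV[R]_((d + d) + (d + d)) -> R[i]) :
    'rV[R]_((d + d) + (d + d)) -> R[i] :=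
  fun X => \sum_(k < d) Dop (ix_eta k) (Dop (ix_t k) F) X
         - \sum_(k < d) Dop (ix_y k) (Dop (ix_theta k) F) X.

(* (i sigma(D) / 2)^j / j! *)
Definition isigmaD_pow {R : realType} {d : nat} (j : nat)
    (F : 'rV[R]_((d + d) + (d + d)) -> R[i]) :
    'rV[R]_((d + d) + (d + d)) -> R[i] :=
  fun X => (j`!)%:R^-1 * iter j (fun G Y => 'i%C / 2 * sigmaD G Y) F X.

(* The j-th term of the expansion of a # b; a and b are a(.;h) and b(.;h). *)
Definition moyal_term {R : realType} {d : nat} (j : nat) (h : R)
    (a b : 'rV[R]_(d + d) -> R[i]) (z : 'rV[R]_(d + d)) : R[i] :=
  (h ^+ (2 * j))%:C *
  isigmaD_pow j (dilate h^-1 (tensor a b)) (h *: row_mx z z).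

(* Main.v *)
Require Import Defs.
From mathcomp Require Import all_boot all_order all_algebra.
From mathcomp Require Import complex.
From mathcomp Require Import all_classical all_reals all_analysis.
From mathcomp Require Import measurable_realfun.
From mathcomp Require Import ring lra.
Import numFieldNormedType.Exports.
Import Order.TTheory GRing.Theory Num.Theory.

Set Implicit Arguments.
Unset Strict Implicit.
Unset Printing Implicit Defensive.

Local Open Scope classical_set_scope.
Local Open Scope ring_scope.
Local Open Scope complex_scope.

(* Oscillatory integrals with the phase exp(-i y.eta) make sense, by repeated
   integration by parts, on smooth functions all of whose derivatives have a
   common polynomial growth.  For a linear map T on R^(2D) put
   A_T F(X) = (2 pi)^(-D) int exp(-i y.eta) F((y, eta) T + X) dy deta.
   If T = T0 + s T1 with T1 isotropic for the phase, then d/ds A_T = A_T Q for a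
   constant coefficient second-order operator Q, and A_T0 = id when T0 is
   isotropic.  Families of this kind are determined by Q, and the generators of
   compositions add up.  This replaces Fubini and Fourier inversion.

   Both a^w (b^w u) and c^w u, where c(z) = A_T (a (x) b)(z, z) for a suitable T,
   are compositions of two such operators applied to a (x) b (x) u, with equal
   total generators; hence c = a # b.  Testing on Gaussians exp(i r.x) gs(delta x),
   delta -> 0, shows that a symbol c with c^w = 0 has A_T c = 0 for an invertible
   A_T, so c = 0 and a # b is unique.  The generator of c is i sigma(D)/2: its
   Taylor polynomial in s is the claimed expansion, its N-th remainder is bounded
   by A_T (i sigma(D)/2)^N (a (x) b), which involves only products of N-th
   derivatives of a and of b, and Peetre's inequality for the weights gives the
   symbol estimates. *)

(** * Complex-valued functions and polynomial weights *)

(** Differentiating the integrand of [AT] along T0 + s T1 produces a factor Y_i from T1; against the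
    phase, Y_i acts as -i times the derivative in the conjugate variable, which brings out the
    corresponding row of T0 + s T1. The coefficient of s in the result is the pairing of T1 with
    itself: isotropy of T1 is what makes Q independent of s. Every map needed is a sum of a part
    supported on the y rows and a part supported on the eta rows, and both parts are automatically
    isotropic. Uniqueness follows by composing one family with the time reversal of the other: the
    generator is 0, so the composition is constant in s. It can be differentiated only if the Taylor
    error of the inner family may be fed into the outer one, uniformly in time; hence the estimates
    for families of functions, and one growth exponent for all derivatives. The only oscillatory
    integral evaluated explicitly is that of the constant 1, by Gaussians; it yields the factor (2
    pi)^D. Limits of regularized integrals come with a rate C e and derivatives with a quadratic
    error, so that no dominated convergence enters. *)

Section Modulus.
Context {R : realType}.
Implicit Types z w : R[i].

Lemma cmodE z : cmod z = Num.sqrt (complex.Re z ^+ 2 + complex.Im z ^+ 2).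
Proof. by case: z. Qed.

Lemma cmod_ge0 z : 0 <= cmod z.
Proof. by rewrite cmodE sqrtr_ge0. Qed.

Lemma cmodM z w : cmod (z * w) = cmod z * cmod w.
Proof. exact: Normc.normcM. Qed.

Lemma cmodD z w : cmod (z + w) <= cmod z + cmod w.
Proof.
have e (u : R[i]) : `|u| = (cmod u)%:C by rewrite normc_def cmodE.
by rewrite -lecR rmorphD -!e ler_normD.
Qed.

Lemma cmodN z : cmod (- z) = cmod z.
Proof. by rewrite !cmodE; case: z => a b /=; rewrite !sqrrN. Qed.

Lemma cmodB z w : cmod (z - w) <= cmod z + cmod w.
Proof. by rewrite -(cmodN w) cmodD. Qed.

Lemma cmodBC z w : cmod (z - w) = cmod (w - z).
Proof. by rewrite -cmodN opprB. Qed.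

Lemma cmod0 : cmod (0 : R[i]) = 0.
Proof. exact: Normc.normc0. Qed.

Lemma cmod1 : cmod (1 : R[i]) = 1.
Proof. exact: Normc.normc1. Qed.

Lemma cmod_eq0 z : cmod z = 0 -> z = 0.
Proof. exact: Normc.eq0_normc. Qed.

Lemma cmodC (r : R) : cmod r%:C = `|r|.
Proof. by rewrite cmodE /= expr0n addr0 sqrtr_sqr. Qed.

Lemma cmodi : cmod ('i%C : R[i]) = 1.
Proof. by rewrite cmodE /= expr0n add0r expr1n sqrtr1. Qed.

Lemma cmod_expi (t : R) : cmod (expi t) = 1.
Proof. by rewrite cmodE /= cos2Dsin2 sqrtr1. Qed.

Lemma Re_le_cmod z : `|complex.Re z| <= cmod z.
Proof. by rewrite cmodE -sqrtr_sqr ler_sqrt ?lerDl ?addr_ge0 ?sqr_ge0. Qed.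

Lemma Im_le_cmod z : `|complex.Im z| <= cmod z.
Proof. by rewrite cmodE -sqrtr_sqr ler_sqrt ?lerDr ?addr_ge0 ?sqr_ge0. Qed.

Lemma complexEi (a b : R) : a +i* b = a%:C + 'i%C * b%:C.
Proof. by apply/eqP; rewrite eq_complex /=; apply/andP; split; apply/eqP; ring. Qed.

Lemma cmod_le_ReIm z : cmod z <= `|complex.Re z| + `|complex.Im z|.
Proof.
case: z => a b; rewrite {1}complexEi (le_trans (cmodD _ _)) //.
by rewrite cmodM !cmodC cmodi mul1r.
Qed.

Lemma cmod_sum (I : Type) (r : seq I) (P : pred I) (F : I -> R[i]) :
  cmod (\sum_(i <- r | P i) F i) <= \sum_(i <- r | P i) cmod (F i).
Proof.
elim/big_ind2 : _ => [|x1 x2 y1 y2 h1 h2|//]; first by rewrite cmod0.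
by rewrite (le_trans (cmodD _ _)) // lerD.
Qed.

Lemma complexP (z w : R[i]) : complex.Re z = complex.Re w ->
  complex.Im z = complex.Im w -> z = w.
Proof. by case: z w => [a b] [c d] /= -> ->. Qed.

Lemma expiD (s t : R) : expi (s + t) = expi s * expi t.
Proof. by apply: complexP; rewrite /= ?cosD ?sinD; ring. Qed.

Lemma expi0 : expi (0 : R) = 1.
Proof. by rewrite /expi cos0 sin0. Qed.

Lemma cReM z w : complex.Re (z * w) =
  complex.Re z * complex.Re w - complex.Im z * complex.Im w.
Proof. by case: z w => [a b] [c d]. Qed.

Lemma cImM z w : complex.Im (z * w) =
  complex.Re z * complex.Im w + complex.Im z * complex.Re w.
Proof. by case: z w => [a b] [c d]. Qed.

Lemma cReD z w : complex.Re (z + w) = complex.Re z + complex.Re w.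
Proof. by case: z w => [a b] [c d]. Qed.

Lemma cImD z w : complex.Im (z + w) = complex.Im z + complex.Im w.
Proof. by case: z w => [a b] [c d]. Qed.

Lemma cReN z : complex.Re (- z) = - complex.Re z. Proof. by case: z. Qed.
Lemma cImN z : complex.Im (- z) = - complex.Im z. Proof. by case: z. Qed.

End Modulus.

(** * Differentiation of complex functions of a real variable *)

Section Cder.
Context {R : realType}.
Implicit Types (f g : R -> R[i]) (t : R) (l : R[i]).

Definition cder f t l :=
  is_derive t 1 (fun s => complex.Re (f s)) (complex.Re l) /\
  is_derive t 1 (fun s => complex.Im (f s)) (complex.Im l).

Lemma cder_cst t (c : R[i]) : cder (fun _ => c) t 0.
Proof. by split; exact: is_derive_cst. Qed.

Lemma cderD f g t l m : cder f t l -> cder g t m -> cder (fun s => f s + g s) t (l + m).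
Proof.
move=> [f1 f2] [g1 g2]; split; rewrite ?cReD ?cImD; under eq_fun do rewrite ?cReD ?cImD.
  exact: is_deriveD.
exact: is_deriveD.
Qed.

Lemma cderM f g t l m : cder f t l -> cder g t m ->
  cder (fun s => f s * g s) t (l * g t + f t * m).
Proof.
move=> [f1 f2] [g1 g2]; split.
  under eq_fun do rewrite cReM.
  apply: (@is_derive_eq _ _ _ _ _ _ _ _ (is_deriveB (is_deriveM f1 g1) (is_deriveM f2 g2))).
  rewrite cReD !cReM /GRing.scale /=; ring.
under eq_fun do rewrite cImM.
apply: (@is_derive_eq _ _ _ _ _ _ _ _ (is_deriveD (is_deriveM f1 g2) (is_deriveM f2 g1))).
rewrite cImD !cImM /GRing.scale /=; ring.
Qed.

Lemma cder_real (r : R -> R) t (l : R) : is_derive t 1 r l ->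
  cder (fun s => (r s)%:C) t l%:C.
Proof. by move=> h; split => //=; exact: is_derive_cst. Qed.

Lemma cder_eq f t l m : cder f t l -> l = m -> cder f t m.
Proof. by move=> ? <-. Qed.

Lemma cder_expi (r : R -> R) t (l : R) : is_derive t 1 r l ->
  cder (fun s => expi (r s)) t ('i%C * l%:C * expi (r t)).
Proof.
move=> h; split => /=.
  have k := is_derive1_comp (is_derive_cos (r t)) h.
  by apply: (is_derive_eq k); rewrite /GRing.scale/=; ring.
have k := is_derive1_comp (is_derive_sin (r t)) h.
by apply: (is_derive_eq k); rewrite /GRing.scale/=; ring.
Qed.

Lemma cder_continuous_Re f t l : cder f t l -> {for t, continuous (fun s => complex.Re (f s))}.
Proof. by move=> [/@ex_derive h _]; apply/differentiable_continuous/derivable1_diffP. Qed.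

Lemma cder_continuous_Im f t l : cder f t l -> {for t, continuous (fun s => complex.Im (f s))}.
Proof. by move=> [_ /@ex_derive h]; apply/differentiable_continuous/derivable1_diffP. Qed.

(* The factor 2 comes from applying the mean value theorem componentwise. *)
Lemma cder_MVT f (f' : R -> R[i]) (B t : R) :
  (forall s, `|s| <= `|t| -> cder f s (f' s)) ->
  (forall s, `|s| <= `|t| -> cmod (f' s) <= B) ->
  cmod (f t - f 0) <= 2 * B * `|t|.
Proof.
move=> df bf.
have comp (r r' : R -> R) : (forall s : R, `|s| <= `|t| -> is_derive s 1 r (r' s)) ->
    (forall s, `|s| <= `|t| -> `|r' s| <= B) -> `|r t - r 0| <= B * `|t|.
  move=> dr br.
  have [t0|t0] := leP 0 t.
  - have lt s : s \in `[0, t]%R -> `|s| <= `|t|.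
      by rewrite in_itv/= => /andP[? ?]; rewrite !ger0_norm.
    have [x /subset_itv_oo_cc/lt/dr//|x|c /lt/br h ->] := @MVT_segment R r r' 0 t t0.
      by apply: derivable_within_continuous => y /lt/dr/@ex_derive.
    by rewrite subr0 normrM ler_wpM2r.
  - have lt s : s \in `[t, 0]%R -> `|s| <= `|t|.
      by rewrite in_itv/= => /andP[? ?]; rewrite !ler0_norm ?lerN2// ltW.
    have [x /subset_itv_oo_cc/lt/dr//|x|c /lt/br h e] := @MVT_segment R r r' t 0 (ltW t0).
      by apply: derivable_within_continuous => y /lt/dr/@ex_derive.
    by rewrite distrC e sub0r normrM normrN ler_wpM2r.
rewrite (le_trans (cmod_le_ReIm _)) // !(cReD, cImD, cReN, cImN).
rewrite -mulrA mulrDl mul1r; apply: lerD.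
  apply: (comp (fun s => complex.Re (f s)) (fun s => complex.Re (f' s))) => s hs; first by have [] := df s hs.
  exact: le_trans (Re_le_cmod _) (bf _ hs).
apply: (comp (fun s => complex.Im (f s)) (fun s => complex.Im (f' s))) => s hs; first by have [] := df s hs.
exact: le_trans (Im_le_cmod _) (bf _ hs).
Qed.

(** The replacement for differentiation under the integral sign: a second-order Taylor estimate of
    the integrand can be integrated, and the resulting quadratic error already gives the
    derivative. *)
Lemma cder_of_quad f t l (B : R) :
  (forall s, `|s| <= 1 -> cmod (f (t + s) - f t - s%:C * l) <= B * s ^+ 2) ->
  cder f t l.
Proof.
move=> hf.
have comp (r : R -> R) (k : R) :
    (forall s, `|s| <= 1 -> `|r (t + s) - r t - s * k| <= B * s ^+ 2) ->
    is_derive t 1 r k.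
  move=> hr.
  suff h : h^-1 *: (r (h *: 1 + t) - r t) @[h --> 0^'] --> k.
    by apply: DeriveDef; [apply/cvg_ex; exists k | exact/cvg_lim].
  apply/cvgrPdist_le => e e0; near=> s.
  have s0 : s != 0 by near: s; exact: nbhs_dnbhs_neq.
  have sB : `|s| * (`|B| + 1) <= e.
    rewrite -ler_pdivlMr ?ltr_wpDl//; near: s; apply: dnbhs0_le.
    by rewrite divr_gt0// ltr_wpDl.
  have s1 : `|s| <= 1 by near: s; exact: dnbhs0_le.
  have -> : k - s^-1 *: (r (s *: 1 + t) - r t) = - s^-1 * (r (t + s) - r t - s * k).
    by rewrite /GRing.scale/= mulr1 (addrC t); field.
  rewrite normrM normrN normfV mulrC ler_pdivrMr ?normr_gt0//.
  apply: le_trans (hr _ s1) _; apply: le_trans (ler_wpM2r (normr_ge0 s) sB).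
  rewrite mulrAC -normrM -expr2 ger0_norm ?sqr_ge0// mulrC ler_wpM2l ?sqr_ge0//.
  by rewrite (le_trans (ler_norm _))// lerDl.
split; apply: comp => s s1; apply: le_trans (hf s s1).
  apply: le_trans (Re_le_cmod _); rewrite !(cReD, cReN, cReM) /=.
  by rewrite mul0r subr0.
apply: le_trans (Im_le_cmod _); rewrite !(cImD, cImN, cImM) /=.
by rewrite mul0r addr0.
Unshelve. all: by end_near.
Qed.

End Cder.

(** * Partial derivatives *)

Section Pder.
Context {R : realType} {n : nat}.
Implicit Types (f g : 'rV[R]_n -> R[i]) (x v : 'rV[R]_n) (l : R[i]).

Lemma is_derive_line (r : 'rV[R]_n -> R) x v (l : R) :
  is_derive (0 : R) (1 : R) (fun t : R => r (x + t *: v)) l <-> is_derive x v r l.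
Proof.
have e : (fun h : R => h^-1 *: (((fun t : R => r (x + t *: v)) \o shift 0) (h *: (1:R)) - r (x + 0 *: v)))
       = (fun h : R => h^-1 *: ((r \o shift x) (h *: v) - r x)).
  have e1 (h : R) : h *: (1 : R) = h by rewrite /GRing.scale/= mulr1.
  by apply/funext => h /=; rewrite e1 addr0 scale0r addr0 (addrC (h *: v)).
by split => -[d1 d2]; apply: DeriveDef; move: d1 d2; rewrite /derivable /derive e.
Qed.

(** Restriction to a coordinate line lets the one-variable rules apply directly; [pderE] and
    [pder_val] are the link to [partial]. *)
Definition pder (i : 'I_n) f x l := cder (fun t : R => f (x + t *: basis_vec i)) 0 l.

Lemma pderE i f x l : pder i f x l <->
  is_derive x (basis_vec i) (fun y => complex.Re (f y)) (complex.Re l) /\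
  is_derive x (basis_vec i) (fun y => complex.Im (f y)) (complex.Im l).
Proof.
split => -[h1 h2]; split.
- exact: (is_derive_line (fun y => complex.Re (f y)) _ _ _).1.
- exact: (is_derive_line (fun y => complex.Im (f y)) _ _ _).1.
- exact: (is_derive_line (fun y => complex.Re (f y)) _ _ _).2.
- exact: (is_derive_line (fun y => complex.Im (f y)) _ _ _).2.
Qed.

Lemma pder_val i f x l : pder i f x l -> partial i f x = l.
Proof.
move=> /pderE[h1 h2]; apply: complexP => /=.
  by rewrite (@derive_val _ _ _ _ _ _ _ h1).
by rewrite (@derive_val _ _ _ _ _ _ _ h2).
Qed.

Definition pderivable i f := forall x, pder i f x (partial i f x).

Lemma pderivableP i f : pderivable i f <-> forall x,
  derivable (fun y => complex.Re (f y)) x (basis_vec i) /\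
  derivable (fun y => complex.Im (f y)) x (basis_vec i).
Proof.
split => h x; first by have /pderE[? ?] := h x; split; exact: ex_derive.
by apply/pderE; have [? ?] := h x; split => /=; exact: derivableP.
Qed.

Lemma pder_pderivable i f (f' : 'rV[R]_n -> R[i]) :
  (forall x, pder i f x (f' x)) -> pderivable i f /\ partial i f = f'.
Proof.
move=> h; have e : partial i f = f' by apply/funext => x; exact: pder_val.
by split => // x; rewrite e.
Qed.

Lemma pder_cst i x (c : R[i]) : pder i (fun _ => c) x 0.
Proof. exact: cder_cst. Qed.

Lemma pderD i f g x l m : pder i f x l -> pder i g x m ->
  pder i (fun y => f y + g y) x (l + m).
Proof. exact: cderD. Qed.

Lemma pderM i f g x l m : pder i f x l -> pder i g x m ->
  pder i (fun y => f y * g y) x (l * g x + f x * m).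
Proof. by move=> hf hg; have := cderM hf hg; rewrite scale0r addr0. Qed.

Lemma pderZ i f x l (c : R[i]) : pder i f x l -> pder i (fun y => c * f y) x (c * l).
Proof. by move=> hf; have := pderM (pder_cst i x c) hf; rewrite mul0r add0r. Qed.

Lemma pderN i f x l : pder i f x l -> pder i (fun y => - f y) x (- l).
Proof.
move=> /(pderZ (-1)); rewrite mulN1r; congr pder; apply/funext => y; by rewrite mulN1r.
Qed.

Lemma pderB i f g x l m : pder i f x l -> pder i g x m ->
  pder i (fun y => f y - g y) x (l - m).
Proof. by move=> hf /pderN; exact: pderD. Qed.

Lemma pder_eq i f x l m : pder i f x l -> l = m -> pder i f x m.
Proof. by move=> ? <-. Qed.

Lemma pder_sum i (I : Type) (r : seq I) (F : I -> 'rV[R]_n -> R[i]) (L : I -> R[i]) x :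
  (forall k, pder i (F k) x (L k)) ->
  pder i (fun y => \sum_(k <- r) F k y) x (\sum_(k <- r) L k).
Proof.
move=> h; elim: r => [|k r IH].
  under eq_fun do rewrite big_nil; rewrite big_nil; exact: pder_cst.
under eq_fun do rewrite big_cons; rewrite big_cons; exact: pderD.
Qed.

Lemma pder_line i f x (t : R) l : pder i f (x + t *: basis_vec i) l ->
  cder (fun s => f (x + s *: basis_vec i)) t l.
Proof.
move=> [h1 h2].
have sh (r : R -> R) (k : R) : is_derive (0:R) (1:R) (fun s => r (t + s)) k -> is_derive t (1:R) r k.
  have e : (fun h : R => h^-1 *: (((fun s => r (t + s)) \o shift 0) (h *: (1:R)) - r (t + 0)))
       = (fun h : R => h^-1 *: ((r \o shift t) (h *: (1 : R)) - r t)).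
    by apply/funext => h /=; rewrite !addr0 (addrC t).
  by move => -[d1 d2]; apply: DeriveDef; move: d1 d2; rewrite /derivable /derive e.
split; apply: sh.
  under eq_fun do rewrite scalerDl addrA; exact: h1.
under eq_fun do rewrite scalerDl addrA; exact: h2.
Qed.

Lemma pderivable_MVT i f x (B t : R) : pderivable i f ->
  (forall s : R, `|s| <= `|t| -> cmod (partial i f (x + s *: basis_vec i)) <= B) ->
  cmod (f (x + t *: basis_vec i) - f x) <= 2 * B * `|t|.
Proof.
move=> df bf; rewrite -[in X in _ - X](addr0 x) -(scale0r (basis_vec i)).
apply: (@cder_MVT _ (fun s => f (x + s *: basis_vec i))
  (fun s => partial i f (x + s *: basis_vec i))) => s hs; last exact: bf.
exact: pder_line.
Qed.

End Pder.

(** * The polynomial weight and a matrix norm *)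

Section Weight.
Context {R : realType}.

(** An l1 substitute for the Japanese bracket: comparable to it ([japan_wt], [wt_japan]), but
    submultiplicative with constant 1 and free of square roots. *)
Definition wt {n} (x : 'rV[R]_n) : R := 1 + \sum_j `|x ord0 j|.

Lemma sumabs_ge0 {n} (x : 'rV[R]_n) : 0 <= \sum_j `|x ord0 j|.
Proof. by apply: sumr_ge0 => j _. Qed.
Hint Extern 0 (is_true (0 <= _)) => solve [apply: sumabs_ge0] : core.

Lemma wt_ge1 {n} (x : 'rV[R]_n) : 1 <= wt x.
Proof. by rewrite lerDl. Qed.

Lemma wt_gt0 {n} (x : 'rV[R]_n) : 0 < wt x.
Proof. exact: lt_le_trans (wt_ge1 x). Qed.

Lemma wt_ge0 {n} (x : 'rV[R]_n) : 0 <= wt x.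
Proof. exact: ltW (wt_gt0 x). Qed.

Lemma wtX_ge1 {n} (x : 'rV[R]_n) k : 1 <= wt x ^+ k.
Proof. exact/exprn_ege1/wt_ge1. Qed.

Lemma wtX_gt0 {n} (x : 'rV[R]_n) k : 0 < wt x ^+ k.
Proof. exact/exprn_gt0/wt_gt0. Qed.

Lemma wtX_ge0 {n} (x : 'rV[R]_n) k : 0 <= wt x ^+ k.
Proof. exact/ltW/wtX_gt0. Qed.

Lemma wt0 {n} : wt (0 : 'rV[R]_n) = 1.
Proof. by rewrite /wt big1 ?addr0// => j _; rewrite mxE normr0. Qed.

Lemma wtD_le {n} (x y : 'rV[R]_n) : wt (x + y) <= wt x + \sum_j `|y ord0 j|.
Proof.
rewrite /wt -addrA lerD2l -big_split /=; apply: ler_sum => j _.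
by rewrite mxE ler_normD.
Qed.

Lemma wtD {n} (x y : 'rV[R]_n) : wt (x + y) <= wt x * wt y.
Proof.
rewrite (le_trans (wtD_le x y))// {3}/wt mulrDr mulr1 lerD2l.
by rewrite ler_peMl ?wt_ge1.
Qed.

Lemma wtN {n} (x : 'rV[R]_n) : wt (- x) = wt x.
Proof. by rewrite /wt; under eq_bigr do rewrite mxE normrN. Qed.

Lemma wt_abs {n} (x : 'rV[R]_n) j : `|x ord0 j| <= wt x.
Proof.
rewrite /wt (bigD1 j)//= addrCA lerDl addr_ge0//; exact: sumr_ge0.
Qed.

Lemma wt_sum {n} (x : 'rV[R]_n) : \sum_j `|x ord0 j| <= wt x.
Proof. by rewrite /wt lerDr. Qed.

Lemma wt_row {p q} (x : 'rV[R]_p) (y : 'rV[R]_q) : wt (row_mx x y) <= wt x * wt y.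
Proof.
rewrite /wt big_split_ord/=.
under eq_bigr do rewrite row_mxEl.
under [X in _ + (_ + X)]eq_bigr do rewrite row_mxEr.
have := sumabs_ge0 x; have := sumabs_ge0 y; nra.
Qed.

Lemma wt_row_l {p q} (x : 'rV[R]_p) (y : 'rV[R]_q) : wt x <= wt (row_mx x y).
Proof.
rewrite /wt big_split_ord/=; under [X in _ <= _ + (X + _)]eq_bigr do rewrite row_mxEl.
by rewrite lerD2l lerDl sumr_ge0.
Qed.

Lemma wt_row_r {p q} (x : 'rV[R]_p) (y : 'rV[R]_q) : wt y <= wt (row_mx x y).
Proof.
rewrite /wt big_split_ord/=; under [X in _ <= _ + (_ + X)]eq_bigr do rewrite row_mxEr.
by rewrite lerD2l lerDr sumr_ge0.
Qed.

Lemma wtZ {n} (a : R) (x : 'rV[R]_n) : wt (a *: x) = 1 + `|a| * \sum_j `|x ord0 j|.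
Proof. by rewrite /wt mulr_sumr; under eq_bigr do rewrite mxE normrM. Qed.

Lemma wtZ_le {n} (a : R) (x : 'rV[R]_n) : `|a| <= 1 -> wt (a *: x) <= wt x.
Proof. by move=> a1; rewrite wtZ /wt lerD2l ler_piMl. Qed.

Lemma wtX_leW {n} (x : 'rV[R]_n) k l : (k <= l)%N -> wt x ^+ k <= wt x ^+ l.
Proof. by move=> kl; rewrite ler_weXn2l ?wt_ge1. Qed.

(** The summand 1 keeps every power at least 1, so that the power for the highest order of
    derivative dominates those for the lower orders. *)
Definition opn {p n} (T : 'M[R]_(p, n)) : R := 1 + \sum_i \sum_j `|T i j|.

Lemma opn_ge1 {p n} (T : 'M[R]_(p, n)) : 1 <= opn T.
Proof. by rewrite lerDl sumr_ge0// => i _; exact: sumr_ge0. Qed.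

Lemma sumabs_mul {p n} (T : 'M[R]_(p, n)) (x : 'rV[R]_p) :
  \sum_j `|(x *m T) ord0 j| <= opn T * \sum_i `|x ord0 i|.
Proof.
apply: (@le_trans _ _ (\sum_j \sum_i `|x ord0 i| * `|T i j|)).
  apply: ler_sum => j _; rewrite mxE (le_trans (ler_norm_sum _ _ _))//.
  by apply: ler_sum => i _; rewrite normrM.
rewrite exchange_big /= mulr_sumr; apply: ler_sum => i _.
rewrite -mulr_sumr mulrC ler_wpM2r// /opn (bigD1 i)//= addrCA lerDl addr_ge0//.
by apply: sumr_ge0 => k _; exact: sumr_ge0.
Qed.

Lemma wt_mul {p n} (T : 'M[R]_(p, n)) (x : 'rV[R]_p) : wt (x *m T) <= opn T * wt x.
Proof.
rewrite {1}/wt (le_trans (lerD (opn_ge1 T) (sumabs_mul T x)))//.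
by rewrite /wt mulrDr mulr1.
Qed.

End Weight.
#[global] Hint Extern 0 (is_true (0 <= cmod _)) => solve [apply: cmod_ge0] : core.
#[global] Hint Extern 0 (is_true (0 <= wt _)) => solve [apply: wt_ge0] : core.
#[global] Hint Extern 0 (is_true (0 < wt _)) => solve [apply: wt_gt0] : core.
#[global] Hint Extern 0 (is_true (1 <= wt _)) => solve [apply: wt_ge1] : core.
#[global] Hint Extern 0 (is_true (0 <= wt _ ^+ _)) => solve [apply: wtX_ge0] : core.
#[global] Hint Extern 0 (is_true (0 < wt _ ^+ _)) => solve [apply: wtX_gt0] : core.
#[global] Hint Extern 0 (is_true (1 <= wt _ ^+ _)) => solve [apply: wtX_ge1] : core.
#[global] Hint Extern 0 (is_true (0 <= bigop _ _ _)) => solve [apply: sumabs_ge0] : core.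

(** * Functions with k derivatives bounded by one weight *)

Section Bnd.
Context {R : realType} {n : nat}.
Implicit Types (f g : 'rV[R]_n -> R[i]) (W V : 'rV[R]_n -> R) (x v : 'rV[R]_n).

(** One weight serves all orders up to k, so products and substitutions stay in this form and only
    change the weight. The recursion replaces f by its derivatives, hence inductions on k are
    general in f. *)
Fixpoint bnd (k : nat) W f : Prop :=
  (forall x, cmod (f x) <= W x) /\
  if k is k'.+1 then forall i, pderivable i f /\ bnd k' W (partial i f) else True.

Lemma bnd0 k W f x : bnd k W f -> cmod (f x) <= W x.
Proof. by case: k => [|k] [h _]; exact: h. Qed.

Lemma bnd_pderivable k W f i : bnd k.+1 W f -> pderivable i f.
Proof. by move=> [_ h]; have [] := h i. Qed.

Lemma bnd_partial k W f i : bnd k.+1 W f -> bnd k W (partial i f).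
Proof. by move=> [_ h]; have [] := h i. Qed.

Lemma bndS k W f (f' : 'I_n -> 'rV[R]_n -> R[i]) : (forall x, cmod (f x) <= W x) ->
  (forall i x, pder i f x (f' i x)) -> (forall i, bnd k W (f' i)) -> bnd k.+1 W f.
Proof.
move=> h0 h1 h2; split => // i; have [? e] := pder_pderivable (h1 i).
by split => //; rewrite e.
Qed.

Lemma bnd_leW k W V f : (forall x, W x <= V x) -> bnd k W f -> bnd k V f.
Proof.
move=> WV; elim: k f => [|k IH] f [h0 h1]; split => //.
- by move=> x; exact: le_trans (WV x).
- by move=> x; exact: le_trans (WV x).
- by move=> i; have [? ?] := h1 i; split => //; exact: IH.
Qed.

Lemma bnd_lek k l W f : (k <= l)%N -> bnd l W f -> bnd k W f.
Proof.
elim: k l f => [|k IH] [|l] f; [by []|by move=> _ [h _]; split|by []|].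
rewrite ltnS => kl [h0 h1]; split => // i; have [? ?] := h1 i; split => //.
exact: IH kl _.
Qed.

Lemma bnd_ge0 k W f x : bnd k W f -> 0 <= W x.
Proof. by move=> h; apply: (le_trans _ (bnd0 x h)); exact: cmod_ge0. Qed.

Lemma bndD k W V f g : bnd k W f -> bnd k V g -> bnd k (fun x => W x + V x) (fun x => f x + g x).
Proof.
elim: k f g => [|k IH] f g hf hg.
  by split => // x; rewrite (le_trans (cmodD _ _))// lerD// (bnd0 _ hf, bnd0 _ hg).
apply: (@bndS _ _ _ (fun i x => partial i f x + partial i g x)) => [x|i x|i].
- exact: le_trans (cmodD _ _) (lerD (bnd0 _ hf) (bnd0 _ hg)).
- by apply: pderD; [exact: (bnd_pderivable i hf)|exact: (bnd_pderivable i hg)].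
- by apply: IH; exact: bnd_partial.
Qed.

Lemma bnd_eqW k W V f : (forall x, W x = V x) -> bnd k W f -> bnd k V f.
Proof. by move=> e; apply: bnd_leW => x; rewrite e. Qed.

Lemma bnd_eqf k W f g : f =1 g -> bnd k W f -> bnd k W g.
Proof. by move=> /funext ->. Qed.

Lemma bndZ k W f (c : R[i]) : bnd k W f -> bnd k (fun x => cmod c * W x) (fun x => c * f x).
Proof.
elim: k f => [|k IH] f hf.
  by split => // x; rewrite cmodM; apply: ler_wpM2l => //; exact: bnd0 _ hf.
apply: (@bndS _ _ _ (fun i x => c * partial i f x)) => [x|i x|i].
- by rewrite cmodM; apply: ler_wpM2l => //; exact: bnd0 _ hf.
- by apply: pderZ; exact: (bnd_pderivable i hf).
- by apply: IH; exact: bnd_partial.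
Qed.

Lemma bndN k W f : bnd k W f -> bnd k W (fun x => - f x).
Proof.
move=> /(bndZ (-1)); rewrite cmodN cmod1 => h.
by apply: bnd_eqf (bnd_eqW _ h) => x; rewrite ?mulN1r ?mul1r.
Qed.

Lemma bndB k W V f g : bnd k W f -> bnd k V g -> bnd k (fun x => W x + V x) (fun x => f x - g x).
Proof. by move=> hf /bndN; exact: bndD. Qed.

(** Each derivative splits the product into two terms, whence the factor 2 ^ k. *)
Lemma bndM k W V f g : bnd k W f -> bnd k V g ->
  bnd k (fun x => 2 ^+ k * (W x * V x)) (fun x => f x * g x).
Proof.
elim: k f g => [|k IH] f g hf hg.
  by split => // x; rewrite mul1r cmodM ler_pM ?(bnd0 _ hf) ?(bnd0 _ hg).
apply: (@bndS _ _ _ (fun i x => partial i f x * g x + f x * partial i g x)) => [x|i x|i].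
- rewrite cmodM (le_trans (ler_pM _ _ (bnd0 _ hf) (bnd0 _ hg)))// ler_peMl ?exprn_ege1 ?ler1n//.
  by rewrite mulr_ge0// ?(bnd_ge0 _ hf) ?(bnd_ge0 _ hg).
- by apply: pderM; [exact: (bnd_pderivable i hf)|exact: (bnd_pderivable i hg)].
- apply: (@bnd_eqW _ (fun x => 2 ^+ k * (W x * V x) + 2 ^+ k * (W x * V x))).
    by move=> x; rewrite exprS; ring.
  apply: bndD; apply: IH.
  + exact: bnd_partial. + exact: bnd_lek hg.
  + exact: bnd_lek hf. + exact: bnd_partial.
Qed.

Lemma bnd_cst k (c : R[i]) : bnd k (fun _ => cmod c) (fun _ => c).
Proof.
elim: k c => [|k IH] c; first by [].
apply: (@bndS _ _ _ (fun _ _ => 0)) => // [i x|i]; first exact: pder_cst.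
by apply: bnd_leW (IH 0) => x; rewrite cmod0.
Qed.

Lemma bnd_sum k (I : Type) (r : seq I) (W : I -> 'rV[R]_n -> R) (F : I -> 'rV[R]_n -> R[i]) :
  (forall j, bnd k (W j) (F j)) ->
  bnd k (fun x => \sum_(j <- r) W j x) (fun x => \sum_(j <- r) F j x).
Proof.
move=> h; elim: r => [|j r IH].
  by apply: bnd_eqf (bnd_leW _ (bnd_cst k 0)) => x; rewrite big_nil// cmod0.
apply: bnd_eqf (bnd_leW _ (bndD (h j) IH)) => x; by rewrite big_cons.
Qed.

Lemma pder_coord i j x : pder i (fun y => (y ord0 j)%:C) x (i == j)%:R%:C.
Proof.
rewrite /pder; under eq_fun do rewrite !mxE eqxx /=.
apply: cder_real.
have h : is_derive (0:R) (1:R) (fun t : R => x ord0 j + t * (j == i)%:R) (0 + (j == i)%:R).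
  apply: is_deriveD; apply: (@is_derive_eq _ _ _ _ _ _ _ _ (is_deriveM (is_derive_id _ _) (is_derive_cst _ _ _))).
  by rewrite /GRing.scale/= mulr0 add0r mulr1.
by move: h; rewrite add0r eq_sym.
Qed.

Lemma bnd_coord k j : bnd k wt (fun x => (x ord0 j)%:C).
Proof.
case: k => [|k]; first by split => // x; rewrite cmodC wt_abs.
apply: (@bndS _ _ _ (fun i x => (i == j)%:R%:C)) => [x|i x|i].
- by rewrite cmodC wt_abs.
- exact: pder_coord.
- apply: bnd_leW (bnd_cst k _) => x; rewrite cmodC.
  by case: eqP => _; rewrite ?normr1 ?normr0.
Qed.

End Bnd.

(** * Mean value estimates in several variables and Schwarz's theorem *)

Section Telescope.
Context {R : realType} {n : nat}.
Implicit Types (f g : 'rV[R]_n -> R[i]) (x v : 'rV[R]_n).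

(* Coordinates are changed one at a time; every intermediate point stays in the box spanned by x and x + v. *)
Lemma pderivable_box f x v (L : 'I_n -> R[i]) (B : R) :
  (forall i, pderivable i f) ->
  (forall i (y : 'rV[R]_n), (forall j, `|y ord0 j - x ord0 j| <= `|v ord0 j|) ->
     cmod (partial i f y - L i) <= B) ->
  cmod (f (x + v) - f x - \sum_i (v ord0 i)%:C * L i) <= 2 * B * \sum_i `|v ord0 i|.
Proof.
move=> df bf.
pose y (l : nat) : 'rV[R]_n := x + \row_j (if (j < l)%N then v ord0 j else 0).
have yS (l : 'I_n) : y l.+1 = y l + v ord0 l *: basis_vec l.
  apply/rowP => j; rewrite !mxE eqxx /= -addrA; congr (_ + _).
  rewrite ltnS leq_eqVlt; have [jl|jl] := eqVneq j l.
    by rewrite jl eqxx ltnn /= add0r mulr1.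
  by rewrite mulr0 addr0 -val_eqE/= in jl *; rewrite (negbTE jl).
have -> : f (x + v) - f x = \sum_(l < n) (f (y l.+1) - f (y l)).
  rewrite -(big_mkord xpredT (fun l => f (y l.+1) - f (y l))) (telescope_sumr (fun l => f (y l)))//.
  congr (f _ - f _); rewrite /y; first by congr (_ + _); apply/rowP => j; rewrite mxE ltn_ord.
  by rewrite -[LHS]addr0; congr (_ + _); apply/rowP => j; rewrite !mxE.
rewrite -sumrB (le_trans (cmod_sum _ _ _))// mulr_sumr; apply: ler_sum => l _.
rewrite yS.
pose g (s : R) : R[i] := f (y l + s *: basis_vec l) - s%:C * L l.
have -> : f (y l + v ord0 l *: basis_vec l) - f (y l) - (v ord0 l)%:C * L l = g (v ord0 l) - g 0.
  by rewrite /g scale0r addr0 mul0r subr0 addrAC.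
apply: (@cder_MVT _ g (fun s => partial l f (y l + s *: basis_vec l) - L l)) => s hs.
  have h1 := pder_line (df l (y l + s *: basis_vec l)).
  have h2 : cder (fun s : R => - L l * s%:C) s (- L l * 1).
    have := cderM (cder_cst s (- L l)) (@cder_real _ id s 1 (is_derive_id _ _)).
    by rewrite mul0r add0r.
  have := cderD h1 h2; rewrite mulr1; congr cder.
  by apply/funext => u; rewrite /g mulrC mulrN.
apply: bf => j; rewrite !mxE eqxx /=.
have -> (a b c : R) : a + b + c - a = b + c by ring.
have [->|jl] := eqVneq j l; first by rewrite ltnn add0r mulr1.
by rewrite mulr0 addr0; case: ifP => _; rewrite ?normr0.
Qed.

Definition ccont g x := forall e : R, 0 < e -> exists2 d : R, 0 < d &
  forall y : 'rV[R]_n, (forall k, `|y ord0 k - x ord0 k| <= d) -> cmod (g y - g x) <= e.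

Lemma ccontP g x : ccont g x <->
  {for x, continuous (fun y => complex.Re (g y))} /\
  {for x, continuous (fun y => complex.Im (g y))}.
Proof.
split.
  move=> h.
  have key (r : R[i] -> R) : (forall z w, `|r z - r w| <= cmod (z - w)) ->
      {for x, continuous (fun y => r (g y))}.
    move=> rl; suff : r (g y) @[y --> x] --> r (g x) by [].
    apply/(@cvgrPdist_le _ _ _ _ (nbhs_filter x)) => e e0; have [d d0 hd] := h e e0.
    apply/nbhs_ballP; exists d => //= y hy; rewrite (le_trans (rl _ _))// cmodBC hd// => k.
    by have [_ /(_ ord0 k)] := hy; rewrite /ball/= distrC => /ltW.
  split; apply: key => z w.
    by rewrite -cReN -cReD Re_le_cmod.
  by rewrite -cImN -cImD Im_le_cmod.
move=> [h1 h2] e e0.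
have e20 : 0 < e / 2 by rewrite divr_gt0.
have /(@cvgrPdist_le _ _ _ _ (nbhs_filter x))/(_ _ e20) k1 := h1.
have /(@cvgrPdist_le _ _ _ _ (nbhs_filter x))/(_ _ e20) k2 := h2.
have [d /= d0 hd] := (nbhs_ballP _ _).1 (filterI k1 k2).
exists (d / 2); first by rewrite divr_gt0.
move=> y hy; have /hd[/= a b] : ball x d y.
  split => // i k; rewrite ord1 /ball/= distrC (le_lt_trans (hy k))// ltr_pdivrMr//.
  by rewrite mulr2n mulrDr mulr1 ltrDl.
rewrite (le_trans (cmod_le_ReIm _))// !(cReD, cImD, cReN, cImN) (splitr e).
by rewrite lerD// distrC.
Qed.

(** Schwarz's theorem: both mixed derivatives are compared with the same second difference of f over
    a square of side t. Two nested mean value estimates, each with a factor 2, give an error 4 e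
    t^2. *)
Lemma partialC i j f x :
  pderivable i f -> pderivable j f ->
  pderivable i (partial j f) -> pderivable j (partial i f) ->
  ccont (partial i (partial j f)) x -> ccont (partial j (partial i f)) x ->
  partial i (partial j f) x = partial j (partial i f) x.
Proof.
have key a b : pderivable b f -> pderivable a (partial b f) -> ccont (partial a (partial b f)) x ->
  forall e : R, 0 < e -> exists2 d : R, 0 < d & forall t : R, 0 <= t -> t <= d ->
    cmod (f (x + t *: basis_vec a + t *: basis_vec b) - f (x + t *: basis_vec b) -
      f (x + t *: basis_vec a) + f x - (t ^+ 2)%:C * partial a (partial b f) x) <= 4 * e * t ^+ 2.
  move=> fb fab cf e e0; have [d d0 hd] := cf e e0; exists (d / 2); first by rewrite divr_gt0.
  move=> t t0 td; set A := partial a _ x.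
  pose g (s : R) := f (x + t *: basis_vec a + s *: basis_vec b) - f (x + s *: basis_vec b) - s%:C * (t%:C * A).
  pose g' (s : R) := partial b f (x + t *: basis_vec a + s *: basis_vec b) - partial b f (x + s *: basis_vec b) - t%:C * A.
  have -> : f (x + t *: basis_vec a + t *: basis_vec b) - f (x + t *: basis_vec b) -
      f (x + t *: basis_vec a) + f x - (t ^+ 2)%:C * A = g t - g 0.
    by rewrite /g !scale0r !addr0 rmorphXn/=; ring.
  have -> : 4 * e * t ^+ 2 = 2 * (2 * e * t) * `|t| by rewrite ger0_norm//; ring.
  apply: (@cder_MVT _ g g') => s hs.
    have h1 := pder_line (fb (x + t *: basis_vec a + s *: basis_vec b)).
    have h2 := pder_line (fb (x + s *: basis_vec b)).
    have h3 := cderM (cder_cst s (- (t%:C * A))) (@cder_real _ id s 1 (is_derive_id _ _)).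
    have h4 := cderM (cder_cst s (- 1)) h2.
    have := cderD (cderD h1 h4) h3; rewrite !mul0r !add0r mulr1 mulN1r; congr cder.
    by apply/funext => u; rewrite /g; ring.
  rewrite /g'.
  pose k (u : R) := partial b f (x + s *: basis_vec b + u *: basis_vec a) - u%:C * A.
  have -> : partial b f (x + t *: basis_vec a + s *: basis_vec b) - partial b f (x + s *: basis_vec b) - t%:C * A = k t - k 0.
    by rewrite /k scale0r addr0 mul0r subr0 [in X in _ = X]addrAC (addrAC x).
  rewrite -[in X in _ <= X](ger0_norm t0).
  apply: (@cder_MVT _ k (fun u => partial a (partial b f) (x + s *: basis_vec b + u *: basis_vec a) - A)) => u hu.
    have h1 := pder_line (fab (x + s *: basis_vec b + u *: basis_vec a)).
    have h3 := cderM (cder_cst u (- A)) (@cder_real _ id u 1 (is_derive_id _ _)).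
    have := cderD h1 h3; rewrite !mul0r !add0r mulr1; congr cder.
    by apply/funext => v; rewrite /k; ring.
  apply: hd => m; rewrite !mxE eqxx /=.
  have -> (p q r : R) : p + q + r - p = q + r by ring.
  have hb (q : bool) (w : R) : `|w| <= `|t| -> `|w * q%:R| <= d / 2.
    move=> wt; rewrite normrM; apply: le_trans td; rewrite -(ger0_norm t0).
    by case: q; rewrite ?normr1 ?mulr1 ?normr0 ?mulr0.
  rewrite (splitr d); apply: le_trans (ler_normD _ _) (lerD _ _); exact: hb.
move=> fi fj fij fji ci cj.
apply/eqP; rewrite -subr_eq0; apply/eqP/cmod_eq0/eqP; rewrite eq_le cmod_ge0 andbT.
apply/ler_addgt0Pr => e e0; rewrite add0r.
(* Two errors 4 (e / 8) t^2, one for each order of differentiation, add up to e t^2. *)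
have e80 : 0 < e / 8 by rewrite divr_gt0.
have [d1 d10 h1] := key i j fj fij ci _ e80; have [d2 d20 h2] := key j i fi fji cj _ e80.
pose t := Num.min d1 d2; have t0 : 0 < t by rewrite /t lt_min d10.
have [td1 td2] : t <= d1 /\ t <= d2 by rewrite /t !ge_min !lexx orbT.
have k1 := h1 t (ltW t0) td1; have k2 := h2 t (ltW t0) td2.
have t20 : 0 < t ^+ 2 by rewrite exprn_gt0.
rewrite -(ler_pM2l t20) -[X in X * cmod _](gtr0_norm t20) -cmodC -cmodM.
set A := partial i _ x in k1 *; set A' := partial j _ x in k2 *.
rewrite (_ : _ * _ = (f (x + t *: basis_vec j + t *: basis_vec i) - f (x + t *: basis_vec i)
  - f (x + t *: basis_vec j) + f x - (t ^+ 2)%:C * A') - (f (x + t *: basis_vec i + t *: basis_vec j) - f (x + t *: basis_vec j)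
  - f (x + t *: basis_vec i) + f x - (t ^+ 2)%:C * A)); last first.
  have gen (a b c d' t2 : R[i]) :
    t2 * (A - A') = (a - b - c + d' - t2 * A') - (a - c - b + d' - t2 * A) by ring.
  by rewrite (addrAC x (t *: basis_vec j)); exact: gen.
apply: le_trans (cmodB _ _) _; apply: le_trans (lerD k2 k1) _.
by rewrite -mulrDl mulrC (_ : 4 * (e / 8) + 4 * (e / 8) = e)//; field.
Qed.
End Telescope.

(** * Smooth functions of common polynomial growth *)

Section Cls.
Context {R : realType}.

(** The exponent M is chosen before the order k. A number of integrations by parts fixed by M
    therefore suffices for f and for all its derivatives. *)
Definition cls {n} (f : 'rV[R]_n -> R[i]) :=
  exists M : nat, forall k, exists B : R, bnd k (fun x => B * wt x ^+ M) f.

Section Lip.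
Context {n : nat}.
Implicit Types (f g : 'rV[R]_n -> R[i]) (x v : 'rV[R]_n).

Lemma wt_box x v (y : 'rV[R]_n) :
  (forall j, `|y ord0 j - x ord0 j| <= `|v ord0 j|) -> wt y <= wt x * wt v.
Proof.
move=> h; rewrite {1}(_ : y = x + (y - x)) 1?[RHS]addrC ?subrK// (le_trans (wtD _ _))// ler_pM2l//.
by rewrite /wt lerD2l; apply: ler_sum => j _; rewrite !mxE.
Qed.

Lemma bnd_B_ge0 k M (B : R) f : bnd k (fun x => B * wt x ^+ M) f -> 0 <= B.
Proof. by move=> /(bnd_ge0 0); rewrite wt0 expr1n mulr1. Qed.

Lemma bnd_lip1 M (B : R) f x v : bnd 1 (fun x => B * wt x ^+ M) f ->
  cmod (f (x + v) - f x) <= 2 * (B * (wt x ^+ M * wt v ^+ M)) * \sum_i `|v ord0 i|.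
Proof.
move=> hf; have B0 := bnd_B_ge0 hf.
have := @pderivable_box _ _ f x v (fun=> 0) (B * (wt x ^+ M * wt v ^+ M)).
rewrite big1; last by move=> i _; rewrite mulr0.
rewrite subr0; apply => [i|i y hy]; first exact: (bnd_pderivable i hf).
rewrite subr0 (le_trans (bnd0 _ (bnd_partial i hf)))// ler_wpM2l// -exprMn.
by rewrite lerXn2r ?nnegrE ?mulr_ge0// wt_box.
Qed.

(** [pderivable_box] is applied with the gradient at x as reference values; the variation of the
    gradient is bounded by [bnd_lip1], and the two factors 2 multiply. *)
Lemma bnd_lip2 M (B : R) f x v : bnd 2 (fun x => B * wt x ^+ M) f ->
  cmod (f (x + v) - f x - \sum_i (v ord0 i)%:C * partial i f x)
    <= 4 * (B * (wt x ^+ M * wt v ^+ M)) * (\sum_i `|v ord0 i|) ^+ 2.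
Proof.
move=> hf; have B0 := bnd_B_ge0 hf.
have := @pderivable_box _ _ f x v (fun i => partial i f x)
  (2 * (B * (wt x ^+ M * wt v ^+ M)) * \sum_i `|v ord0 i|).
rewrite [X in _ -> _ -> _ <= X](_ : _ = 4 * (B * (wt x ^+ M * wt v ^+ M)) * (\sum_i `|v ord0 i|) ^+ 2); last by ring.
apply => [i|i y hy]; first exact: (bnd_pderivable i hf).
rewrite {1}(_ : y = x + (y - x)) 1?[RHS]addrC ?subrK// (le_trans (bnd_lip1 x (y - x) (bnd_partial i hf)))//.
have s1 : \sum_i `|(y - x) ord0 i| <= \sum_i `|v ord0 i|.
  by apply: ler_sum => j _; rewrite !mxE.
apply: ler_pM => //.
  by rewrite !mulr_ge0.
rewrite ler_pM2l// ler_wpM2l// ler_pM2l// lerXn2r ?nnegrE//.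
by rewrite /wt lerD2l.
Qed.

Lemma cls_bnd k f : cls f -> exists M (B : R), bnd k (fun x => B * wt x ^+ M) f.
Proof. by move=> [M /(_ k)[B h]]; exists M, B. Qed.

Lemma cls_pderivable i f : cls f -> pderivable i f.
Proof. by move=> /(cls_bnd 1)[M [B /(bnd_pderivable i)]]. Qed.

Lemma cls_partial i f : cls f -> cls (partial i f).
Proof.
by move=> [M h]; exists M => k; have [B hB] := h k.+1; exists B; exact: bnd_partial.
Qed.

Lemma cls_ccont f x : cls f -> ccont f x.
Proof.
move=> /(cls_bnd 1)[M [B h]] e e0.
pose C := 2 * (B * (wt x ^+ M * (1 + n%:R) ^+ M)) * n%:R.
have B0 := bnd_B_ge0 h.
have C0 : 0 <= C by rewrite !mulr_ge0// exprn_ge0// addr_ge0.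
pose d := Num.min 1 (e / (1 + C)).
have d0 : 0 < d by rewrite lt_min ltr01 divr_gt0// ltr_wpDr.
have d1 : d <= 1 by rewrite /d ge_min lexx.
have d2 : d * (1 + C) <= e by rewrite -ler_pdivlMr ?ltr_wpDr// /d ge_min lexx orbT.
exists d => // y hy; rewrite {1}(_ : y = x + (y - x)) 1?[RHS]addrC ?subrK//.
apply: le_trans (bnd_lip1 x (y - x) h) _.
have s1 : \sum_i `|(y - x) ord0 i| <= n%:R * d.
  rewrite -[X in X%:R](card_ord n) -sum1_card natr_sum mulr_suml; apply: ler_sum => j _.
  by rewrite !mxE mul1r.
apply: le_trans d2; apply: (@le_trans _ _ (C * d)); last by rewrite mulrDr mulr1 mulrC lerDr ltW.
rewrite /C -[leRHS]mulrA; apply: ler_pM => //; first by rewrite !mulr_ge0.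
rewrite ler_pM2l// ler_wpM2l// ler_pM2l// lerXn2r ?nnegrE ?addr_ge0//.
rewrite /wt lerD2l (le_trans s1)// ler_piMr//.
Qed.

Lemma cls_partialC i j f : cls f -> partial i (partial j f) = partial j (partial i f).
Proof.
move=> h; apply/funext => x.
have hi := cls_partial i h; have hj := cls_partial j h.
exact: partialC (cls_pderivable i h) (cls_pderivable j h) (cls_pderivable i hj)
  (cls_pderivable j hi) (cls_ccont x (cls_partial i hj)) (cls_ccont x (cls_partial j hi)).
Qed.

Lemma cls_eqf f g : f =1 g -> cls f -> cls g.
Proof. by move=> /funext ->. Qed.

Lemma clsD f g : cls f -> cls g -> cls (fun x => f x + g x).
Proof.
move=> [M hf] [N hg]; exists (maxn M N) => k.
have [B hB] := hf k; have [C hC] := hg k; exists (B + C).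
apply: bnd_leW (bndD hB hC) => x; rewrite mulrDl.
by rewrite lerD// ler_wpM2l ?(bnd_B_ge0 hB) ?(bnd_B_ge0 hC)// wtX_leW// ?leq_maxl ?leq_maxr.
Qed.

Lemma clsM f g : cls f -> cls g -> cls (fun x => f x * g x).
Proof.
move=> [M hf] [N hg]; exists (M + N)%N => k.
have [B hB] := hf k; have [C hC] := hg k; exists (2 ^+ k * (B * C)).
by apply: bnd_eqW (bndM hB hC) => x; rewrite exprD; ring.
Qed.

Lemma cls_cst (c : R[i]) : cls (fun _ : 'rV[R]_n => c).
Proof.
exists 0 => k; exists (cmod c); apply: bnd_leW (bnd_cst k c) => x; by rewrite mulr1.
Qed.

Lemma clsZ (c : R[i]) f : cls f -> cls (fun x => c * f x).
Proof. exact/clsM/cls_cst. Qed.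

Lemma clsN f : cls f -> cls (fun x => - f x).
Proof. by move=> /(clsZ (-1)); apply: cls_eqf => x; rewrite mulN1r. Qed.

Lemma clsB f g : cls f -> cls g -> cls (fun x => f x - g x).
Proof. by move=> hf /clsN; exact: clsD. Qed.

Lemma cls_coord j : cls (fun x : 'rV[R]_n => (x ord0 j)%:C).
Proof. by exists 1 => k; exists 1; apply: bnd_leW (bnd_coord k j) => x; rewrite mul1r. Qed.

Lemma cls_sum (I : Type) (r : seq I) (F : I -> 'rV[R]_n -> R[i]) :
  (forall j, cls (F j)) -> cls (fun x => \sum_(j <- r) F j x).
Proof.
move=> h; elim: r => [|j r IH].
  by apply: cls_eqf (cls_cst 0) => x; rewrite big_nil.
by apply: cls_eqf (clsD (h j) IH) => x; rewrite big_cons.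
Qed.

End Lip.

Section Subst.
Context {p n : nat}.
Implicit Types (f g : 'rV[R]_n -> R[i]) (T : 'M[R]_(p, n)) (c : 'rV[R]_n).

(** The chain rule: moving along the i-th coordinate displaces the argument of f along the i-th row
    of T, where [bnd_lip2] supplies the quadratic error. *)
Lemma pder_subst i f T c (x : 'rV[R]_p) : cls f ->
  pder i (fun x => f (x *m T + c)) x (\sum_j (T i j)%:C * partial j f (x *m T + c)).
Proof.
move=> /(cls_bnd 2)[M [B h]]; have B0 := bnd_B_ge0 h.
set y := x *m T + c; set u := \sum_j _ * _.
pose C := 4 * (B * (wt y ^+ M * wt (row i T) ^+ M)) * (\sum_k `|row i T ord0 k|) ^+ 2.
apply: (@cder_of_quad _ _ 0 u C) => s s1.
rewrite add0r scale0r addr0.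
have -> : (x + s *: basis_vec i) *m T + c = y + s *: row i T.
  by rewrite mulmxDl -scalemxAl -rowE addrAC.
have := bnd_lip2 y (s *: row i T) h.
have -> : \sum_i0 ((s *: row i T) ord0 i0)%:C * partial i0 f y = s%:C * u.
  by rewrite /u mulr_sumr; apply: eq_bigr => j _; rewrite !mxE rmorphM/= mulrA.
move=> /le_trans; apply.
have -> : \sum_i0 `|(s *: row i T) ord0 i0| = `|s| * \sum_k `|row i T ord0 k|.
  by rewrite mulr_sumr; apply: eq_bigr => j _; rewrite !mxE normrM.
rewrite exprMn real_normK ?num_real// [leLHS]mulrCA [leLHS]mulrC ler_wpM2r ?sqr_ge0//.
rewrite /C ler_wpM2r ?sqr_ge0// ler_pM2l// ler_wpM2l// ler_pM2l//.
by rewrite lerXn2r ?nnegrE// wtZ_le.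
Qed.

Lemma partial_subst i f T c (x : 'rV[R]_p) : cls f ->
  partial i (fun x => f (x *m T + c)) x = \sum_j (T i j)%:C * partial j f (x *m T + c).
Proof. by move=> /(pder_subst i T c x)/pder_val. Qed.

(** Each derivative costs one row sum of T through the chain rule, hence the power of [opn] T. *)
Lemma bnd_subst k W f T c : cls f -> bnd k W f ->
  bnd k (fun x => opn T ^+ k * W (x *m T + c)) (fun x => f (x *m T + c)).
Proof.
elim: k f => [|k IH] f cf hf.
  by split => // x; rewrite mul1r (bnd0 _ hf).
have T1 := opn_ge1 T.
apply: (@bndS _ _ _ _ _ (fun i x => \sum_j (T i j)%:C * partial j f (x *m T + c))) => [x|i x|i].
- rewrite (le_trans (bnd0 _ hf))// ler_peMl ?exprn_ege1//; exact: bnd_ge0 _ hf.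
- exact: pder_subst.
- apply: (@bnd_leW _ _ _ (fun x => \sum_j cmod (T i j)%:C * (opn T ^+ k * W (x *m T + c)))).
    move=> x; rewrite -mulr_suml exprS -mulrA ler_wpM2r//.
      by rewrite mulr_ge0 ?exprn_ge0 ?(le_trans _ T1)//; exact: bnd_ge0 _ hf.
    rewrite (eq_bigr (fun j => `|T i j|)); last by move=> j _; rewrite cmodC.
    rewrite /opn (bigD1 i)//= addrCA.
    by rewrite lerDl addr_ge0//; apply: sumr_ge0 => a _; exact: sumr_ge0.
  apply: bnd_sum => j; apply: bndZ; apply: IH; [exact: cls_partial|exact: bnd_partial].
Qed.

Lemma cls_subst f T c : cls f -> cls (fun x => f (x *m T + c)).
Proof.
move=> cf; have [M h] := cf; exists M => k; have [B hB] := h k.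
exists (opn T ^+ k * (B * (opn T * wt c) ^+ M)).
apply: bnd_leW (bnd_subst T c cf hB) => x.
have B0 := bnd_B_ge0 hB; have T1 := opn_ge1 T.
rewrite -!mulrA ler_wpM2l ?exprn_ge0 ?(le_trans _ T1)// ler_wpM2l// -exprMn.
rewrite lerXn2r ?nnegrE ?mulr_ge0 ?(le_trans _ T1)// (le_trans (wtD _ _))//.
by rewrite mulrAC ler_pM2r// wt_mul.
Qed.

End Subst.

Section Slice.
Context {p q : nat}.
Implicit Types (f : 'rV[R]_(p + q) -> R[i]).

Lemma row_mx_lshift (x : 'rV[R]_p) (y : 'rV[R]_q) i (t : R) :
  row_mx x y + t *: basis_vec (lshift q i) = row_mx (x + t *: basis_vec i) y.
Proof.
apply/rowP => j; rewrite !mxE eqxx /=; case: splitP => k jk; rewrite ?mxE ?eqxx /=.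
  by rewrite (_ : (j == lshift q i) = (k == i)) // -!val_eqE/= jk.
rewrite (_ : (j == lshift q i) = false) ?mulr0 ?addr0//.
by rewrite -val_eqE/= jk; apply/eqP => e; have := ltn_ord i; rewrite -e ltnNge leq_addr.
Qed.

Lemma row_mx_rshift (x : 'rV[R]_p) (y : 'rV[R]_q) i (t : R) :
  row_mx x y + t *: basis_vec (rshift p i) = row_mx x (y + t *: basis_vec i).
Proof.
apply/rowP => j; rewrite !mxE eqxx /=; case: splitP => k jk; rewrite ?mxE ?eqxx /=.
  rewrite (_ : (j == rshift p i) = false) ?mulr0 ?addr0//.
  by rewrite -val_eqE/= jk; apply/eqP => e; have := ltn_ord k; rewrite e ltnNge leq_addr.
by rewrite (_ : (j == rshift p i) = (k == i)) // -!val_eqE/= jk eqn_add2l.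
Qed.

Lemma pder_sliceR f x i y l : pder (rshift p i) f (row_mx x y) l ->
  pder i (fun y => f (row_mx x y)) y l.
Proof. by rewrite /pder; under eq_fun do rewrite row_mx_rshift. Qed.

Lemma bnd_sliceR k W f x : bnd k W f ->
  bnd k (fun y => W (row_mx x y)) (fun y => f (row_mx x y)).
Proof.
elim: k f => [|k IH] f hf; first by split => // y; exact: bnd0 _ hf.
apply: (@bndS _ _ _ _ _ (fun i y => partial (rshift p i) f (row_mx x y))) => [y|i y|i].
- exact: bnd0 _ hf.
- by apply: pder_sliceR; exact: bnd_pderivable _ hf _.
- by apply: IH; exact: bnd_partial.
Qed.

Lemma cls_sliceR f x : cls f -> cls (fun y => f (row_mx x y)).
Proof.
move=> [M h]; exists M => k; have [B hB] := h k; exists (B * wt x ^+ M).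
apply: bnd_leW (bnd_sliceR x hB) => y; rewrite -mulrA ler_wpM2l ?(bnd_B_ge0 hB)//.
by rewrite -exprMn lerXn2r ?nnegrE ?mulr_ge0// wt_row.
Qed.

End Slice.

Section Dilate.
Context {n : nat}.
Implicit Types (f : 'rV[R]_n -> R[i]).

Lemma pder_dilate i f (e : R) (x0 x : 'rV[R]_n) : pderivable i f ->
  pder i (fun x => f (e *: (x + x0))) x (e%:C * partial i f (e *: (x + x0))).
Proof.
move=> h; rewrite /pder.
have hc := h (e *: (x + x0)).
have [h1 h2] := hc.
have d (r : R -> R) k : is_derive (0:R) (1:R) r k -> is_derive (0:R) (1:R) (fun t => r (e * t)) (e * k).
  move=> hr; have hr' : is_derive (e * 0 : R) (1:R) r k by rewrite mulr0.
  have hm : is_derive (0:R) (1:R) (fun t : R => e * t) e.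
    apply: (@is_derive_eq _ _ _ _ _ _ _ _ (is_deriveM (is_derive_cst e (0:R) (1:R)) (is_derive_id (0:R) (1:R)))).
    by rewrite /GRing.scale/= mulr1 mul0r addr0.
  have hk := is_derive1_comp hr' hm.
  by apply: (is_derive_eq hk); rewrite /GRing.scale/= mulrC.
have ev t : e *: (x + t *: basis_vec i + x0) = e *: (x + x0) + (e * t) *: basis_vec i.
  by rewrite addrAC scalerDr scalerA.
split; under eq_fun do rewrite ev.
  rewrite (_ : complex.Re (e%:C * partial i f (e *: (x + x0))) = e * complex.Re (partial i f (e *: (x + x0)))); first exact: d h1.
  by rewrite cReM /= mul0r subr0.
rewrite (_ : complex.Im (e%:C * partial i f (e *: (x + x0))) = e * complex.Im (partial i f (e *: (x + x0)))); first exact: d h2.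
by rewrite cImM /= mul0r addr0.
Qed.

Lemma bnd_dilate k W f (e : R) (x0 : 'rV[R]_n) : `|e| <= 1 -> bnd k W f ->
  bnd k (fun x => W (e *: (x + x0))) (fun x => f (e *: (x + x0))).
Proof.
move=> e1; elim: k f => [|k IH] f hf; first by split => // x; exact: bnd0 _ hf.
apply: (@bndS _ _ _ _ _ (fun i x => e%:C * partial i f (e *: (x + x0)))) => [x|i x|i].
- exact: bnd0 _ hf.
- by apply: pder_dilate; exact: bnd_pderivable _ hf.
- apply: bnd_leW (bndZ _ (IH _ (bnd_partial i hf))) => x.
  by rewrite cmodC ler_piMl//; exact: bnd_ge0 _ hf.
Qed.

End Dilate.

End Cls.

(** * Multi-indices and words, symbols and Schwartz functions *)

Section Words.
Context {R : realType} {n : nat}.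
Implicit Types (f g : 'rV[R]_n -> R[i]) (s : seq 'I_n) (alpha : 'I_n -> nat).

Lemma partials_rcons s i f : partials (rcons s i) f = partials s (partial i f).
Proof. by rewrite /partials foldr_rcons. Qed.

Lemma partials_cat s1 s2 f : partials (s1 ++ s2) f = partials s1 (partials s2 f).
Proof. by rewrite /partials foldr_cat. Qed.

Lemma bnd_partials k W f s : (size s <= k)%N -> bnd k W f ->
  forall x, cmod (partials s f x) <= W x.
Proof.
elim/last_ind: s k f => [|s i IH] k f; first by move=> _ hf x; exact: bnd0 _ hf.
rewrite size_rcons; case: k => // k; rewrite ltnS => sk hf x.
by rewrite partials_rcons; apply: (IH k) => //; exact: bnd_partial.
Qed.

Lemma bnd_words k W f :
  (forall s i, pderivable i (partials s f)) ->
  (forall s, (size s <= k)%N -> forall x, cmod (partials s f x) <= W x) ->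
  bnd k W f.
Proof.
elim: k f => [|k IH] f df bf; first by split => //; exact: (bf [::]).
split; first exact: (bf [::]).
move=> i; split; first exact: (df [::] i).
apply: IH => [s j|s sk x]; first by rewrite -partials_rcons; exact: df.
by rewrite -partials_rcons; apply: bf; rewrite size_rcons.
Qed.

Lemma smooth_pderivable f s i : smooth f -> pderivable i (partials s f).
Proof. by move=> h; apply/pderivableP => x; have [_ _ ] := h s; apply. Qed.

Lemma smooth_ccont f s x : smooth f -> ccont (partials s f) x.
Proof. by move=> h; apply/ccontP; have [h1 h2 _] := h s; split; [exact: h1|exact: h2]. Qed.

Lemma smooth_partials f s : smooth f -> smooth (partials s f).
Proof. by move=> h t; rewrite -partials_cat; exact: h. Qed.

Lemma smooth_partialC f i j : smooth f -> partial i (partial j f) = partial j (partial i f).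
Proof.
move=> h; apply/funext => x.
exact: partialC (smooth_pderivable [::] i h) (smooth_pderivable [::] j h)
  (smooth_pderivable [:: j] i h) (smooth_pderivable [:: i] j h)
  (smooth_ccont [:: i; j] x h) (smooth_ccont [:: j; i] x h).
Qed.

Lemma smooth_partialsC f i s : smooth f -> partial i (partials s f) = partials s (partial i f).
Proof.
move=> h; elim: s => [//|j s IH] /=.
by rewrite smooth_partialC ?IH //; exact: smooth_partials.
Qed.

Lemma smooth_partials_catC f s1 s2 : smooth f ->
  partials (s1 ++ s2) f = partials (s2 ++ s1) f.
Proof.
move=> h; elim: s1 s2 => [|i s1 IH] s2; first by rewrite cats0.
by rewrite /= IH smooth_partialsC// -cat_rcons !partials_cat partials_rcons smooth_partialsC.
Qed.

Lemma smooth_partials_perm f s1 s2 : smooth f -> perm_eq s1 s2 -> partials s1 f = partials s2 f.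
Proof.
(* Permutations are generated by exchanges of two adjacent blocks at the head of a word. *)
move=> h s12; apply/esym; apply: (catCA_perm_ind (P := fun s => partials s f = partials s1 f) _ s12) => //.
move=> a b c <-; rewrite !catA (partials_cat (a ++ b)) (partials_cat (b ++ a)).
by rewrite smooth_partials_catC//; exact: smooth_partials.
Qed.

Definition word alpha : seq 'I_n := flatten [seq nseq (alpha k) k | k <- enum 'I_n].

Lemma dmulti_word alpha f : dmulti alpha f = partials (word alpha) f.
Proof.
rewrite /dmulti /word; elim: (enum 'I_n) => //= k r ->.
by rewrite partials_cat; elim: (alpha k) => //= m ->.
Qed.

Lemma size_word alpha : size (word alpha) = mabs alpha.
Proof.
rewrite /word size_flatten /shape -map_comp sumnE big_map /mabs big_enum /=.
by apply: eq_bigr => k _; rewrite size_nseq.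
Qed.

Lemma perm_word s : perm_eq (word (fun k => count_mem k s)) s.
Proof.
apply/allP => i _ /=; apply/eqP.
rewrite /word count_flatten -map_comp sumnE big_map big_enum /= (bigD1 i)//=.
rewrite count_nseq /= eqxx mul1n big1 ?addn0// => k ki.
by rewrite count_nseq /= (negbTE ki).
Qed.

Lemma smooth_partials_dmulti f s : smooth f ->
  partials s f = dmulti (fun k => count_mem k s) f.
Proof.
by move=> h; rewrite dmulti_word; apply: smooth_partials_perm => //; rewrite perm_sym perm_word.
Qed.

Lemma mabs_count s : mabs (fun k => count_mem k s) = size s.
Proof. by rewrite -size_word (perm_size (perm_word s)). Qed.

(* Only finitely many words have length at most k. *)
Lemma words_bound (P : seq 'I_n -> R -> Prop) k :
  (forall s (B C : R), B <= C -> P s B -> P s C) ->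
  (forall s, (size s <= k)%N -> exists B : R, P s B) ->
  exists B : R, forall s, (size s <= k)%N -> P s B.
Proof.
move=> mono; elim: k P mono => [|k IH] P mono h.
  by have [B hB] := h [::] isT; exists B => -[].
have [B0 hB0] := h [::] isT.
have hi i : exists B : R, forall s, (size s <= k)%N -> P (i :: s) B.
  by apply: (IH (fun s B => P (i :: s) B)) => [s B C BC|s sk]; [exact: mono|exact: h].
pose Bi i := projT1 (cid (hi i)).
exists (`|B0| + \sum_i `|Bi i|) => -[|i s] hs.
  by apply: mono hB0; rewrite (le_trans (ler_norm _))// lerDl sumr_ge0.
have := projT2 (cid (hi i)) s hs; apply: mono.
rewrite -/(Bi i) (bigD1 i)//= addrCA (le_trans (ler_norm _))// lerDl addr_ge0//.
exact: sumr_ge0.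
Qed.

Lemma cls_partials f s : cls f -> cls (partials s f).
Proof. by move=> h; elim: s => //= i s; exact: cls_partial. Qed.

Lemma cls_smooth f : cls f -> smooth f.
Proof.
move=> h s; have c := cls_partials s h.
split; [move=> x|move=> x|].
- exact: ((ccontP _ _).1 (cls_ccont x c)).1.
- exact: ((ccontP _ _).1 (cls_ccont x c)).2.
- by move=> k; apply/pderivableP; exact: cls_pderivable.
Qed.

Lemma bnd_dmulti k W f alpha : (mabs alpha <= k)%N -> bnd k W f ->
  forall x, cmod (dmulti alpha f x) <= W x.
Proof. by move=> ak hf; rewrite dmulti_word; apply: bnd_partials hf; rewrite size_word. Qed.

Lemma smooth_bnd f (W : 'rV[R]_n -> R) k : (forall x, 0 <= W x) -> smooth f ->
  (forall alpha, exists C : R, forall x, cmod (dmulti alpha f x) <= C * W x) ->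
  exists B : R, bnd k (fun x => B * W x) f.
Proof.
move=> W0 sf h.
have [B hB] := @words_bound (fun s B => forall x, cmod (partials s f x) <= B * W x) k
  (fun s B C BC hB x => le_trans (hB x) (ler_wpM2r (W0 x) BC))
  (fun s _ => let: ex_intro C hC := h (fun i => count_mem i s) in
     ex_intro _ C (fun x => eq_ind_r (fun g => is_true (cmod (g x) <= C * W x)) (hC x) (smooth_partials_dmulti s sf))).
by exists B; apply: bnd_words => // s i; exact: smooth_pderivable.
Qed.

Lemma japan_ge1 (x : 'rV[R]_n) : 1 <= japan x.
Proof.
rewrite -[X in X <= _]sqrtr1 ler_sqrt; last by rewrite addr_ge0// sumr_ge0// => k _; rewrite -expr2 sqr_ge0.
by rewrite lerDl sumr_ge0// => k _; rewrite -expr2 sqr_ge0.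
Qed.

Lemma japan_sqr (x : 'rV[R]_n) : japan x ^+ 2 = 1 + \sum_k x ord0 k ^+ 2.
Proof. by rewrite sqr_sqrtr// addr_ge0// sumr_ge0// => k _; rewrite -expr2 sqr_ge0. Qed.

Lemma japan_gt0 (x : 'rV[R]_n) : 0 < japan x.
Proof. exact: lt_le_trans (japan_ge1 x). Qed.

Lemma japan_wt (x : 'rV[R]_n) : japan x <= wt x.
Proof.
rewrite -(@ler_pXn2r _ 2) ?nnegrE ?(ltW (japan_gt0 x))// japan_sqr /wt.
rewrite sqrrD expr1n mul1r -addrA lerD2l.
apply: (@le_trans _ _ ((\sum_k `|x ord0 k|) ^+ 2)); last by rewrite lerDr mulrn_wge0.
suff : \sum_k x ord0 k ^+ 2 <= (\sum_k `|x ord0 k|) ^+ 2 /\ 0 <= \sum_k `|x ord0 k| by case.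
elim/big_ind2 : _ => [|a b c d [h1 h2] [h3 h4]|i _]; first by rewrite expr0n.
  by split; nra.
by rewrite real_normK ?num_real// normr_ge0.
Qed.

Lemma wt_japan (x : 'rV[R]_n) : wt x <= (1 + n%:R) * japan x.
Proof.
rewrite /wt mulrDl mul1r lerD ?japan_ge1//.
rewrite -[X in X%:R](card_ord n) -sum1_card natr_sum mulr_suml; apply: ler_sum => j _.
rewrite mul1r -(@ler_pXn2r _ 2) ?nnegrE ?(ltW (japan_gt0 x))// japan_sqr.
rewrite real_normK ?num_real// (bigD1 j)//= addrCA lerDl addr_ge0//.
by apply: sumr_ge0 => k _; rewrite sqr_ge0.
Qed.

(** Transfers real powers between [japan] and [wt]. A negative exponent is reduced to the opposite
    one by inversion, which is why |mu| appears in the constant. *)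
Lemma powR_eqv (mu : R) : exists2 C : R, 0 < C & forall x : 'rV[R]_n,
  japan x `^ mu <= C * wt x `^ mu /\ wt x `^ mu <= C * japan x `^ mu.
Proof.
pose K : R := 1 + n%:R; have K1 : 1 <= K by rewrite lerDl.
have K0 : 0 < K by exact: lt_le_trans K1.
have key (a b : R) : 1 <= a -> 1 <= b -> a <= K * b -> b <= K * a -> a `^ mu <= K `^ `|mu| * b `^ mu.
  move=> a1 b1 ab ba; have a0 : 0 < a := lt_le_trans ltr01 a1.
  have b0 : 0 < b := lt_le_trans ltr01 b1.
  have [m0|m0] := leP 0 mu.
    rewrite (ger0_norm m0) -powRM ?(ltW K0) ?(ltW b0)//.
    by rewrite ge0_ler_powR ?nnegrE ?mulr_ge0 ?(ltW K0) ?(ltW b0) ?(ltW a0).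
  have e c : c `^ mu = (c `^ (- mu))^-1 by rewrite -powRN opprK.
  rewrite (ltr0_norm m0) (e a) (e b) -ler_pdivrMr ?invr_gt0 ?powR_gt0// invrK mulrC ler_pdivrMr ?powR_gt0//.
  rewrite -powRM ?(ltW K0) ?(ltW a0)//.
  by rewrite ge0_ler_powR ?nnegrE ?oppr_ge0 ?mulr_ge0 ?(ltW K0) ?(ltW b0) ?(ltW a0)// ltW.
exists (K `^ `|mu|); first by rewrite powR_gt0.
move=> x; have jw : japan x <= K * wt x.
  by rewrite (le_trans (japan_wt x))// ler_peMl.
have wj : wt x <= K * japan x by exact: wt_japan.
by split; apply: key => //; exact: japan_ge1.
Qed.

Lemma wt_powR_le (mu : R) : exists M : nat, forall x : 'rV[R]_n, wt x `^ mu <= wt x ^+ M.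
Proof.
have [M hM] : exists M : nat, mu <= M%:R.
  by exists (Num.truncn `|mu|).+1; rewrite (le_trans (ler_norm _))// ltW// truncnS_gt.
by exists M => x; rewrite -powR_mulrn// ler_powR.
Qed.

(** The real exponent may be raised to a natural number because [wt] is at least 1, and bounds for
    the finitely many words of length at most k are merged into one constant. *)
Lemma cls_weyl f : cls f <-> weyl_symbol f.
Proof.
split=> [h|[sf [M h]]].
  split; first exact: cls_smooth.
  have [M hM] := h; exists M%:R => alpha; have [B hB] := hM (mabs alpha).
  have [C C0 hC] := powR_eqv M%:R.
  exists (B * C) => z; apply: le_trans (bnd_dmulti (leqnn _) hB z) _.
  rewrite -mulrA ler_wpM2l ?(bnd_B_ge0 hB)// -powR_mulrn//.
  exact: (hC z).2.
have [M' hM'] := wt_powR_le M; have [C C0 hC] := powR_eqv M.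
exists M' => k.
have h2 alpha : exists D : R, forall x, cmod (dmulti alpha f x) <= D * wt x ^+ M'.
  have [D hD] := h alpha; exists (`|D| * C) => x; rewrite (le_trans (hD x))//.
  apply: (@le_trans _ _ (`|D| * japan x `^ M)); first by rewrite ler_wpM2r ?powR_ge0// ler_norm.
  rewrite -mulrA ler_wpM2l// (le_trans (hC x).1)// ler_pM2l//.
by have [|B hB] := @smooth_bnd f (fun x => wt x ^+ M') k _ sf h2; [by []|exists B].
Qed.

Definition rapid f := forall (p k : nat), exists B : R, bnd k (fun x => B / wt x ^+ p) f.

Lemma rapid_schwartz f : rapid f <-> schwartz f.
Proof.
split=> [h|[sf h]].
  split.
    apply: cls_smooth; exists 0 => k; have [B hB] := h 0 k; exists B.
    by apply: bnd_eqW hB => x; rewrite expr0 invr1.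
  move=> alpha p; have [B hB] := h p (mabs alpha); exists B => x.
  have := bnd_dmulti (leqnn _) hB x; rewrite ler_pdivlMr// mulrC; apply: le_trans.
  by rewrite ler_wpM2r// lerXn2r ?nnegrE ?(ltW (japan_gt0 _))// japan_wt.
move=> p k; have [||B hB] := @smooth_bnd f (fun x => (wt x ^+ p)^-1) k _ sf.
- by move=> x; rewrite invr_ge0.
- move=> alpha; have [C hC] := h alpha p; exists (C * (1 + n%:R) ^+ p) => x.
  rewrite ler_pdivlMr// mulrC.
  apply: (@le_trans _ _ ((1 + n%:R) ^+ p * (japan x ^+ p * cmod (dmulti alpha f x)))).
    by rewrite mulrA -exprMn ler_wpM2r// lerXn2r ?nnegrE// ?wt_japan// mulr_ge0 ?addr_ge0// ltW// japan_gt0.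
  by rewrite mulrC ler_wpM2r// exprn_ge0// addr_ge0.
- by exists B.
Qed.

Lemma rapid_cls f : rapid f -> cls f.
Proof.
move=> h; exists 0 => k; have [B hB] := h 0 k; exists B.
by apply: bnd_eqW hB => x; rewrite expr0 invr1.
Qed.

Lemma rapid_partial f i : rapid f -> rapid (partial i f).
Proof. by move=> h p k; have [B hB] := h p k.+1; exists B; exact: bnd_partial. Qed.

(** The decay of g is used at order p + M, so that M powers pay for the growth of f. *)
Lemma rapidM f g : cls f -> rapid g -> rapid (fun x => f x * g x).
Proof.
move=> [M hf] hg p k; have [B hB] := hf k; have [C hC] := hg (p + M)%N k.
exists (2 ^+ k * (B * C)); apply: bnd_eqW (bndM hB hC) => x.
by rewrite exprD invfM; field; rewrite !gt_eqF.
Qed.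

End Words.

(** * Integrals of rapidly decreasing functions *)

Section Integral1.
Context {R : realType}.
Implicit Types (r s : R -> R) (f g : R -> R[i]).
Let mu := @lebesgue_measure R.

(** A concrete sufficient condition for integrability: continuity gives measurability, and the
    dominating function has integral pi. *)
Definition rdom r := continuous r /\ exists B : R, forall t, `|r t| <= B * (1 + t ^+ 2)^-1.

Lemma oneDsqr_gt0' (t : R) : 0 < 1 + t ^+ 2.
Proof. by rewrite ltr_wpDr ?sqr_ge0. Qed.

Lemma integralT_oneDsqr : (\int[mu]_x ((1 + x ^+ 2)^-1)%:E = pi%:E)%E.
Proof.
rewrite ge0_symfun_integralT//=.
- rewrite (_ : [set x | _] = `[0, +oo[%classic); last first.
    by apply/seteqP; split => x/=; rewrite in_itv/= andbT.
  by rewrite integral0y_oneDsqr -EFinM mulrCA divff// mulr1.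
- by move=> x; rewrite invr_ge0 ltW// oneDsqr_gt0'.
- exact: continuous_oneDsqrV.
- by move=> x/=; rewrite sqrrN.
Qed.

Lemma integrable_oneDsqr : mu.-integrable [set: R] (EFin \o (fun x : R => (1 + x ^+ 2)^-1)).
Proof.
have m : measurable_fun [set: R] (fun x : R => (1 + x ^+ 2)^-1).
  exact: (continuous_measurable_fun continuous_oneDsqrV).
apply/integrableP; split; first exact/measurable_EFinP.
under eq_integral do rewrite /= ger0_norm ?invr_ge0 ?(ltW (oneDsqr_gt0' _))//.
by rewrite integralT_oneDsqr ltry.
Qed.

Lemma rdom_integrable r : rdom r -> mu.-integrable [set: R] (EFin \o r).
Proof.
move=> [cr [B hB]].
have h : mu.-integrable [set: R] (fun x : R => (B%:E * ((1 + x ^+ 2)^-1)%:E)%E).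
  exact: integrableZl integrable_oneDsqr.
apply: le_integrable h => //.
  by apply/measurable_EFinP; exact: continuous_measurable_fun.
move=> x _; rewrite -EFinM !abse_EFin lee_fin (le_trans (hB x))// ler_norm//.
Qed.

Lemma rdomD r s : rdom r -> rdom s -> rdom (fun x => r x + s x).
Proof.
move=> [cr [B hB]] [cs [C hC]]; split.
  by move=> x; apply: cvgD; [exact: cr|exact: cs].
exists (B + C) => t; rewrite mulrDl; exact: le_trans (ler_normD _ _) (lerD _ _).
Qed.

Lemma rdomZ r (a : R) : rdom r -> rdom (fun x => a * r x).
Proof.
move=> [cr [B hB]]; split; first by move=> x; apply: cvgM; [exact: cvg_cst|exact: cr].
by exists (`|a| * B) => t; rewrite normrM -mulrA ler_wpM2l.
Qed.

Lemma RintD r s : rdom r -> rdom s ->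
  Rintegral mu setT (fun x => r x + s x) = Rintegral mu setT r + Rintegral mu setT s.
Proof. by move=> hr hs; rewrite RintegralD//; exact: rdom_integrable. Qed.

Lemma RintZ r (a : R) : rdom r ->
  Rintegral mu setT (fun x => a * r x) = a * Rintegral mu setT r.
Proof. by move=> hr; rewrite RintegralZl//; exact: rdom_integrable. Qed.

Lemma Rint_le r (B : R) : rdom r -> (forall t, `|r t| <= B * (1 + t ^+ 2)^-1) ->
  `|Rintegral mu setT r| <= pi * B.
Proof.
move=> hr hB.
have hi := rdom_integrable hr.
have bi : mu.-integrable [set: R] (EFin \o (fun x : R => B * (1 + x ^+ 2)^-1)).
  exact: (integrableZl measurableT B integrable_oneDsqr).
rewrite (le_trans (le_normr_Rintegral _ hi))//.
have -> : pi * B = Rintegral mu setT (fun x : R => B * (1 + x ^+ 2)^-1).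
  rewrite RintegralZl//; last exact: integrable_oneDsqr.
  by rewrite /Rintegral integralT_oneDsqr mulrC.
apply: le_Rintegral => //.
by move/integrable_abse : hi.
Qed.

(** Lebesgue measure is determined by its values on half-open intervals, whose lengths are invariant
    under translation. *)
Lemma lebesgue_measure_shift (a : R) (A : set R) : measurable A ->
  pushforward mu ((fun x => x + a) : _ -> measurableTypeR R) A = mu A.
Proof.
move=> mA; apply: esym; apply: lebesgue_measure_unique => //=.
  by apply: measurable_funD => //; exact: measurable_cst.
move=> _ _ [[b c] _ <-].
rewrite /pushforward.
have -> : (fun x : R => x + a) @^-1` `]b, c]%classic = `](b - a), (c - a)]%classic.
  by apply/seteqP; split => x /=; rewrite !in_itv/= ltrBlDr lerBrDr.
by rewrite !lebesgue_measure_itv/= !lte_fin ltrD2r -!EFinD opprD opprK addrACA addNr addr0.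
Qed.

Lemma rdom_shift r (a : R) : rdom r -> rdom (fun x => r (x + a)).
Proof.
move=> [cr [B hB]]; split.
  move=> x; apply: (@continuous_comp _ _ _ (fun x => x + a) r); last exact: cr.
  by apply: cvgD; [exact: cvg_id|exact: cvg_cst].
have B0 : 0 <= B by have := le_trans (normr_ge0 _) (hB 0); rewrite expr0n/= addr0 invr1 mulr1.
exists (B * (2 * (1 + a ^+ 2))) => t; rewrite (le_trans (hB _))// -mulrA ler_wpM2l//.
rewrite -[leLHS]mul1r ler_pdivrMr ?oneDsqr_gt0'// mulrAC ler_pdivlMr ?oneDsqr_gt0'// mul1r.
have := sqr_ge0 (t + a * 2); have := sqr_ge0 (a * (t + a)); nra.
Qed.

Lemma Rint_shift r (a : R) : rdom r ->
  Rintegral mu setT (fun x => r (x + a)) = Rintegral mu setT r.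
Proof.
move=> hr; congr fine.
have ms : @measurable_fun _ _ (measurableTypeR R) (measurableTypeR R) setT (fun x : R => x + a).
  by apply: measurable_funD => //; exact: measurable_cst.
have h := @integral_pushforward _ _ (measurableTypeR R) (measurableTypeR R) R _ ms
  (@lebesgue_measure R) setT (EFin \o r).
apply: etrans; first (apply: esym; apply: h => //).
- by apply/measurable_EFinP; apply: continuous_measurable_fun; case: hr.
- exact: (rdom_integrable (rdom_shift a hr)).
apply: eq_measure_integral => A mA _; exact: lebesgue_measure_shift.
Qed.

Definition cdom g := rdom (fun t => complex.Re (g t)) /\ rdom (fun t => complex.Im (g t)).

Definition cint1 g : R[i] :=
  Rintegral mu setT (fun t => complex.Re (g t)) +i* Rintegral mu setT (fun t => complex.Im (g t)).

Lemma cint1_lin f g (c : R[i]) : cdom f -> cdom g ->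
  cint1 (fun t => f t + c * g t) = cint1 f + c * cint1 g.
Proof.
move=> [f1 f2] [g1 g2]; apply: complexP; rewrite /cint1 /=.
  under eq_fun do rewrite cReD cReM -mulNr.
  have d1 := rdomZ (complex.Re c) g1; have d2 := rdomZ (- complex.Im c) g2.
  rewrite RintD//; last exact: rdomD.
  by rewrite RintD// !RintZ// cReD cReM /= mulNr.
under eq_fun do rewrite cImD cImM.
have d1 := rdomZ (complex.Re c) g2; have d2 := rdomZ (complex.Im c) g1.
rewrite RintD//; last exact: rdomD.
by rewrite RintD// !RintZ// cImD cImM.
Qed.

Lemma cint1_le f (B : R) : cdom f -> (forall t, cmod (f t) <= B * (1 + t ^+ 2)^-1) ->
  cmod (cint1 f) <= 2 * pi * B.
Proof.
move=> [f1 f2] hB; rewrite (le_trans (cmod_le_ReIm _))// -mulrA mulrDl mul1r lerD//=.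
  by apply: Rint_le => // t; exact: le_trans (Re_le_cmod _) (hB t).
by apply: Rint_le => // t; exact: le_trans (Im_le_cmod _) (hB t).
Qed.

Lemma cint1_shift f (a : R) : cdom f -> cint1 (fun t => f (t + a)) = cint1 f.
Proof.
move=> [f1 f2]; apply: complexP; rewrite /cint1 /=.
  exact: (@Rint_shift (fun t => complex.Re (f t))).
exact: (@Rint_shift (fun t => complex.Im (f t))).
Qed.

Lemma lipschitz_continuous r (C : R) :
  (forall t u : R, `|r (t + u) - r t| <= C * `|u|) -> continuous r.
Proof.
move=> h t; apply/cvgrPdist_le => e e0; near=> u.
rewrite distrC {1}(_ : u = t + (u - t)) 1?[RHS]addrC ?subrK// (le_trans (h _ _))//.
have hu : `|u - t| <= e / (`|C| + 1).
  rewrite distrC; near: u; apply/nbhs_ballP; exists (e / (`|C| + 1)); first by rewrite /= divr_gt0// ltr_wpDl.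
  by move=> u /ltW.
move: hu; rewrite ler_pdivlMr ?ltr_wpDl// mulrC; apply: le_trans.
by rewrite ler_wpM2r// (le_trans (ler_norm _))// lerDl.
Unshelve. all: by end_near.
Qed.

(** Lipschitz continuity is the form of continuity that survives integration over the remaining
    variables, because it is an estimate. *)
Lemma cdom_of f (B C : R) : (forall t u : R, cmod (f (t + u) - f t) <= C * `|u|) ->
  (forall t, cmod (f t) <= B * (1 + t ^+ 2)^-1) -> cdom f.
Proof.
move=> hC hB; split; split.
- apply: (@lipschitz_continuous _ C) => t s; apply: le_trans (hC t s).
  by rewrite -cReN -cReD Re_le_cmod.
- by exists B => t; exact: le_trans (Re_le_cmod _) (hB t).
- apply: (@lipschitz_continuous _ C) => t s; apply: le_trans (hC t s).
  by rewrite -cImN -cImD Im_le_cmod.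
- by exists B => t; exact: le_trans (Im_le_cmod _) (hB t).
Qed.

End Integral1.

(** * Iterated integrals *)

Section IntegralN.
Context {R : realType}.

(** A product weight, so that an iterated integral can be estimated one coordinate at a time. Each
    coordinate then contributes pi for the real part and pi for the imaginary part. *)
Definition PW {n} (x : 'rV[R]_n) : R := \prod_k (1 + x ord0 k ^+ 2)^-1.

Lemma PW_gt0 {n} (x : 'rV[R]_n) : 0 < PW x.
Proof. by apply: prodr_gt0 => k _; rewrite invr_gt0 oneDsqr_gt0'. Qed.

Lemma PW_ge0 {n} (x : 'rV[R]_n) : 0 <= PW x. Proof. exact: ltW (PW_gt0 x). Qed.

Lemma PW_cons {n} (t : R) (v : 'rV[R]_n) :
  PW (row_mx (const_mx t : 'rV[R]_1) v) = (1 + t ^+ 2)^-1 * PW v.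
Proof.
rewrite /PW big_split_ord/= big_ord1 row_mxEl mxE; congr (_ * _).
by apply: eq_bigr => i _; rewrite row_mxEr.
Qed.

Lemma PW_wt {n} (x : 'rV[R]_n) : (wt x ^+ (2 * n))^-1 <= PW x.
Proof.
rewrite /PW prodfV lef_pV2 ?posrE//; last by apply: prodr_gt0 => k _; exact: oneDsqr_gt0'.
rewrite exprM -[X in _ ^+ X](card_ord n) -prodr_const; apply: ler_prod => k _.
rewrite (ltW (oneDsqr_gt0' _))/= -(real_normK (num_real (x ord0 k))).
have h : 1 + `|x ord0 k| <= wt x.
  by rewrite /wt lerD2l (bigD1 k)//= lerDl; exact: sumr_ge0.
apply: (@le_trans _ _ ((1 + `|x ord0 k|) ^+ 2)); last by rewrite lerXn2r ?nnegrE ?addr_ge0.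
by have := normr_ge0 (x ord0 k); nra.
Qed.

(** The derivative is included for the sake of the outer variables: with its decay it makes the
    inner integrals Lipschitz ([igr_lip]), hence continuous and measurable. *)
Definition igr {n} (f : 'rV[R]_n -> R[i]) := exists B : R, bnd 1 (fun x => B * PW x) f.

Lemma cintegral_rVS n (f : 'rV[R]_n.+1 -> R[i]) :
  cintegral_rV f = cint1 (fun t => cintegral_rV (fun v : 'rV[R]_n => f (row_mx (const_mx t : 'rV[R]_1) v))).
Proof. by []. Qed.

Lemma cintegral_rV0 (f : 'rV[R]_0 -> R[i]) : cintegral_rV f = f 0.
Proof. by rewrite /cintegral_rV /=; case: (f 0). Qed.

Lemma igr_lin n (f g : 'rV[R]_n -> R[i]) c : igr f -> igr g -> igr (fun x => f x + c * g x).
Proof.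
move=> [B hB] [C hC]; exists (B + cmod c * C).
by apply: bnd_eqW (bndD hB (bndZ c hC)) => x; rewrite mulrDl mulrA.
Qed.

Lemma PW0 {n} : PW (0 : 'rV[R]_n) = 1.
Proof. by rewrite /PW big1// => k _; rewrite mxE expr0n/= addr0 invr1. Qed.

Lemma igr_B_ge0 n k (B : R) (f : 'rV[R]_n -> R[i]) : bnd k (fun x => B * PW x) f -> 0 <= B.
Proof. by move=> /(bnd_ge0 0); rewrite PW0 mulr1. Qed.

Lemma igr_slice n (f : 'rV[R]_n.+1 -> R[i]) (t : R) : igr f ->
  igr (fun v : 'rV[R]_n => f (row_mx (const_mx t : 'rV[R]_1) v)).
Proof.
move=> [B hB]; exists (B * (1 + t ^+ 2)^-1).
apply: bnd_eqW (@bnd_sliceR _ 1 n _ _ f (const_mx t) hB) => v.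
by rewrite PW_cons mulrA.
Qed.

Lemma igr_lip n (f : 'rV[R]_n.+1 -> R[i]) (B : R) : bnd 1 (fun x => B * PW x) f ->
  forall (t s : R) (v : 'rV[R]_n), cmod (f (row_mx (const_mx (t + s) : 'rV[R]_1) v) -
    f (row_mx (const_mx t : 'rV[R]_1) v)) <= (2 * B * `|s|) * PW v.
Proof.
move=> hB t s v; have B0 := igr_B_ge0 hB.
have e (u : R) : row_mx (const_mx (t + u) : 'rV[R]_1) v =
    row_mx (const_mx t) v + u *: basis_vec (lshift n (ord0 : 'I_1)).
  rewrite row_mx_lshift; congr row_mx; apply/rowP => j; rewrite !mxE.
  by rewrite !ord1 !eqxx mulr1.
rewrite e (_ : 2 * B * `|s| * PW v = 2 * (B * PW v) * `|s|); last by ring.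
apply: pderivable_MVT => [|u _]; first exact: (bnd_pderivable (n := 1 + n) _ hB).
rewrite -e (le_trans (bnd0 _ (bnd_partial (n := 1 + n) _ hB)))// ler_wpM2l//.
rewrite PW_cons ler_piMl ?PW_ge0// invf_le1 ?oneDsqr_gt0'// lerDl sqr_ge0//.
Qed.

(** Linearity and the bound are proved by one induction: in the next dimension the inner integral
    must be Lipschitz in the outer variable, and this is the bound applied to a difference of
    slices, which linearity turns into a single integral. *)
Lemma cintegral_main n :
  (forall (f g : 'rV[R]_n -> R[i]) c, igr f -> igr g ->
     cintegral_rV (fun x => f x + c * g x) = cintegral_rV f + c * cintegral_rV g) /\
  (forall (f : 'rV[R]_n -> R[i]) (B : R), igr f -> (forall x, cmod (f x) <= B * PW x) ->
     cmod (cintegral_rV f) <= (2 * pi) ^+ n * B).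
Proof.
elim: n => [|n [IHl IHb]].
  split => [f g c _ _|f B _ h]; first by rewrite !cintegral_rV0.
  by rewrite cintegral_rV0 mul1r (le_trans (h 0))// PW0 mulr1.
have inner (f : 'rV[R]_n.+1 -> R[i]) (B : R) : igr f -> (forall x, cmod (f x) <= B * PW x) ->
    forall t, cmod (cintegral_rV (fun v : 'rV[R]_n => f (row_mx (const_mx t : 'rV[R]_1) v)))
      <= (2 * pi) ^+ n * B * (1 + t ^+ 2)^-1.
  move=> hf hB t; rewrite -mulrA; apply: IHb; first exact: igr_slice.
  by move=> v; rewrite (le_trans (hB _))// PW_cons mulrA.
have dom (f : 'rV[R]_n.+1 -> R[i]) : igr f ->
    cdom (fun t => cintegral_rV (fun v : 'rV[R]_n => f (row_mx (const_mx t : 'rV[R]_1) v))).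
  move=> hf; have [B hB] := hf.
  apply: (@cdom_of _ _ ((2 * pi) ^+ n * B) ((2 * pi) ^+ n * (2 * B))) => [t s|t]; last first.
    by apply: inner => // x; exact: bnd0 _ hB.
  set f1 := fun v : 'rV[R]_n => _; set f2 := fun v : 'rV[R]_n => f (row_mx (const_mx t : 'rV[R]_1) v).
  have -> : cintegral_rV f1 - cintegral_rV f2 = cintegral_rV (fun v => f1 v + (-1) * f2 v).
    by rewrite IHl ?mulN1r//; exact: igr_slice.
  rewrite -mulrA; apply: IHb; first by apply: igr_lin; exact: igr_slice.
  by move=> v; rewrite mulN1r; exact: igr_lip.
split => [f g c hf hg|f B hf hB].
  rewrite !cintegral_rVS -cint1_lin; [|exact: dom|exact: dom].
  by congr cint1; apply/funext => t; rewrite IHl//; exact: igr_slice.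
rewrite cintegral_rVS exprS -mulrA; apply: cint1_le; first exact: dom.
exact: inner.
Qed.

Lemma cintegral_lin n (f g : 'rV[R]_n -> R[i]) c : igr f -> igr g ->
  cintegral_rV (fun x => f x + c * g x) = cintegral_rV f + c * cintegral_rV g.
Proof. exact: (cintegral_main n).1. Qed.

Lemma cintegral_le n (f : 'rV[R]_n -> R[i]) (B : R) : igr f -> (forall x, cmod (f x) <= B * PW x) ->
  cmod (cintegral_rV f) <= (2 * pi) ^+ n * B.
Proof. exact: (cintegral_main n).2. Qed.

Lemma cintegral_dom n (f : 'rV[R]_n.+1 -> R[i]) : igr f ->
  cdom (fun t => cintegral_rV (fun v : 'rV[R]_n => f (row_mx (const_mx t : 'rV[R]_1) v))).
Proof.
move=> hf; have [B hB] := hf.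
apply: (@cdom_of _ _ ((2 * pi) ^+ n * B) ((2 * pi) ^+ n * (2 * B))) => [t s|t]; last first.
  rewrite -mulrA; apply: cintegral_le; first exact: igr_slice.
  by move=> v; rewrite (le_trans (bnd0 _ hB))// PW_cons mulrA.
set f1 := fun v : 'rV[R]_n => _; set f2 := fun v : 'rV[R]_n => f (row_mx (const_mx t : 'rV[R]_1) v).
have -> : cintegral_rV f1 - cintegral_rV f2 = cintegral_rV (fun v => f1 v + (-1) * f2 v).
  by rewrite cintegral_lin ?mulN1r//; exact: igr_slice.
rewrite -mulrA; apply: cintegral_le; first by apply: igr_lin; exact: igr_slice.
by move=> v; rewrite mulN1r; exact: igr_lip.
Qed.

(** The translation is split into its first coordinate, handled by one-dimensional invariance, and
    the others, handled inside each slice. *)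
Lemma cintegral_shift n (f : 'rV[R]_n -> R[i]) (a : 'rV[R]_n) : igr f ->
  cintegral_rV (fun x => f (x + a)) = cintegral_rV f.
Proof.
elim: n f a => [|n IH] f a hf.
  by rewrite !cintegral_rV0; congr f; apply/rowP => -[].
rewrite !cintegral_rVS.
have e0 : lsubmx (a : 'rV_(1 + n)) = const_mx (a ord0 ord0).
  by apply/rowP => j; rewrite !mxE ord1; congr (a _ _); apply/val_inj.
have ea : a = row_mx (const_mx (a ord0 ord0) : 'rV[R]_1) (rsubmx (a : 'rV_(1 + n))).
  by rewrite -e0 hsubmxK.
pose b := rsubmx (a : 'rV_(1 + n)).
rewrite -(@cint1_shift _ _ (a ord0 ord0) (cintegral_dom hf)).
congr cint1; apply/funext => t.
rewrite -[RHS](IH _ b); last exact: igr_slice.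
congr cintegral_rV; apply/funext => v; rewrite {1}ea; congr f.
apply: etrans; first exact: (@add_row_mx _ 1 1 n).
by congr (@row_mx _ 1 1 n _ _); apply/rowP => j; rewrite !mxE.
Qed.

End IntegralN.

(** * Integration by parts and Gaussians *)

Section IntegralMore.
Context {R : realType}.

(** Rests on t^2 <= 2 (t + a)^2 + 2 a^2, whose two sides differ by (t + 2 a)^2. *)
Lemma oneDsqr_shift (t a : R) : (1 + (t + a) ^+ 2)^-1 <= 2 * (1 + a ^+ 2) * (1 + t ^+ 2)^-1.
Proof.
rewrite ler_pdivlMr ?oneDsqr_gt0'// mulrC ler_pdivrMr ?oneDsqr_gt0'//.
have := sqr_ge0 (t + a * 2); have := sqr_ge0 (a * (t + a)); nra.
Qed.

Definition PWc {n} (a : 'rV[R]_n) : R := \prod_k (2 * (1 + a ord0 k ^+ 2)).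

Lemma PW_shift {n} (x a : 'rV[R]_n) : PW (x + a) <= PWc a * PW x.
Proof.
rewrite /PW /PWc -big_split /=; apply: ler_prod => k _.
by rewrite mxE oneDsqr_shift invr_ge0 ltW// oneDsqr_gt0'.
Qed.

Lemma igr_eqf n (f g : 'rV[R]_n -> R[i]) : f =1 g -> igr f -> igr g.
Proof. by move=> /funext ->. Qed.

Lemma igr_shift n (f : 'rV[R]_n -> R[i]) a : igr f -> igr (fun x => f (x + a)).
Proof.
move=> [B hB]; exists (B * PWc a).
have h := @bnd_dilate R n 1 _ f 1 a _ hB.
apply: bnd_eqf (bnd_leW _ (h _)) => [x|x|]; rewrite ?scale1r ?normr1//.
by rewrite -mulrA ler_wpM2l ?(igr_B_ge0 hB)// PW_shift.
Qed.

Lemma igr0 n : igr (fun _ : 'rV[R]_n => 0).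
Proof. by exists 0; apply: bnd_leW (bnd_cst _ _) => x; rewrite cmod0 mul0r. Qed.

Lemma igrZ n (f : 'rV[R]_n -> R[i]) c : igr f -> igr (fun x => c * f x).
Proof. by move=> /(igr_lin c (igr0 n)); apply: igr_eqf => x; rewrite add0r. Qed.

Lemma cintegral0 n : cintegral_rV (fun _ : 'rV[R]_n => 0) = 0.
Proof.
transitivity (cintegral_rV (fun _ : 'rV[R]_n => 0 + (-1) * 0 : R[i])).
  by congr cintegral_rV; apply/funext => x; rewrite mulr0 addr0.
by rewrite (cintegral_lin (-1) (igr0 n) (igr0 n)) mulN1r subrr.
Qed.

Lemma cintegralZ n (f : 'rV[R]_n -> R[i]) c : igr f ->
  cintegral_rV (fun x => c * f x) = c * cintegral_rV f.
Proof.
move=> hf; have := cintegral_lin c (igr0 n) hf; rewrite cintegral0 add0r => <-.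
by congr cintegral_rV; apply/funext => x; rewrite add0r.
Qed.

Lemma igr_sum n (I : Type) (r : seq I) (F : I -> 'rV[R]_n -> R[i]) : (forall k, igr (F k)) ->
  igr (fun x => \sum_(k <- r) F k x).
Proof.
move=> h; elim: r => [|k r IH]; first by apply: igr_eqf (igr0 n) => x; rewrite big_nil.
by apply: igr_eqf (igr_lin 1 (h k) IH) => x; rewrite big_cons mul1r.
Qed.

Lemma cintegral_sum n (I : Type) (r : seq I) (F : I -> 'rV[R]_n -> R[i]) : (forall k, igr (F k)) ->
  cintegral_rV (fun x => \sum_(k <- r) F k x) = \sum_(k <- r) cintegral_rV (F k).
Proof.
move=> h; elim: r => [|k r IH].
  by rewrite big_nil -[RHS](cintegral0 n); congr cintegral_rV; apply/funext => x; rewrite big_nil.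
rewrite big_cons -IH -[X in _ + X]mul1r -cintegral_lin//; last exact: igr_sum.
by congr cintegral_rV; apply/funext => x; rewrite big_cons mul1r.
Qed.

(* By translation invariance the integral of a difference quotient vanishes. *)
Lemma cintegral_partial n (f : 'rV[R]_n -> R[i]) (B : R) i : bnd 2 (fun x => B * PW x) f ->
  cintegral_rV (partial i f) = 0.
Proof.
move=> hB; have B0 := igr_B_ge0 hB.
have hf : igr f by exists B; exact: bnd_lek hB.
have hd : igr (partial i f) by exists B; exact: bnd_partial.
pose C := (2 * pi) ^+ n * (2 * (2 * (B * 4))) : R.
(* Only the i-th factor of [PW] changes, by at most 2 (1 + u^2) <= 4. *)
have PW4 (x : 'rV[R]_n) (u : R) : `|u| <= 1 -> PW (x + u *: basis_vec i) <= 4 * PW x.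
  move=> u1; rewrite /PW (bigD1 i)//= [X in _ <= _ * X](bigD1 i)//= mulrA.
  rewrite [X in _ * X <= _](eq_bigr (fun k => (1 + x ord0 k ^+ 2)^-1)); last first.
    by move=> k ki; rewrite !mxE eqxx /= (negbTE ki) mulr0 addr0.
  apply: ler_wpM2r; first by apply: prodr_ge0 => k _; rewrite invr_ge0 ltW// oneDsqr_gt0'.
  rewrite !mxE !eqxx mulr1 (le_trans (oneDsqr_shift _ _))//.
  rewrite ler_wpM2r ?invr_ge0 ?(ltW (oneDsqr_gt0' _))//.
  by rewrite -(real_normK (num_real u)); have := normr_ge0 u; nra.
(* In the Taylor formula for a translation by d, the integrals of f and of its translate cancel;
   what remains is d times the wanted integral, against an error O(d^2). *)
have key (d : R) : 0 < d -> d <= 1 -> d * cmod (cintegral_rV (partial i f)) <= C * d ^+ 2.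
  move=> d0 d1.
  have -> : d * cmod (cintegral_rV (partial i f)) =
    cmod (cintegral_rV (fun x => f (x + d *: basis_vec i) + (-1) * (f x + d%:C * partial i f x))).
    rewrite cintegral_lin; [|exact: igr_shift|exact: igr_lin].
    rewrite cintegral_shift// cintegral_lin// mulN1r opprD addrA subrr add0r cmodN cmodM cmodC.
    by rewrite gtr0_norm.
  rewrite /C -[leRHS]mulrA; apply: cintegral_le.
    by apply: igr_lin; [exact: igr_shift|exact: igr_lin].
  move=> x; rewrite mulN1r opprD addrA.
  pose g (s : R) := f (x + s *: basis_vec i) - s%:C * partial i f x.
  rewrite (_ : f _ - _ - _ = g d - g 0); last by rewrite /g scale0r addr0 mul0r subr0 addrAC.
  rewrite (_ : 2 * (2 * (B * 4)) * d ^+ 2 * PW x = 2 * (2 * (B * (4 * PW x)) * d) * `|d|); last by rewrite gtr0_norm//; ring.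
  apply: (@cder_MVT _ g (fun s => partial i f (x + s *: basis_vec i) - partial i f x)) => s hs.
    have h1 := pder_line (bnd_pderivable i hB (x + s *: basis_vec i)).
    have h3 := cderM (cder_cst s (- partial i f x)) (@cder_real _ id s 1 (is_derive_id _ _)).
    have := cderD h1 h3; rewrite !mul0r !add0r mulr1; congr cder.
    by apply/funext => v; rewrite /g mulNr mulrC.
  rewrite (gtr0_norm d0) in hs.
  apply: (@le_trans _ _ (2 * (B * (4 * PW x)) * `|s|)).
    apply: pderivable_MVT => [|u hu]; first exact: bnd_pderivable i (bnd_partial i hB).
    rewrite (le_trans (bnd0 _ (bnd_partial i (bnd_partial i hB))))// ler_wpM2l// PW4//.
    by rewrite (le_trans hu)// (le_trans hs).
  by rewrite ler_wpM2l// !mulr_ge0// PW_ge0.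
apply: cmod_eq0; apply/eqP; rewrite eq_le cmod_ge0 andbT.
apply/ler_addgt0Pr => e e0; rewrite add0r.
have C0 : 0 <= C by rewrite /C !mulr_ge0// exprn_ge0// mulr_ge0// pi_ge0.
pose d := Num.min 1 (e / (1 + C)).
have d0 : 0 < d by rewrite lt_min ltr01 divr_gt0// ltr_wpDr.
have d1 : d <= 1 by rewrite /d ge_min lexx.
have d2 : d * (1 + C) <= e by rewrite -ler_pdivlMr ?ltr_wpDr// /d ge_min lexx orbT.
have := key d d0 d1; rewrite expr2 mulrCA ler_pM2l// => /le_trans; apply.
by apply: le_trans d2; rewrite mulrDr mulr1 mulrC lerDr ltW.
Qed.

Lemma igr_rapid n (f : 'rV[R]_n -> R[i]) k : rapid f -> exists B : R, bnd k (fun x => B * PW x) f.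
Proof.
move=> h; have [B hB] := h (2 * n)%N k; exists B; apply: (bnd_leW _ hB) => x.
have B0 : 0 <= B by have := bnd_ge0 0 hB; rewrite wt0 expr1n invr1 mulr1.
by rewrite ler_wpM2l// PW_wt.
Qed.

Lemma igr_of_rapid n (f : 'rV[R]_n -> R[i]) : rapid f -> igr f.
Proof. by move=> h; have [B hB] := igr_rapid 1 h; exists B. Qed.

Definition gs {n} (x : 'rV[R]_n) : R[i] := (expR (- (\sum_j x ord0 j ^+ 2) / 2))%:C.

Lemma sumsqr_line {n} (x : 'rV[R]_n) i (t : R) :
  \sum_j (x + t *: basis_vec i) ord0 j ^+ 2 = \sum_j x ord0 j ^+ 2 + (t * (2 * x ord0 i) + t ^+ 2).
Proof.
rewrite (bigD1 i)//= [in RHS](bigD1 i)//= !mxE !eqxx /= mulr1.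
rewrite (eq_bigr (fun j => x ord0 j ^+ 2)); last first.
  by move=> j ji; rewrite !mxE eqxx /= (negbTE ji) mulr0 addr0.
ring.
Qed.

Lemma is_derive_quad (c b : R) : is_derive (0 : R) (1 : R) (fun t : R => c + (t * b + t ^+ 2)) b.
Proof.
have h1 := is_deriveM (is_derive_id (0:R) (1:R)) (is_derive_cst b (0:R) (1:R)).
have h2 := is_deriveM (is_derive_id (0:R) (1:R)) (is_derive_id (0:R) (1:R)).
under eq_fun do rewrite expr2.
apply: (@is_derive_eq _ _ _ _ _ _ _ _ (is_deriveD (is_derive_cst c (0:R) (1:R)) (is_deriveD h1 h2))).
by rewrite /GRing.scale /= !(mul0r, mulr0, add0r, addr0, mulr1).
Qed.

Lemma pder_gs {n} i (x : 'rV[R]_n) : pder i gs x (- (x ord0 i)%:C * gs x).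
Proof.
rewrite /pder /gs; under eq_fun do rewrite sumsqr_line.
have hq := is_derive_quad (\sum_j x ord0 j ^+ 2) (2 * x ord0 i).
have hr : is_derive (0:R) (1:R) (fun t : R => - (\sum_j x ord0 j ^+ 2 + (t * (2 * x ord0 i) + t ^+ 2)) / 2) (- x ord0 i).
  have h2 := is_deriveM (is_deriveN hq) (is_derive_cst (2^-1 : R) (0:R) (1:R)).
  apply: (@is_derive_eq _ _ _ _ _ _ _ _ h2).
  by rewrite /GRing.scale /= mulr0 add0r; field.
have hk := cder_real (is_derive1_comp (is_derive_expR _) hr).
apply: cder_eq hk _; rewrite mul0r expr0n/= addr0 addr0 rmorphM rmorphN /=.
by rewrite mulrC.
Qed.

(** With u = |x|^2 / 2 and c = q + 1, the inequality 1 + u / c <= exp (u / c) raised to the power c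
    bounds (1 + 2 u)^c by (2 c)^c exp u, and 1 + 2 u is the square of [japan] x. *)
Lemma gs_le {n} q : exists C : R, forall x : 'rV[R]_n, cmod (gs x) <= C / wt x ^+ q.
Proof.
case: q => [|q].
  exists 1 => x; rewrite expr0 divr1 cmodC ger0_norm ?expR_ge0// -expR0 ler_expR.
  by rewrite mulNr oppr_le0 divr_ge0// sumr_ge0// => j _; rewrite sqr_ge0.
exists ((1 + n%:R) ^+ (2 * q.+1) * (2 * q.+1%:R) ^+ q.+1) => x.
rewrite ler_pdivlMr// cmodC ger0_norm ?expR_ge0//.
pose u : R := (\sum_j x ord0 j ^+ 2) / 2.
have u0 : 0 <= u by rewrite divr_ge0// sumr_ge0// => j _; rewrite sqr_ge0.
rewrite mulNr -/u expRN mulrC ler_pdivrMr ?expR_gt0//.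
apply: (@le_trans _ _ (wt x ^+ (2 * q.+1))); first by rewrite wtX_leW// leq_pmull.
apply: (@le_trans _ _ ((1 + n%:R) ^+ (2 * q.+1) * japan x ^+ (2 * q.+1))).
  by rewrite -exprMn lerXn2r ?nnegrE// ?wt_japan// mulr_ge0 ?addr_ge0// ltW// japan_gt0.
rewrite -mulrA ler_wpM2l ?exprn_ge0 ?addr_ge0// exprM japan_sqr.
have -> : \sum_k x ord0 k ^+ 2 = 2 * u by rewrite /u mulrC divfK.
set c : R := q.+1%:R; have c1 : 1 <= c by rewrite ler1n.
have c0 : 0 < c := lt_le_trans ltr01 c1.
have hu : 1 + u / c <= expR (u / c) by rewrite expR_ge1Dx.
have uc0 : 0 <= 1 + u / c by rewrite addr_ge0// divr_ge0// ltW.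
apply: (@le_trans _ _ ((2 * c * (1 + u / c)) ^+ q.+1)).
  have e : 2 * c * (1 + u / c) = 2 * c + 2 * u by field; rewrite gt_eqF.
  rewrite e; apply: lerXn2r; rewrite ?nnegrE; lra.
rewrite exprMn ler_wpM2l ?exprn_ge0 ?mulr_ge0 ?(ltW c0)//.
have -> : expR u = expR (u / c) ^+ q.+1.
  by rewrite -expRM_natl mulrC divfK ?pnatr_eq0.
by rewrite lerXn2r ?nnegrE ?expR_ge0.
Qed.

Lemma gs_rapid {n} : rapid (@gs n).
Proof.
(* A factor f of polynomial growth is carried along to close the induction: the i-th derivative of f
   gs is (f_i - x_i f) gs, of the same form with the exponent raised by one. *)
suff h k : forall M p (B : R) (f : 'rV[R]_n -> R[i]), bnd k (fun x => B * wt x ^+ M) f ->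
    exists C : R, bnd k (fun x => C / wt x ^+ p) (fun x => f x * gs x).
  move=> p k; have hc : bnd k (fun x : 'rV[R]_n => 1 * wt x ^+ 0) (fun _ => 1).
    by apply: bnd_leW (bnd_cst _ _) => x; rewrite cmod1 mul1r.
  have [C hC] := h k 0 p 1 _ hc; exists C; by apply: bnd_eqf hC => x; rewrite mul1r.
elim: k => [|k IH] M p B f hf; have B0 := bnd_B_ge0 hf.
  have [C hC] := @gs_le n (M + p); exists (B * C); split => // x.
  rewrite cmodM (le_trans (ler_pM _ _ (bnd0 _ hf) (hC x)))//.
  by rewrite exprD invfM [leLHS](_ : _ = B * C / wt x ^+ p)//; field; rewrite !gt_eqF.
have hb : bnd k (fun x => B * wt x ^+ M) f by exact: bnd_lek hf.
have hi i : bnd k (fun x => (B + 2 ^+ k * B) * wt x ^+ M.+1) (fun x => partial i f x - (x ord0 i)%:C * f x).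
  apply: bnd_leW (bndB (bnd_partial i hf) (bndM (bnd_coord k i) hb)) => x.
  rewrite [leRHS]mulrDl; apply: lerD; first by rewrite ler_wpM2l// wtX_leW.
  by rewrite exprS -mulrA ler_wpM2l ?exprn_ge0// mulrCA.
have [C0 hC0] := IH _ p _ _ hb.
have hC' i := IH _ p _ _ (hi i).
pose C i := projT1 (cid (hC' i)).
exists (`|C0| + \sum_i `|C i|).
have wp (x : 'rV[R]_n) : 0 <= (wt x ^+ p)^-1 by rewrite invr_ge0.
apply: (@bndS _ _ _ _ _ (fun i x => (partial i f x - (x ord0 i)%:C * f x) * gs x)) => [x|i x|i].
- rewrite (le_trans (bnd0 _ hC0))// ler_wpM2r// (le_trans (ler_norm _))// lerDl.
  exact: sumr_ge0.
- apply: pder_eq (pderM (bnd_pderivable i hf x) (pder_gs i x)) _; ring.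
- apply: bnd_leW (projT2 (cid (hC' i))) => x; rewrite ler_wpM2r// -/(C i) (bigD1 i)//=.
  by rewrite addrCA (le_trans (ler_norm _))// lerDl addr_ge0//; exact: sumr_ge0.
Qed.

Lemma gs0 {n} : gs (0 : 'rV[R]_n) = 1.
Proof. by rewrite /gs big1 ?oppr0 ?mul0r ?expR0// => j _; rewrite mxE expr0n. Qed.

End IntegralMore.

(** * Oscillatory integrals *)

Section Phase.
Context {R : realType} {D : nat}.
Local Notation N := (D + D)%N.
Implicit Types (Y : 'rV[R]_N) (F G : 'rV[R]_N -> R[i]).

(** The conjugate variable: y_k and eta_k are exchanged, and the derivative of y.eta in the variable
    j is the variable [swap] j. *)
Definition swap (j : 'I_N) : 'I_N :=
  match fintype.split j with inl k => rshift D k | inr k => lshift D k end.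

Lemma swap_l k : swap (lshift D k) = rshift D k.
Proof. by rewrite /swap (unsplitK (inl k)). Qed.

Lemma swap_r k : swap (rshift D k) = lshift D k.
Proof. by rewrite /swap (unsplitK (inr k)). Qed.

Lemma swapK : involutive swap.
Proof. by move=> j; case: (split_ordP j) => k ->; rewrite ?swap_l ?swap_r ?swap_l. Qed.

Definition ph Y : R := dotv (lsubmx Y) (rsubmx Y).
Definition eph Y : R[i] := expi (- ph Y).

Lemma ph_line Y j (t : R) : ph (Y + t *: basis_vec j) = ph Y + t * Y ord0 (swap j).
Proof.
rewrite /ph /dotv; case: (split_ordP j) => k ->; rewrite ?swap_l ?swap_r.
- rewrite [LHS](bigD1 k)//= [in RHS](bigD1 k)//= !mxE !eqxx /= mulr1.
  have -> : (rshift D k == lshift D k) = false by rewrite -val_eqE /= gtn_eqF// ltn_addr.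
  rewrite mulr0 addr0 mulrDl addrAC; congr (_ + _ + _).
  apply: eq_bigr => i ik; rewrite !mxE eqxx /= (inj_eq (@lshift_inj _ _)) (negbTE ik) mulr0 addr0.
  have -> : (rshift D i == lshift D k) = false by rewrite -val_eqE /= gtn_eqF// ltn_addr.
  by rewrite mulr0 addr0.
- rewrite [LHS](bigD1 k)//= [in RHS](bigD1 k)//= !mxE !eqxx /= mulr1.
  have -> : (lshift D k == rshift D k) = false by rewrite -val_eqE /= ltn_eqF// ltn_addr.
  rewrite mulr0 addr0 mulrDr addrAC (mulrC t); congr (_ + _ + _).
  apply: eq_bigr => i ik; rewrite !mxE eqxx /= (inj_eq (@rshift_inj _ _)) (negbTE ik) mulr0 addr0.
  have -> : (lshift D i == rshift D k) = false by rewrite -val_eqE /= ltn_eqF// ltn_addr.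
  by rewrite mulr0 addr0.
Qed.

Lemma pder_eph j Y : pder j eph Y (- 'i%C * (Y ord0 (swap j))%:C * eph Y).
Proof.
rewrite /pder /eph; under eq_fun do rewrite ph_line.
have h : is_derive (0:R) (1:R) (fun t : R => - (ph Y + t * Y ord0 (swap j))) (- Y ord0 (swap j)).
  have h1 := is_deriveM (is_derive_id (0:R) (1:R)) (is_derive_cst (Y ord0 (swap j)) (0:R) (1:R)).
  apply: (@is_derive_eq _ _ _ _ _ _ _ _ (is_deriveN (is_deriveD (is_derive_cst (ph Y) (0:R) (1:R)) h1))).
  by rewrite /GRing.scale /= mulr0 !add0r mulr1.
by apply: cder_eq (cder_expi h) _; rewrite mul0r addr0 (rmorphN (real_complex R)) mulrN !mulNr.
Qed.

Lemma cmod_eph Y : cmod (eph Y) = 1. Proof. exact: cmod_expi. Qed.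

(** Every derivative brings down a coordinate. The exponent grows with k, so the phase factor cannot
    be treated as a member of [cls]. *)
Lemma bnd_eph k : exists C : R, bnd k (fun Y => C * wt Y ^+ k) eph.
Proof.
elim: k => [|k [C hC]].
  by exists 1; split => // Y; rewrite cmod_eph mul1r.
have C0 := bnd_B_ge0 hC.
exists (1 + 2 ^+ k * C).
apply: (@bndS _ _ _ _ _ (fun j Y => - 'i%C * ((Y ord0 (swap j))%:C * eph Y))) => [Y|j Y|j].
- rewrite cmod_eph (le_trans (wtX_ge1 Y k.+1))// ler_peMl// lerDl mulr_ge0// exprn_ge0//.
- by apply: pder_eq (pder_eph j Y) _; rewrite mulrA.
- apply: bnd_leW (bndZ _ (bndM (bnd_coord k (swap j)) hC)) => Y.
  rewrite cmodN cmodi mul1r [leRHS]mulrDl mul1r [wt Y ^+ k.+1]exprS.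
  rewrite (_ : 2 ^+ k * (wt Y * (C * wt Y ^+ k)) = 2 ^+ k * C * (wt Y * wt Y ^+ k)); last by ring.
  by rewrite lerDr mulr_ge0.
Qed.

(** With [qi] = 1 / [rq], the functions [qi] and [kap] are the coefficients of a first-order
    operator reproducing [eph]. As [kap] decays only like 1 / [wt], one integration by parts gains
    one power of the weight. *)
Definition rq Y : R := 1 + \sum_j Y ord0 j ^+ 2.
Definition qi Y : R[i] := ((rq Y)^-1)%:C.
Definition kap (j : 'I_N) Y : R[i] := (Y ord0 j)%:C * qi Y.

Lemma rq_gt0 Y : 0 < rq Y.
Proof. by rewrite ltr_wpDr// sumr_ge0// => j _; rewrite sqr_ge0. Qed.

Lemma pder_qi i Y : pder i qi Y (- 2 * kap i Y * qi Y).
Proof.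
rewrite /pder /qi /rq; under eq_fun do rewrite sumsqr_line addrA.
have hq := is_derive_quad (1 + \sum_j Y ord0 j ^+ 2) (2 * Y ord0 i).
have nz : 1 + \sum_j Y ord0 j ^+ 2 + (0 * (2 * Y ord0 i) + 0 ^+ 2) != 0 :> R.
  by rewrite mul0r expr0n !addr0 gt_eqF// rq_gt0.
have h := cder_real (@is_deriveV _ (fun t : R => 1 + \sum_j Y ord0 j ^+ 2 + (t * (2 * Y ord0 i) + t ^+ 2)) 0 _ 1 nz hq).
apply: cder_eq h _; rewrite mul0r expr0n !addr0 -/(rq Y) /kap /qi.
have q0 : rq Y != 0 by rewrite gt_eqF// rq_gt0.
rewrite -[2%R in RHS](rmorph_nat (real_complex R) 2) -rmorphN -!rmorphM; congr (_%:C).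
by rewrite /GRing.scale /=; field.
Qed.

Lemma pder_kap i j Y : pder i (kap j) Y ((i == j)%:R%:C * qi Y + (- 2) * (kap j Y * kap i Y)).
Proof.
apply: pder_eq (pderM (pder_coord i j Y) (pder_qi i Y)) _.
by rewrite /kap; ring.
Qed.

Lemma wt_rq Y : wt Y ^+ 2 <= (1 + N%:R) ^+ 2 * rq Y.
Proof.
rewrite /rq -japan_sqr -exprMn lerXn2r ?nnegrE// ?wt_japan//.
by rewrite mulr_ge0 ?addr_ge0// ltW// japan_gt0.
Qed.

Lemma bnd_qi_kap k : exists2 C : R, 0 <= C &
  bnd k (fun Y => C / wt Y ^+ 2) qi /\ forall j, bnd k (fun Y => C / wt Y) (kap j).
Proof.
have b0 Y : cmod (qi Y) <= (1 + N%:R) ^+ 2 / wt Y ^+ 2.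
  rewrite cmodC ger0_norm ?invr_ge0 ?(ltW (rq_gt0 _))//.
  by rewrite ler_pdivlMr// mulrC ler_pdivrMr ?rq_gt0// wt_rq.
have b1 j Y : cmod (kap j Y) <= (1 + N%:R) ^+ 2 / wt Y.
  rewrite cmodM cmodC (le_trans (ler_pM _ _ (wt_abs Y j) (b0 Y)))//.
  by rewrite [leLHS](_ : _ = (1 + N%:R) ^+ 2 / wt Y)//; field; rewrite gt_eqF.
have K0 : 0 <= (1 + N%:R) ^+ 2 :> R by rewrite sqr_ge0.
elim: k => [|k [C C0 [hq hk]]].
  by exists ((1 + N%:R) ^+ 2).
have W1 Y : (wt Y)^-1 <= 1 by rewrite invf_le1.
have W2 Y : (wt Y ^+ 2)^-1 <= (wt Y)^-1.
  by rewrite lef_pV2 ?posrE// -{1}[wt Y]expr1 wtX_leW.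
pose C1 : R := 2 * (2 ^+ k * (C * C)).
have C10 : 0 <= C1 by rewrite /C1 !mulr_ge0// exprn_ge0.
have hkk i j : bnd k (fun Y => C1 / wt Y ^+ 2) (fun Y => (- 2) * (kap j Y * kap i Y)).
  apply: bnd_eqW (bndZ (- 2) (bndM (hk j) (hk i))) => Y.
  rewrite cmodN -(rmorph_nat (real_complex R) 2) cmodC ger0_norm// /C1; field.
  by rewrite gt_eqF.
exists ((1 + N%:R) ^+ 2 + C + C1); first by rewrite !addr_ge0.
have wn Y p : 0 <= (wt Y ^+ p)^-1 by rewrite invr_ge0.
split=> [|j].
  apply: (@bndS _ _ _ _ _ (fun i Y => (-2) * (kap i Y * qi Y))) => [Y|i Y|i].
  - by rewrite (le_trans (b0 Y))// ler_wpM2r// -addrA lerDl addr_ge0.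
  - apply: pder_eq (pder_qi i Y) _; ring.
  - apply: bnd_leW (bndZ (- 2) (bndM (hk i) hq)) => Y.
    rewrite cmodN -(rmorph_nat (real_complex R) 2) cmodC ger0_norm//.
    rewrite (_ : 2 * _ = C1 * (wt Y)^-1 / wt Y ^+ 2); last first.
      by rewrite /C1; field; rewrite gt_eqF.
    apply: ler_wpM2r => //; apply: le_trans (ler_piMr C10 (W1 Y)) _.
    by rewrite lerDr addr_ge0.
have wn1 Y : 0 <= (wt Y)^-1 by rewrite invr_ge0.
apply: (@bndS _ _ _ _ _ (fun i Y => (i == j)%:R%:C * qi Y + (- 2) * (kap j Y * kap i Y))) => [Y|i Y|i].
- by rewrite (le_trans (b1 j Y))// ler_wpM2r// -addrA lerDl addr_ge0.
- exact: pder_kap.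
- apply: bnd_leW (bndD (bndZ _ hq) (hkk i j)) => Y.
  apply: (@le_trans _ _ (C / wt Y ^+ 2 + C1 / wt Y ^+ 2)).
    rewrite lerD2r cmodC; case: eqP => _; rewrite ?normr1 ?mul1r// normr0 mul0r.
    by rewrite divr_ge0.
  rewrite -mulrDl (le_trans (ler_wpM2l _ (W2 Y))) ?addr_ge0// ler_wpM2r//.
  by rewrite -addrA lerDr.
Qed.

Lemma cls_qi : cls qi.
Proof.
exists 0 => k; have [C C0 [h _]] := bnd_qi_kap k; exists C; apply: bnd_leW h => Y.
by rewrite mulr1 ler_piMr// invf_le1.
Qed.

Lemma cls_kap j : cls (kap j). Proof. exact/clsM/cls_qi/cls_coord. Qed.

Definition Lt G Y : R[i] :=
  qi Y * G Y - 'i%C * \sum_j partial j (fun y => kap (swap j) y * G y) Y.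

Lemma bnd_Lt k : exists2 C : R, 0 <= C & forall W G, bnd k.+1 W G ->
  bnd k (fun Y => C * (W Y / wt Y)) (Lt G).
Proof.
have [C C0 [hq hk]] := bnd_qi_kap k.+1.
exists (2 ^+ k * C + N%:R * (2 ^+ k.+1 * C)).
  by rewrite addr_ge0 ?mulr_ge0 ?exprn_ge0.
move=> W G hG.
have h1 := bndM (bnd_lek (leqnSn k) hq) (bnd_lek (leqnSn k) hG).
have h2 : bnd k (fun Y => \sum_(j < N) 2 ^+ k.+1 * (C / wt Y * W Y))
    (fun Y => \sum_j partial j (fun y => kap (swap j) y * G y) Y).
  by apply: bnd_sum => j; exact: (bnd_partial j (bndM (hk (swap j)) hG)).
apply: bnd_leW (bndB h1 (bndZ 'i%C h2)) => Y; have W0 := bnd_ge0 Y hG.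
rewrite cmodi mul1r sumr_const card_ord [leRHS]mulrDl; apply: lerD.
  rewrite -!mulrA ler_wpM2l ?exprn_ge0// ler_wpM2l// mulrC ler_wpM2l//.
  by rewrite lef_pV2 ?posrE// -{1}[wt Y]expr1 wtX_leW.
by rewrite -[leLHS]mulr_natl -!mulrA ler_wpM2l// ler_wpM2l ?exprn_ge0// (mulrC (W Y)).
Qed.

Lemma cls_Lt G : cls G -> cls (Lt G).
Proof.
move=> h; apply: clsB; first exact: clsM cls_qi h.
apply: clsZ; apply: cls_sum => j; apply: cls_partial; exact: clsM (cls_kap _) h.
Qed.

Lemma rapid_Lt G : rapid G -> rapid (Lt G).
Proof.
move=> h p k; have [C C0 hC] := bnd_Lt k; have [B hB] := h p k.+1; exists (C * B).
have B0 : 0 <= B by have := bnd_ge0 0 hB; rewrite wt0 expr1n invr1 mulr1.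
apply: bnd_leW (hC _ _ hB) => Y; rewrite -[leRHS]mulrA ler_wpM2l// ler_piMr//.
  by rewrite divr_ge0.
by rewrite invf_le1.
Qed.

Lemma rapid_iter_Lt K G : rapid G -> rapid (iter K Lt G).
Proof. by move=> h; elim: K => //= K; exact: rapid_Lt. Qed.

Lemma bnd_iter_Lt K k : exists2 C : R, 0 <= C & forall W G, bnd (K + k) W G ->
  bnd k (fun Y => C * (W Y / wt Y ^+ K)) (iter K Lt G).
Proof.
elim: K k => [|K IH] k.
  by exists 1 => // W G h; apply: bnd_eqW h => Y; rewrite expr0 divr1 mul1r.
have [C C0 hC] := IH k.+1; have [C' C'0 hC'] := bnd_Lt k.
exists (C' * C); first by rewrite mulr_ge0.
move=> W G h; have := hC W G; rewrite addnS -addSn => /(_ h)/hC'.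
by apply: bnd_eqW => Y; rewrite exprS; field; rewrite !gt_eqF.
Qed.

Lemma Lt_lin F G c : cls F -> cls G ->
  Lt (fun Y => F Y + c * G Y) = (fun Y => Lt F Y + c * Lt G Y).
Proof.
move=> hF hG; apply/funext => Y; rewrite /Lt.
have e j : partial j (fun y => kap (swap j) y * (F y + c * G y)) Y =
    partial j (fun y => kap (swap j) y * F y) Y + c * partial j (fun y => kap (swap j) y * G y) Y.
  have h1 := cls_pderivable j (clsM (cls_kap (swap j)) hF) Y.
  have h2 := cls_pderivable j (clsM (cls_kap (swap j)) hG) Y.
  apply: pder_val; have := pderD h1 (pderZ c h2); congr pder.
  by apply/funext => y; ring.
rewrite (eq_bigr _ (fun j _ => e j)) big_split /= -mulr_sumr; ring.
Qed.

Lemma cls_iter_Lt K F : cls F -> cls (iter K Lt F).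
Proof. by move=> h; elim: K => //= K; exact: cls_Lt. Qed.

Lemma iter_Lt_lin K F G c : cls F -> cls G ->
  iter K Lt (fun Y => F Y + c * G Y) = (fun Y => iter K Lt F Y + c * iter K Lt G Y).
Proof.
move=> hF hG; elim: K => //= K ->.
by rewrite Lt_lin//; exact: cls_iter_Lt.
Qed.

Lemma rapid_eph G k : rapid G -> forall p, exists B : R, bnd k (fun Y => B / wt Y ^+ p) (fun Y => eph Y * G Y).
Proof.
move=> h p; have [C hC] := bnd_eph k; have [B hB] := h (p + k)%N k.
exists (2 ^+ k * (C * B)); apply: bnd_eqW (bndM hC hB) => Y.
by rewrite exprD; field; rewrite !gt_eqF.
Qed.

Lemma rapid_eph' G : rapid G -> rapid (fun Y => eph Y * G Y).
Proof. by move=> h p k; exact: rapid_eph. Qed.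

(* Since eph = L eph for the first-order operator L = 1/q + (i/q) sum_j Y_(swap j) d_j, whose transpose is Lt. *)
Lemma cintegral_Lt G : rapid G ->
  cintegral_rV (fun Y => eph Y * G Y) = cintegral_rV (fun Y => eph Y * Lt G Y).
Proof.
move=> hG.
pose H j := fun Y => eph Y * (kap (swap j) Y * G Y).
have rH j : rapid (H j) by apply/rapid_eph'/rapidM => //; exact: cls_kap.
have dH j Y : partial j (H j) Y = eph Y * partial j (fun y => kap (swap j) y * G y) Y
    - 'i%C * (Y ord0 (swap j))%:C * kap (swap j) Y * (eph Y * G Y).
  have h1 := cls_pderivable j (clsM (cls_kap (swap j)) (rapid_cls hG)) Y.
  apply: pder_val; apply: pder_eq (pderM (pder_eph j Y) h1) _; ring.
(* Pointwise the two integrands differ by a divergence: since the Y_j [kap] j sum to 1 - [qi], the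
   undifferentiated terms of the divergence complete the term [qi] G of [Lt] G to G. *)
have key Y : eph Y * G Y = eph Y * Lt G Y + 'i%C * \sum_j partial j (H j) Y.
  have e : \sum_j (Y ord0 (swap j))%:C * kap (swap j) Y = 1 - qi Y.
    rewrite (reindex_inj (inv_inj swapK)) /=.
    under eq_bigr do rewrite swapK /kap mulrA -expr2 -rmorphXn.
    rewrite -mulr_suml -rmorph_sum /qi -rmorphM -rmorphB; congr (_%:C).
    have q0 := rq_gt0 Y; rewrite (_ : \sum_i _ = rq Y - 1); last by rewrite /rq addrAC subrr add0r.
    by field; rewrite gt_eqF.
  have e2 : \sum_j 'i%C * (Y ord0 (swap j))%:C * kap (swap j) Y * (eph Y * G Y) = 'i%C * (1 - qi Y) * (eph Y * G Y).
    by rewrite -e mulr_sumr mulr_suml; apply: eq_bigr => j _; ring.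
  rewrite (eq_bigr _ (fun j _ => dH j Y)) big_split /= -mulr_sumr sumrN e2 /Lt.
  have ii : 'i%C * 'i%C = -1 :> R[i] by rewrite -expr2 sqr_i.
  set S := \sum_j _; set E := eph Y; set g := G Y; set q := qi Y.
  rewrite (_ : 'i%C * (E * S - 'i%C * (1 - q) * (E * g)) = 'i%C * E * S - 'i%C * 'i%C * ((1 - q) * (E * g))); last by ring.
  by rewrite ii; ring.
rewrite (_ : (fun Y => eph Y * G Y) = fun Y => eph Y * Lt G Y + 'i%C * \sum_j partial j (H j) Y); last exact/funext.
have iH j : igr (partial j (H j)) by apply/igr_of_rapid/rapid_partial.
rewrite cintegral_lin; first last.
- exact: igr_sum.
- exact/igr_of_rapid/rapid_eph'/rapid_Lt.
rewrite cintegral_sum// big1 ?mulr0 ?addr0// => j _.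
by have [B hB] := igr_rapid 2 (rH j); exact: cintegral_partial hB.
Qed.

Lemma cintegral_iter_Lt K G : rapid G ->
  cintegral_rV (fun Y => eph Y * G Y) = cintegral_rV (fun Y => eph Y * iter K Lt G Y).
Proof.
move=> h; elim: K => //= K ->.
by rewrite cintegral_Lt//; exact: rapid_iter_Lt.
Qed.

(* The number of integrations by parts that makes wt ^+ M integrable. *)
Definition KK M := (M + 2 * N).+1.

Definition IK K F := cintegral_rV (fun Y => eph Y * iter K Lt F Y).

(** Of the (KK M).+1 derivatives, KK M are consumed by [Lt] and the last one by the derivative
    contained in [igr]. *)
Lemma IK_spec M : exists2 C : R, 0 <= C & forall B F, bnd (KK M).+1 (fun Y => B * wt Y ^+ M) F ->
  igr (fun Y => eph Y * iter (KK M) Lt F Y) /\ cmod (IK (KK M) F) <= C * B.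
Proof.
have [C C0 hC] := bnd_iter_Lt (KK M) 1; have [E hE] := bnd_eph 1.
have E0 := bnd_B_ge0 hE.
exists ((2 * pi) ^+ N * C); first by rewrite mulr_ge0// exprn_ge0// mulr_ge0// pi_ge0.
move=> B F; rewrite -addn1 => hF; have B0 := bnd_B_ge0 hF.
have h := hC _ _ hF.
(* The powers 2 N give [PW]; the one beyond compensates the factor [wt] that a derivative of [eph]
   produces. *)
have e Y : B * wt Y ^+ M / wt Y ^+ KK M = B / (wt Y ^+ (2 * N) * wt Y).
  by rewrite /KK -addnS exprD -addn1 exprD expr1; field; rewrite !gt_eqF.
have ig : igr (fun Y => eph Y * iter (KK M) Lt F Y).
  exists (2 * (E * (C * B))); apply: bnd_leW (bndM hE h) => Y.
  rewrite e expr1 [leLHS](_ : _ = 2 * (E * (C * B)) * (wt Y ^+ (2 * N))^-1); last first.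
    by field; rewrite !gt_eqF.
  by rewrite ler_wpM2l ?mulr_ge0// PW_wt.
split => //; rewrite -mulrA; apply: cintegral_le => // Y.
rewrite cmodM cmod_eph mul1r (le_trans (bnd0 _ h))// e -mulrA ler_wpM2l// ler_wpM2l//.
rewrite (le_trans _ (PW_wt Y))// lef_pV2 ?posrE ?mulr_gt0// ler_peMr//.
Qed.

End Phase.

(** * Dilated cutoffs *)

Section Dilation.
Context {R : realType} {n : nat}.
Implicit Types (chi : 'rV[R]_n -> R[i]) (Y : 'rV[R]_n).

Lemma rapid_B_ge0 p k (B : R) chi : bnd k (fun x => B / wt x ^+ p) chi -> 0 <= B.
Proof. by move=> h; have := bnd_ge0 0 h; rewrite wt0 expr1n invr1 mulr1. Qed.

Lemma dil_bnd chi (Y0 : 'rV[R]_n) k : rapid chi ->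
  exists2 C : R, 0 <= C & forall e : R, 0 < e <= 1 -> bnd k (fun _ => C) (fun Y => chi (e *: (Y + Y0))).
Proof.
move=> h; have [B hB] := h 0 k; exists B; first exact: rapid_B_ge0 hB.
move=> e /andP[e0 e1]; apply: bnd_leW (bnd_dilate _ _ hB) => [Y|]; last by rewrite gtr0_norm.
by rewrite expr0 divr1.
Qed.

(** Trades one power of the weight for the small factor e; this is the source of the rate C e in all
    regularized limits. *)
Lemma dil_bnd1 chi (Y0 : 'rV[R]_n) k : rapid chi -> chi 0 = 1 ->
  exists2 C : R, 0 <= C & forall e : R, 0 < e <= 1 ->
    bnd k (fun Y => C * e * wt Y) (fun Y => chi (e *: (Y + Y0)) - 1).
Proof.
move=> h h1; have [B hB] := h 0 1%N; have B0 := rapid_B_ge0 hB.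
have hB' : bnd 1 (fun x => B * wt x ^+ 0) chi by apply: bnd_eqW hB => x; rewrite expr0 invr1.
have base e : 0 < e <= 1 -> forall Y, cmod (chi (e *: (Y + Y0)) - 1) <= 2 * B * wt Y0 * e * wt Y.
  move=> /andP[e0 e1] Y; have := bnd_lip1 0 (e *: (Y + Y0)) hB'.
  rewrite add0r h1 !expr0 !mulr1 => /le_trans; apply.
  rewrite -!mulrA ler_wpM2l// ler_wpM2l//.
  apply: (@le_trans _ _ (e * \sum_j `|(Y + Y0) ord0 j|)).
    by rewrite mulr_sumr; apply: ler_sum => j _; rewrite !mxE normrM gtr0_norm.
  rewrite mulrCA ler_pM2l// (le_trans (wt_sum _))// mulrC wtD//.
case: k => [|k].
  exists (2 * B * wt Y0); first by rewrite !mulr_ge0.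
  by move=> e he; split => // Y; exact: base.
have hi i := dil_bnd Y0 k (rapid_partial i h).
pose C i := s2val (cid2 (hi i)).
have C0 i : 0 <= C i by exact: s2valP (cid2 (hi i)).
have hC i : forall e, 0 < e <= 1 -> bnd k (fun _ => C i) (fun Y => partial i chi (e *: (Y + Y0))).
  exact: s2valP' (cid2 (hi i)).
have S0 : 0 <= \sum_i C i by exact: sumr_ge0.
exists (2 * B * wt Y0 + \sum_i C i); first by rewrite addr_ge0// !mulr_ge0.
move=> e he; have /andP[e0 e1] := he.
apply: (@bndS _ _ _ _ _ (fun i Y => e%:C * partial i chi (e *: (Y + Y0)))) => [Y|i Y|i].
- rewrite (le_trans (base e he Y))// ler_wpM2r// ler_wpM2r ?(ltW e0)// lerDl//.
- have := pderB (pder_dilate e Y0 Y (cls_pderivable i (rapid_cls h))) (pder_cst i Y 1).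
  by rewrite subr0.
- apply: bnd_leW (bndZ _ (hC i e he)) => Y; rewrite cmodC gtr0_norm// mulrC.
  rewrite (le_trans _ (ler_peMr _ (wt_ge1 Y)))// ?mulr_ge0 ?addr_ge0 ?mulr_ge0 ?(ltW e0)//.
  rewrite ler_wpM2r ?(ltW e0)// (bigD1 i)//= addrCA lerDl addr_ge0 ?mulr_ge0//.
  exact: sumr_ge0.
Qed.

Lemma dil_rapid chi (Y0 : 'rV[R]_n) (e : R) : 0 < e <= 1 -> rapid chi ->
  rapid (fun Y => chi (e *: (Y + Y0))).
Proof.
move=> /andP[e0 e1] h p k; have [B hB] := h p k; have B0 := rapid_B_ge0 hB.
exists (B * (e^-1 * wt Y0) ^+ p).
apply: bnd_leW (bnd_dilate Y0 _ hB) => [Y|]; last by rewrite gtr0_norm.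
rewrite -mulrA ler_wpM2l// ler_pdivlMr// mulrC ler_pdivrMr//.
(* The constant degenerates as e tends to 0: rapid decay of the dilated cutoff is used for each
   fixed e only. *)
have ew : wt Y <= e^-1 * wt Y0 * wt (e *: (Y + Y0)).
  have h1 : wt Y <= wt (Y + Y0) * wt Y0.
    by have := wtD (Y + Y0) (- Y0); rewrite addrK wtN.
  have h2 : e * wt (Y + Y0) <= wt (e *: (Y + Y0)).
    by rewrite wtZ gtr0_norm// /wt mulrDr mulr1 lerD2r.
  by rewrite (le_trans h1)// mulrC -mulrA mulrCA ler_pM2l// mulrC ler_pdivlMr// mulrC.
by rewrite -exprMn lerXn2r ?nnegrE// !mulr_ge0// invr_ge0 ltW.
Qed.

End Dilation.

Lemma dilE {R : realType} {n} {T : Type} (f : 'rV[R]_n -> T) (e : R) :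
  (fun Y => f (e *: (Y + 0))) = (fun Y => f (e *: Y)).
Proof. by apply/funext => Y; rewrite addr0. Qed.

Lemma le_small {R : realType} (x y C : R) :
  (forall e : R, 0 < e <= 1 -> x <= y + C * e) -> x <= y.
Proof.
move=> h; apply/ler_addgt0Pr => e e0.
pose d := Num.min 1 (e / (1 + `|C|)).
have d0 : 0 < d by rewrite lt_min ltr01 divr_gt0// ltr_wpDr.
have d1 : d <= 1 by rewrite /d ge_min lexx.
have d2 : d * (1 + `|C|) <= e by rewrite -ler_pdivlMr ?ltr_wpDr// /d ge_min lexx orbT.
have hd : 0 < d <= 1 by rewrite d0.
apply: le_trans (h d hd) _; rewrite lerD2l; apply: le_trans d2.
rewrite mulrDr mulr1 (le_trans (ler_wpM2r (ltW d0) (ler_norm C)))// mulrC lerDr ltW//.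
Qed.

(** * Existence and calculus of oscillatory integrals *)

Section Osc.
Context {R : realType} {D : nat}.
Local Notation N := (D + D)%N.
Implicit Types (Y : 'rV[R]_N) (F G chi : 'rV[R]_N -> R[i]).

(** The limit is the convergent integral [IK] K F left by K integrations by parts. These apply to
    the regularized integral too; with the cutoff written as 1 + (chi - 1), the second part is O(e)
    by [dil_bnd1]. The centre Y0 makes room for cutoffs moved by a change of variables. *)
Lemma osc_lim F : cls F -> exists v : R[i], forall chi Y0, rapid chi -> chi 0 = 1 ->
  exists C : R, forall e : R, 0 < e <= 1 ->
    cmod (cintegral_rV (fun Y => chi (e *: (Y + Y0)) * (eph Y * F Y)) - v) <= C * e.
Proof.
move=> cF; have [M hM] := cF; pose K := @KK D M.+1.
exists (IK K F) => chi Y0 rc c1.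
have [C C0 hC] := @IK_spec R D M.+1.
have [B hB] := hM K.+1; have B0 := bnd_B_ge0 hB.
have [A A0 hA] := dil_bnd1 Y0 K.+1 rc c1.
exists (C * (2 ^+ K.+1 * (A * B))) => e he; have /andP[e0 e1] := he.
pose E Y := (chi (e *: (Y + Y0)) - 1) * F Y.
have rd := dil_rapid Y0 he rc.
have cE : cls E by apply: clsM cF; apply: clsB (rapid_cls rd) (cls_cst 1).
have bE : bnd K.+1 (fun Y => 2 ^+ K.+1 * (A * B) * e * wt Y ^+ M.+1) E.
  by apply: bnd_eqW (bndM (hA e he) hB) => Y; rewrite [wt Y ^+ M.+1]exprS; ring.
have [iE lE] := hC _ _ bE.
have bF : bnd K.+1 (fun Y => B * wt Y ^+ M.+1) F.
  by apply: bnd_leW hB => Y; rewrite ler_wpM2l// wtX_leW.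
have [iF _] := hC _ _ bF.
have rG : rapid (fun Y => F Y * chi (e *: (Y + Y0))) by exact: rapidM.
have -> : cintegral_rV (fun Y => chi (e *: (Y + Y0)) * (eph Y * F Y)) = IK K F + 1 * IK K E.
  transitivity (cintegral_rV (fun Y => eph Y * (F Y * chi (e *: (Y + Y0))))).
    by congr cintegral_rV; apply/funext => Y; ring.
  rewrite (cintegral_iter_Lt K rG).
  have -> : (fun Y => F Y * chi (e *: (Y + Y0))) = (fun Y => F Y + 1 * E Y).
    by apply/funext => Y; rewrite /E; ring.
  rewrite (iter_Lt_lin K 1 cF cE) /IK -(cintegral_lin 1 iF iE).
  by congr cintegral_rV; apply/funext => Y; rewrite !mul1r mulrDr.
by rewrite mul1r addrAC subrr add0r (le_trans lE)// !mulrA.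
Qed.

(** A single reference cutoff and an explicit rate: sums, multiples and uniqueness of limits become
    inequalities between constants. *)
Definition oscp F (v : R[i]) := exists C : R, forall e : R, 0 < e <= 1 ->
  cmod (cintegral_rV (fun Y => gs (e *: Y) * (eph Y * F Y)) - v) <= C * e.

Lemma oscp_uniq F v w : oscp F v -> oscp F w -> v = w.
Proof.
move=> [C hC] [C' hC']; apply/eqP; rewrite -subr_eq0; apply/eqP/cmod_eq0/eqP.
rewrite eq_le cmod_ge0 andbT; apply: (@le_small _ _ _ (C + C')) => e he.
set I := cintegral_rV (fun Y => gs (e *: Y) * (eph Y * F Y)).
rewrite add0r (_ : v - w = (I - w) - (I - v)); last by ring.
by rewrite (le_trans (cmodB _ _))// mulrDl addrC lerD ?hC ?hC'.
Qed.

(* Junk value 0 when the oscillatory integral does not exist; it exists for F in cls. *)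
Definition osc F : R[i] := xget 0 [set v | oscp F v].

Lemma oscp_osc F v : oscp F v -> osc F = v.
Proof. by move=> h; exact: (oscp_uniq (xgetPex 0 (ex_intro [set w | oscp F w] v h)) h). Qed.

Lemma osc_spec F chi Y0 : cls F -> rapid chi -> chi 0 = 1 ->
  exists C : R, forall e : R, 0 < e <= 1 ->
    cmod (cintegral_rV (fun Y => chi (e *: (Y + Y0)) * (eph Y * F Y)) - osc F) <= C * e.
Proof.
move=> /osc_lim[v hv] rc c1.
suff -> : osc F = v by exact: hv.
apply: oscp_osc; have [C hC] := hv gs 0 gs_rapid gs0; exists C => e he.
by have := hC e he; under eq_fun do rewrite addr0.
Qed.

Lemma oscpP F : cls F -> oscp F (osc F).
Proof.
move=> h; have [C hC] := osc_spec 0 h gs_rapid gs0; exists C => e he.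
by have := hC e he; under eq_fun do rewrite addr0.
Qed.

Lemma osc_ext F G : F =1 G -> osc F = osc G. Proof. by move=> /funext ->. Qed.

Lemma gs_dil_rapid (e : R) : 0 < e <= 1 -> rapid (fun Y => gs (e *: Y)).
Proof. by move=> he; rewrite -dilE; exact: dil_rapid gs_rapid. Qed.

Lemma rapid_reg F (e : R) : 0 < e <= 1 -> cls F -> rapid (fun Y => gs (e *: Y) * (eph Y * F Y)).
Proof.
move=> he hF; have h := rapid_eph' (rapidM hF (gs_dil_rapid he)).
by move=> p k; have [B hB] := h p k; exists B; apply: bnd_eqf hB => Y; ring.
Qed.

Lemma osc_lin F G c : cls F -> cls G -> osc (fun Y => F Y + c * G Y) = osc F + c * osc G.
Proof.
move=> hF hG; have [C hC] := oscpP hF; have [C' hC'] := oscpP hG.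
apply: oscp_osc; exists (C + cmod c * C') => e he.
rewrite (_ : cintegral_rV _ = cintegral_rV (fun Y => gs (e *: Y) * (eph Y * F Y)) +
   c * cintegral_rV (fun Y => gs (e *: Y) * (eph Y * G Y))); last first.
  rewrite -cintegral_lin; [|exact/igr_of_rapid/rapid_reg|exact/igr_of_rapid/rapid_reg].
  by congr cintegral_rV; apply/funext => Y; ring.
rewrite (_ : _ - _ = (cintegral_rV (fun Y => gs (e *: Y) * (eph Y * F Y)) - osc F) +
   c * (cintegral_rV (fun Y => gs (e *: Y) * (eph Y * G Y)) - osc G)); last by ring.
rewrite (le_trans (cmodD _ _))// cmodM mulrDl lerD ?hC// -mulrA ler_wpM2l ?hC'//.
Qed.

Lemma osc0 : osc (fun _ => 0) = 0.
Proof.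
have h := osc_lin (-1) (cls_cst (0 : R[i])) (cls_cst (0 : R[i])).
transitivity (osc (fun _ => 0 + (-1) * 0)); last by rewrite h mulN1r subrr.
by apply: osc_ext => Y; rewrite mulr0 addr0.
Qed.

Lemma oscZ F c : cls F -> osc (fun Y => c * F Y) = c * osc F.
Proof.
move=> hF; have := osc_lin c (cls_cst 0) hF; rewrite osc0 add0r => <-.
by apply: osc_ext => Y; rewrite add0r.
Qed.

Lemma oscD F G : cls F -> cls G -> osc (fun Y => F Y + G Y) = osc F + osc G.
Proof.
move=> hF hG; have := osc_lin 1 hF hG; rewrite mul1r => <-.
by apply: osc_ext => Y; rewrite mul1r.
Qed.

Lemma oscB F G : cls F -> cls G -> osc (fun Y => F Y - G Y) = osc F - osc G.
Proof.
move=> hF hG; have := osc_lin (-1) hF hG; rewrite mulN1r => <-.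
by apply: osc_ext => Y; rewrite mulN1r.
Qed.

Lemma osc_sum (I : Type) (r : seq I) (F : I -> 'rV[R]_N -> R[i]) : (forall k, cls (F k)) ->
  osc (fun Y => \sum_(k <- r) F k Y) = \sum_(k <- r) osc (F k).
Proof.
move=> h; elim: r => [|k r IH].
  by rewrite big_nil -[RHS]osc0; apply: osc_ext => Y; rewrite big_nil.
rewrite big_cons -IH -oscD//; last exact: cls_sum.
by apply: osc_ext => Y; rewrite big_cons.
Qed.

(** The basic estimate behind all later bounds. It holds for the regularized integrals with a
    constant independent of e, because the derivatives of the dilated Gaussian are bounded
    uniformly, and it passes to the limit. *)
Lemma osc_le M : exists2 C : R, 0 <= C & forall (B : R) F, cls F ->
  bnd (@KK D M).+1 (fun Y => B * wt Y ^+ M) F -> cmod (osc F) <= C * B.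
Proof.
have [C C0 hC] := @IK_spec R D M.
have [A A0 hA] := dil_bnd (0 : 'rV[R]_N) (@KK D M).+1 gs_rapid.
exists (C * (2 ^+ (@KK D M).+1 * A)); first by do ?[apply: mulr_ge0 => //|apply: exprn_ge0].
move=> B F cF hF; have [L hL] := oscpP cF.
apply: (@le_small _ _ _ L) => e he.
set I := cintegral_rV (fun Y => gs (e *: Y) * (eph Y * F Y)).
rewrite (_ : osc F = I - (I - osc F)); last by ring.
rewrite (le_trans (cmodB _ _))// lerD ?hL//.
have rG : rapid (fun Y => F Y * gs (e *: Y)) by apply: rapidM => //; exact: gs_dil_rapid.
have -> : I = IK (@KK D M) (fun Y => F Y * gs (e *: Y)).
  by rewrite /IK -(cintegral_iter_Lt (@KK D M) rG); congr cintegral_rV; apply/funext => Y; ring.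
have hb : bnd (@KK D M).+1 (fun Y => 2 ^+ (@KK D M).+1 * A * B * wt Y ^+ M) (fun Y => F Y * gs (e *: Y)).
  have hA' := hA e he; rewrite (dilE gs) in hA'; have := bndM hF hA'.
  by apply: bnd_eqW => Y; ring.
by have [_] := hC _ _ hb; rewrite !mulrA.
Qed.

(** The integral of the derivative of cutoff times [eph] times F vanishes. Where the derivative
    falls on the cutoff it leaves a factor e, and this term disappears in the limit. *)
Lemma osc_partial F j : cls F -> osc (partial j F) = 'i%C * osc (fun Y => (Y ord0 (swap j))%:C * F Y).
Proof.
move=> cF; have cY : cls (fun Y => (Y ord0 (swap j))%:C * F Y) by exact: clsM (cls_coord _) cF.
have cd := cls_partial j cF.
apply/eqP; rewrite -subr_eq0 -oscZ// -oscB//; last exact: clsZ.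
apply/eqP/oscp_osc.
have [M hM] := cF.
have [C C0 hC] := @IK_spec R D M; have [B hB] := hM (@KK D M).+1; have B0 := bnd_B_ge0 hB.
have [A A0 hA] := dil_bnd (0 : 'rV[R]_N) (@KK D M).+1 (rapid_partial j gs_rapid).
exists (C * (2 ^+ (@KK D M).+1 * (A * B))) => e he; have /andP[e0 e1] := he.
rewrite subr0.
have rg := gs_dil_rapid he.
have dg Y : pder j (fun Y => gs (e *: Y)) Y (e%:C * partial j gs (e *: Y)).
  have := @pder_dilate _ _ j gs e 0 Y (cls_pderivable j (rapid_cls gs_rapid)).
  by rewrite (dilE gs) addr0.
pose H Y := gs (e *: Y) * (eph Y * F Y).
have rH : rapid H by exact: rapid_reg.
have dH Y : pder j H Y (e%:C * partial j gs (e *: Y) * (eph Y * F Y) +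
    gs (e *: Y) * (eph Y * (partial j F Y - 'i%C * ((Y ord0 (swap j))%:C * F Y)))).
  apply: pder_eq (pderM (dg Y) (pderM (pder_eph j Y) (cls_pderivable j cF Y))) _; ring.
have [_ eH] := pder_pderivable dH.
have rdg : rapid (fun Y => partial j gs (e *: Y)).
  by rewrite -(dilE (partial j gs)); exact: dil_rapid (rapid_partial j gs_rapid).
pose P Y := F Y * partial j gs (e *: Y).
have rP : rapid P by exact: rapidM.
have : cintegral_rV (partial j H) = 0.
  by have [B' hB'] := igr_rapid 2 rH; exact: cintegral_partial hB'.
rewrite eH.
pose Q Y := gs (e *: Y) * (eph Y * (partial j F Y - 'i%C * ((Y ord0 (swap j))%:C * F Y))).
have -> : (fun Y => e%:C * partial j gs (e *: Y) * (eph Y * F Y) + gs (e *: Y) *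
    (eph Y * (partial j F Y - 'i%C * ((Y ord0 (swap j))%:C * F Y)))) =
    (fun Y => Q Y + e%:C * (eph Y * P Y)).
  by apply/funext => Y; rewrite /Q /P; ring.
rewrite cintegral_lin; last first.
- exact/igr_of_rapid/rapid_eph'.
- apply/igr_of_rapid/rapid_reg => //; apply: clsB => //; exact: clsZ.
move=> /eqP; rewrite addr_eq0 => /eqP ->; rewrite cmodN cmodM cmodC gtr0_norm// mulrC ler_pM2r//.
rewrite (cintegral_iter_Lt (@KK D M) rP) -/(IK _ _).
have hb : bnd (@KK D M).+1 (fun Y => 2 ^+ (@KK D M).+1 * (A * B) * wt Y ^+ M) P.
  have hA' := hA e he; rewrite (dilE (partial j gs)) in hA'; have := bndM hB hA'.
  by apply: bnd_eqW => Y; ring.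
by have [_] := hC _ _ hb.
Qed.

Lemma osc_coord F k : cls F ->
  osc (fun Y => (Y ord0 k)%:C * F Y) = - 'i%C * osc (partial (swap k) F).
Proof.
move=> hF; rewrite osc_partial// swapK mulrA mulNr -expr2 sqr_i opprK mul1r//.
Qed.

End Osc.

(** * Oscillatory integrals depending on parameters *)

Section OscParam.
Context {R : realType} {D p : nat}.
Local Notation N := (D + D)%N.
Implicit Types (F : 'rV[R]_(p + N) -> R[i]) (x : 'rV[R]_p).

Definition oscs F x : R[i] := osc (fun Y : 'rV[R]_N => F (row_mx x Y)).

Lemma oscs_le M : exists2 C : R, 0 <= C & forall (B : R) F, cls F ->
  bnd (@KK D M).+1 (fun Y => B * wt Y ^+ M) F -> forall x, cmod (oscs F x) <= C * B * wt x ^+ M.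
Proof.
have [C C0 hC] := @osc_le R D M; exists C => // B F cF hF x.
rewrite -mulrA; apply: hC; first exact: cls_sliceR.
apply: bnd_leW (bnd_sliceR x hF) => Y; rewrite -mulrA ler_wpM2l ?(bnd_B_ge0 hF)//.
by rewrite -exprMn lerXn2r ?nnegrE ?mulr_ge0// wt_row.
Qed.

(** The second-order Taylor remainder in x is O(s^2) together with its derivatives in Y, so [osc_le]
    gives a quadratic error for the integral. *)
Lemma pder_oscs F i x : cls F -> pder i (oscs F) x (oscs (partial (lshift N i) F) x).
Proof.
move=> cF; have [M hM] := cF.
(* Stable under differentiation in Y: a derivative of the remainder of G is the remainder of the
   derivative of G, since partial derivatives commute. *)
pose Rs (s : R) G (Y : 'rV[R]_N) : R[i] := G (row_mx (x + s *: basis_vec i) Y) - G (row_mx x Y)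
  - s%:C * partial (lshift N i) G (row_mx x Y).
have base (s : R) G (B : R) Y : `|s| <= 1 -> bnd 2 (fun Y => B * wt Y ^+ M) G ->
    cmod (Rs s G Y) <= 4 * B * (wt x * 2) ^+ M * s ^+ 2 * wt Y ^+ M.
  move=> s1 hG; have B0 := bnd_B_ge0 hG.
  rewrite /Rs -row_mx_lshift; set v := s *: basis_vec (lshift N i).
  have hv : \sum_j `|v ord0 j| = `|s|.
    rewrite (bigD1 (lshift N i))//= big1 ?addr0; first by rewrite !mxE !eqxx mulr1.
    by move=> j ji; rewrite !mxE eqxx /= (negbTE ji) mulr0 normr0.
  have := bnd_lip2 (row_mx x Y) v hG.
  rewrite (_ : \sum_j _ * _ = s%:C * partial (lshift N i) G (row_mx x Y)); last first.
    rewrite (bigD1 (lshift N i))//= big1 ?addr0; first by rewrite !mxE !eqxx mulr1.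
    by move=> j ji; rewrite !mxE eqxx /= (negbTE ji) mulr0 mul0r.
  move=> /le_trans; apply; rewrite hv real_normK ?num_real//.
  rewrite [leRHS](_ : _ = 4 * (B * ((wt x * 2) ^+ M * wt Y ^+ M)) * s ^+ 2); last by ring.
  rewrite ler_wpM2r ?sqr_ge0// ler_pM2l// ler_wpM2l// -!exprMn.
  rewrite lerXn2r ?nnegrE ?mulr_ge0// (mulrAC (wt x)).
  by rewrite ler_pM// ?wt_row// /wt hv -[leRHS]/(1 + 1) lerD2l.
have bRs k (s : R) G (B : R) : `|s| <= 1 -> cls G -> bnd k.+2 (fun Y => B * wt Y ^+ M) G ->
    bnd k (fun Y => 4 * B * (wt x * 2) ^+ M * s ^+ 2 * wt Y ^+ M) (Rs s G).
  move=> s1; elim: k G => [|k IH] G cG hG.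
    by split => // Y; exact: base.
  apply: (@bndS _ _ _ _ _ (fun j Y => Rs s (partial (rshift p j) G) Y)) => [Y|j Y|j].
  - exact: base s1 (bnd_lek (isT : (2 <= k.+3)%N) hG).
  - have d := cls_pderivable (rshift p j) cG.
    have d' := cls_pderivable (rshift p j) (cls_partial (lshift N i) cG).
    have h1 := pder_sliceR (d (row_mx (x + s *: basis_vec i) Y)).
    have h2 := pder_sliceR (d (row_mx x Y)).
    have h3 := pder_sliceR (d' (row_mx x Y)).
    have := pderB (pderB h1 h2) (pderZ s%:C h3).
    by rewrite cls_partialC.
  - by apply: IH; [exact: cls_partial|exact: bnd_partial].
have [C C0 hC] := @osc_le R D M; have [B hB] := hM (@KK D M).+3.
apply: (@cder_of_quad _ _ _ _ (C * (4 * B * (wt x * 2) ^+ M))) => s s1.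
rewrite add0r scale0r addr0.
rewrite /oscs -oscZ; last exact/cls_sliceR/cls_partial.
have c1 := cls_sliceR (x + s *: basis_vec i) cF; have c2 := cls_sliceR x cF.
have c3 := clsZ s%:C (cls_sliceR x (cls_partial (lshift N i) cF)).
rewrite -oscB// -oscB//; last exact: clsB.
rewrite -mulrA; apply: hC; first by apply: clsB => //; exact: clsB.
exact: bRs.
Qed.

Lemma cls_oscs F : cls F -> cls (oscs F).
Proof.
move=> cF; have [M hM] := cF; exists M => k.
have [C C0 hC] := @oscs_le M.
elim: k F cF hM => [|k IH] F cF hM.
  have [B hB] := hM (@KK D M).+1; exists (C * B); split => // x.
  exact: hC.
have [B hB] := hM (@KK D M).+1; have B0 := bnd_B_ge0 hB.
have hi (i : 'I_p) : exists B, bnd k (fun x => B * wt x ^+ M) (oscs (partial (lshift N i) F)).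
  apply: IH; first exact: cls_partial.
  by move=> l; have [B' hB'] := hM l.+1; exists B'; exact: bnd_partial.
pose A i := projT1 (cid (hi i)).
exists (C * B + \sum_i `|A i|).
have S0 : 0 <= \sum_i `|A i| by apply: sumr_ge0.
apply: (@bndS _ _ _ _ _ (fun i x => oscs (partial (lshift N i) F) x)) => [x|i x|i].
- by rewrite (le_trans (hC _ _ cF hB x))// ler_wpM2r// lerDl.
- exact: pder_oscs.
- apply: bnd_leW (projT2 (cid (hi i))) => x; rewrite ler_wpM2r// -/(A i) (bigD1 i)//=.
  by rewrite addrCA (le_trans (ler_norm _))// lerDl addr_ge0 ?mulr_ge0//; exact: sumr_ge0.
Qed.

End OscParam.

(** * Families generated by second-order operators *)

Section Flow.
Context {R : realType} {n : nat}.
Implicit Types (F G : 'rV[R]_n -> R[i]) (X : 'rV[R]_n).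
Local Notation fam := (R * R -> 'rV[R]_n -> R[i]).

(** Times up to 2 leave room for a step of length at most 1 from any base time in [-1, 1]. The
    increment is nonzero because quotients by its square are formed, and the condition is invariant
    under a -> -a, as time reversal requires. *)
Definition okp (a : R * R) := [/\ `|a.1| <= 2, `|a.1 + a.2| <= 2, 0 < `|a.2| & `|a.2| <= 1].

(* A family indexed by a base time a.1 and an increment a.2, with derivative bounds uniform in a. *)
Definition bfam (H : fam) := exists M : nat, forall k, exists B : R,
  forall a, okp a -> bnd k (fun x => B * wt x ^+ M) (H a).

Lemma bfam_cls H a : bfam H -> okp a -> cls (H a).
Proof. by move=> [M h] oa; exists M => k; have [B hB] := h k; exists B; exact: hB. Qed.

Lemma bfam_cst F : cls F -> bfam (fun _ => F).
Proof. by move=> [M h]; exists M => k; have [B hB] := h k; exists B. Qed.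

Lemma bfam_partial i H : bfam H -> bfam (fun a => partial i (H a)).
Proof.
by move=> [M h]; exists M => k; have [B hB] := h k.+1; exists B => a /hB; exact: bnd_partial.
Qed.

Lemma bfamD H H' : bfam H -> bfam H' -> bfam (fun a x => H a x + H' a x).
Proof.
move=> [M h] [M' h']; exists (maxn M M') => k.
have [B hB] := h k; have [B' hB'] := h' k; exists (`|B| + `|B'|) => a oa.
apply: bnd_leW (bndD (hB a oa) (hB' a oa)) => x; rewrite mulrDl.
have le (b : R) (m m' : nat) : (m <= m')%N -> b * wt x ^+ m <= `|b| * wt x ^+ m'.
  move=> mm; apply: (@le_trans _ _ (`|b| * wt x ^+ m)); first by rewrite ler_wpM2r// ler_norm.
  by rewrite ler_wpM2l// wtX_leW.
by rewrite lerD// le// ?leq_maxl ?leq_maxr.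
Qed.

Lemma bfamZ (c : R * R -> R[i]) (C : R) H : (forall a, okp a -> cmod (c a) <= C) -> bfam H ->
  bfam (fun a x => c a * H a x).
Proof.
move=> hc [M h]; exists M => k; have [B hB] := h k; exists (C * B) => a oa.
apply: bnd_leW (bndZ (c a) (hB a oa)) => x; rewrite -mulrA ler_wpM2r ?hc//.
exact: bnd_ge0 x (hB a oa).
Qed.

Lemma bfam_eq H H' : (forall a, okp a -> H a =1 H' a) -> bfam H -> bfam H'.
Proof.
move=> e [M h]; exists M => k; have [B hB] := h k; exists B => a oa.
by apply: bnd_eqf (hB a oa); exact: e.
Qed.

Lemma bfam_sum (I : Type) (r : seq I) (H : I -> fam) :
  (forall i, bfam (H i)) -> bfam (fun a x => \sum_(i <- r) H i a x).
Proof.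
move=> h; elim: r => [|i r IH].
  by apply: bfam_eq (bfam_cst (cls_cst 0)) => a _ x; rewrite big_nil.
by apply: bfam_eq (bfamD (h i) IH) => a _ x; rewrite big_cons.
Qed.

(* Operators commuting with the derivatives only need a pointwise bound. *)
Lemma bfam_op (E : R * R -> ('rV[R]_n -> R[i]) -> 'rV[R]_n -> R[i]) :
  (forall a F i, cls F -> pderivable i (E a F) /\ partial i (E a F) = E a (partial i F)) ->
  (forall M, exists K M' (C : R), forall a, okp a -> forall F (B : R), cls F ->
     bnd K (fun x => B * wt x ^+ M) F -> forall X, cmod (E a F X) <= C * B * wt X ^+ M') ->
  forall H, bfam H -> bfam (fun a => E a (H a)).
Proof.
move=> hE hb H hH; have [M hM] := hH; have [K [M' [C hC]]] := hb M; exists M' => k.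
have [B hB] := hM (K + k)%N; exists (C * B) => a oa.
have : bnd (K + k) (fun x => B * wt x ^+ M) (H a) by exact: hB.
have : cls (H a) by exact: bfam_cls oa.
elim: k (H a) {hB} => [|k IH] F cF hF.
  by split => // X; rewrite addn0 in hF; exact: hC hF X.
split => [X|i]; first by apply: hC => //; exact: bnd_lek (leq_addr _ _) hF.
have [d e] := hE a F i cF; split => //; rewrite e; apply: IH; first exact: cls_partial.
by apply: bnd_partial; rewrite -addnS.
Qed.

Definition Qop (q : 'I_n -> 'I_n -> R[i]) F X : R[i] :=
  \sum_l \sum_j q l j * partial l (partial j F) X.

Lemma cls_Qop q F : cls F -> cls (Qop q F).
Proof. by move=> h; apply: cls_sum => l; apply: cls_sum => j; apply: clsZ; do 2 apply: cls_partial. Qed.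

Lemma partial_Qop q i F : cls F -> pderivable i (Qop q F) /\ partial i (Qop q F) = Qop q (partial i F).
Proof.
move=> cF; apply: pder_pderivable => Z; rewrite /Qop.
apply: pder_sum => l; apply: pder_sum => j; apply: pderZ.
have c2 : cls (partial l (partial j F)) by do 2 apply: cls_partial.
have := cls_pderivable i c2 Z.
by rewrite (cls_partialC i l (cls_partial j cF)) (cls_partialC i j cF).
Qed.

Lemma bfam_Qop q H : bfam H -> bfam (fun a => Qop q (H a)).
Proof.
move=> h; apply: bfam_sum => l; apply: bfam_sum => j.
by apply: (@bfamZ _ (cmod (q l j))) => //; do 2 apply: bfam_partial.
Qed.

(* A one-parameter family commuting with derivatives, with generator Qop q: the
   last clause bounds the second-order Taylor quotient in the time increment. *)
Definition flow (L : R -> ('rV[R]_n -> R[i]) -> 'rV[R]_n -> R[i]) (q : 'I_n -> 'I_n -> R[i]) :=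
  [/\ forall s F, cls F -> cls (L s F),
      forall s F G c, cls F -> cls G -> L s (fun x => F x + c * G x) = (fun x => L s F x + c * L s G x),
      forall s i F, cls F -> partial i (L s F) = L s (partial i F),
      forall (t : R * R -> R) H, (forall a, okp a -> `|t a| <= 2) -> bfam H -> bfam (fun a => L (t a) (H a)) &
      forall H, bfam H -> bfam (fun a x => (a.2 ^- 2)%:C *
        (L (a.1 + a.2) (H a) x - L a.1 (H a) x - a.2%:C * L a.1 (Qop q (H a)) x))].

Section FlowTheory.
Variables (L : R -> ('rV[R]_n -> R[i]) -> 'rV[R]_n -> R[i]) (q : 'I_n -> 'I_n -> R[i]).
Hypothesis fL : flow L q.

Lemma flow_cls s F : cls F -> cls (L s F). Proof. by case: fL => h _ _ _ _; exact: h. Qed.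
Lemma flow_lin s F G c : cls F -> cls G ->
  L s (fun x => F x + c * G x) = (fun x => L s F x + c * L s G x).
Proof. by case: fL => _ h _ _ _; exact: h. Qed.
Lemma flow_partial s i F : cls F -> partial i (L s F) = L s (partial i F).
Proof. by case: fL => _ _ h _ _; exact: h. Qed.
Lemma flow_bfam (t : R * R -> R) H :
  (forall a, okp a -> `|t a| <= 2) -> bfam H -> bfam (fun a => L (t a) (H a)).
Proof. by case: fL => _ _ _ h _; exact: h. Qed.
Lemma flow_diff H : bfam H -> bfam (fun a x => (a.2 ^- 2)%:C *
        (L (a.1 + a.2) (H a) x - L a.1 (H a) x - a.2%:C * L a.1 (Qop q (H a)) x)).
Proof. by case: fL => _ _ _ _ h; exact: h. Qed.

Lemma flow0 s : L s (fun _ => 0) = (fun _ => 0).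
Proof.
have h := flow_lin s (-1) (cls_cst (0 : R[i])) (cls_cst (0 : R[i])).
transitivity (L s (fun _ => 0 + (-1) * 0)); first by congr L; apply/funext => x; rewrite mulr0 addr0.
by rewrite h; apply/funext => x; rewrite mulN1r subrr.
Qed.

Lemma flowZ s c F : cls F -> L s (fun x => c * F x) = (fun x => c * L s F x).
Proof.
move=> hF; have := flow_lin s c (cls_cst 0) hF; rewrite flow0 => h.
transitivity (L s (fun x => 0 + c * F x)); first by congr L; apply/funext => x; rewrite add0r.
by rewrite h; apply/funext => x; rewrite add0r.
Qed.

Lemma flowD s F G : cls F -> cls G -> L s (fun x => F x + G x) = (fun x => L s F x + L s G x).
Proof.
move=> hF hG; have h := flow_lin s 1 hF hG.
transitivity (L s (fun x => F x + 1 * G x)); first by congr L; apply/funext => x; rewrite mul1r.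
by rewrite h; apply/funext => x; rewrite mul1r.
Qed.

Lemma flow_sum s (I : Type) (r : seq I) (H : I -> 'rV[R]_n -> R[i]) : (forall i, cls (H i)) ->
  L s (fun x => \sum_(i <- r) H i x) = (fun x => \sum_(i <- r) L s (H i) x).
Proof.
move=> h; elim: r => [|i r IH].
  transitivity (L s (fun _ => 0)); first by congr L; apply/funext => x; rewrite big_nil.
  by rewrite flow0; apply/funext => x; rewrite big_nil.
transitivity (L s (fun x => H i x + \sum_(j <- r) H j x)).
  by congr L; apply/funext => x; rewrite big_cons.
by rewrite flowD ?IH//; [apply/funext => x; rewrite big_cons|exact: cls_sum].
Qed.

Lemma flow_Qop s q' F : cls F -> Qop q' (L s F) = L s (Qop q' F).
Proof.
move=> cF; have c2 l j : cls (partial l (partial j F)) by do 2 apply: cls_partial.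
rewrite /Qop flow_sum; last by move=> l; apply: cls_sum => j; exact: clsZ.
apply/funext => X; apply: eq_bigr => l _.
rewrite flow_sum; last by move=> j; exact: clsZ.
apply: eq_bigr => j _; rewrite flowZ// flow_partial// flow_partial//; exact: cls_partial.
Qed.

Lemma flow_cder F X (s : R) : cls F -> `|s| <= 1 ->
  cder (fun t => L t F X) s (L s (Qop q F) X).
Proof.
move=> cF s1; have [M /(_ 0%N)[B hB]] := flow_diff (bfam_cst cF).
apply: (@cder_of_quad _ _ _ _ (B * wt X ^+ M)) => d d1.
have [->|d0] := eqVneq d 0.
  by rewrite addr0 subrr mul0r subr0 cmod0 expr0n mulr0.
have oa : okp (s, d).
  split => //=; last by rewrite normr_gt0.
    by rewrite (le_trans s1)// ler1n.
  by rewrite (le_trans (ler_normD _ _))// (le_trans (lerD s1 d1)).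
have [/(_ X) h _] := hB _ oa; move: h; rewrite /= cmodM cmodC normfV normrX.
rewrite -normrX ger0_norm ?sqr_ge0// mulrC ler_pdivrMr// lt_neqAle sqr_ge0 andbT eq_sym.
by rewrite expf_neq0.
Qed.

End FlowTheory.

Lemma okp_l a : okp a -> `|a.1| <= 2. Proof. by case. Qed.
Lemma okp_s a : okp a -> `|a.1 + a.2| <= 2. Proof. by case. Qed.

(** A product rule: the increment of L L' is L (s + d) applied to the increment of L', plus the
    increment of L on L' s. The error of the inner increment depends on the time, so the outer
    operator must act on families. *)
Lemma flow_comp L q L' q' : flow L q -> flow L' q' ->
  flow (fun s F => L s (L' s F)) (fun l j => q l j + q' l j).
Proof.
move=> fL fL'; split.
- by move=> s F cF; apply: (flow_cls fL); exact: (flow_cls fL').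
- by move=> s F G c cF cG; rewrite (flow_lin fL')// (flow_lin fL)//; exact: (flow_cls fL').
- move=> s i F cF; rewrite (flow_partial fL); last exact: (flow_cls fL').
  by rewrite (flow_partial fL').
- by move=> t H ht hH; apply: (flow_bfam fL) => //; exact: (flow_bfam fL').
move=> H hH.
pose G := fun a => L' a.1 (H a).
have bG : bfam G by apply: (flow_bfam fL') => // a; exact: okp_l.
pose E' := fun a x => (a.2 ^- 2)%:C * (L' (a.1 + a.2) (H a) x - L' a.1 (H a) x - a.2%:C * L' a.1 (Qop q' (H a)) x).
have bE' : bfam E' by exact: (flow_diff fL').
pose E := fun a x => (a.2 ^- 2)%:C * (L (a.1 + a.2) (G a) x - L a.1 (G a) x - a.2%:C * L a.1 (Qop q (G a)) x).
have bE : bfam E by exact: (flow_diff fL).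
pose P := fun a => L' a.1 (Qop q' (H a)).
have bP : bfam P by apply: (flow_bfam fL') => [a|]; [exact: okp_l|exact: bfam_Qop].
have bE2 := flow_diff fL bP.
(* The first-order term of the inner increment still carries L (s + d); expanding it once more gives
   d times a bounded error plus L s Q P, the remaining terms of order d^2 before division. *)
pose S := fun a x => L (a.1 + a.2) (E' a) x + E a x + (a.2%:C * ((a.2 ^- 2)%:C *
   (L (a.1 + a.2) (P a) x - L a.1 (P a) x - a.2%:C * L a.1 (Qop q (P a)) x)) + 1 * L a.1 (Qop q (P a)) x).
have bS : bfam S.
  apply: bfamD; first apply: bfamD => //.
    by apply: (flow_bfam fL) => // a; exact: okp_s.
  apply: bfamD.
    by apply: (@bfamZ _ 1) => // a [_ _ _ h]; rewrite cmodC.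
  apply: (@bfamZ _ 1) => [a _|]; first by rewrite cmod1.
  by apply: (flow_bfam fL) => [a|]; [exact: okp_l|exact: bfam_Qop].
apply: bfam_eq bS => a oa x.
have cH : cls (H a) by exact: bfam_cls oa.
have cG : cls (G a) by exact: bfam_cls oa.
have cP : cls (P a) by exact: bfam_cls oa.
have cQ : cls (Qop q (H a)) by exact: cls_Qop.
have cQ' : cls (Qop q' (H a)) by exact: cls_Qop.
have cs : cls (L' (a.1 + a.2) (H a)) by exact: (flow_cls fL').
have d0 : a.2 != 0 by case: oa => _ _; rewrite normr_gt0.
have -> : Qop (fun l j => q l j + q' l j) (H a) = (fun x => Qop q (H a) x + Qop q' (H a) x).
  apply/funext => y; rewrite /Qop -big_split; apply: eq_bigr => l _.
  by rewrite -big_split; apply: eq_bigr => j _; rewrite mulrDl.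
rewrite (flowD fL')// (flowD fL)//; [|exact: (flow_cls fL')..].
rewrite /S /E.
have -> : L (a.1 + a.2) (E' a) x = (a.2 ^- 2)%:C * (L (a.1 + a.2) (L' (a.1 + a.2) (H a)) x -
    L (a.1 + a.2) (G a) x - a.2%:C * L (a.1 + a.2) (P a) x).
  rewrite /E' (flowZ fL); last first.
    by apply: clsB; [exact: clsB|exact: clsZ].
  congr (_ * _).
  have -> : (fun x => L' (a.1 + a.2) (H a) x - L' a.1 (H a) x - a.2%:C * L' a.1 (Qop q' (H a)) x) =
    (fun x => (L' (a.1 + a.2) (H a) x + (-1) * G a x) + (- a.2%:C) * P a x).
    by apply/funext => y; rewrite mulN1r mulNr.
  rewrite (flow_lin fL)//; last by apply: clsD => //; exact: clsZ.
  by rewrite (flow_lin fL)// mulN1r mulNr.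
have -> : Qop q (G a) = L' a.1 (Qop q (H a)) by rewrite /G (flow_Qop fL').
have e : a.2%:C * (a.2 ^- 2)%:C * a.2%:C = 1 :> R[i].
  by rewrite -!rmorphM (_ : _ * _ * _ = 1)//; field.
rewrite /G -/(P a); set d := a.2%:C in e *; set d2 := (a.2 ^- 2)%:C in e *.
have e' (z : R[i]) : d * (d2 * (d * z)) = z by rewrite !mulrA e mul1r.
move: (L (a.1 + a.2) (L' (a.1 + a.2) (H a)) x) (L (a.1 + a.2) (L' a.1 (H a)) x) (L (a.1 + a.2) (P a) x)
  (L a.1 (L' a.1 (H a)) x) (L a.1 (L' a.1 (Qop q (H a))) x) (L a.1 (P a) x) (L a.1 (Qop q (P a)) x).
move=> u1 u2 u3 u4 u5 u6 u7.
rewrite (_ : d * (d2 * (u3 - u6 - d * u7)) = d * (d2 * (u3 - u6)) - d * (d2 * (d * u7))); last by ring.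
rewrite e'; ring.
Qed.

Lemma flow_opp L q : flow L q -> flow (fun s => L (- s)) (fun l j => - q l j).
Proof.
move=> fL; split.
- by move=> s F; exact: (flow_cls fL).
- by move=> s F G c; exact: (flow_lin fL).
- by move=> s i F; exact: (flow_partial fL).
- by move=> t H ht; apply: (flow_bfam fL) => a oa; rewrite normrN ht.
move=> H hH.
have oN a : okp a -> okp (- a.1, - a.2).
  by move=> [h1 h2 h3 h4]; split; rewrite /= -?opprD !normrN.
have bN (K : fam) : bfam K -> bfam (fun a => K (- a.1, - a.2)).
  move=> [M h]; exists M => k; have [B hB] := h k; exists B => a /oN; exact: hB.
have := bN _ (flow_diff fL (bN _ hH)).
apply: bfam_eq => a oa x /=.
rewrite !opprK -opprD sqrrN -surjective_pairing.
have cH : cls (H a) by exact: bfam_cls oa.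
have -> : Qop (fun l j => - q l j) (H a) = (fun x => (-1) * Qop q (H a) x).
  apply/funext => y; rewrite /Qop mulN1r -sumrN; apply: eq_bigr => l _.
  by rewrite -sumrN; apply: eq_bigr => j _; rewrite mulNr.
rewrite (flowZ fL); last exact: cls_Qop.
rewrite (rmorphN (real_complex R)); congr (_ * (_ - _)).
by rewrite mulN1r mulNr mulrN.
Qed.

Lemma flow_id L q : flow L q -> (forall F, cls F -> Qop q F = (fun _ => 0)) ->
  (forall F, cls F -> L 0 F = F) -> forall s F, `|s| <= 1 -> cls F -> L s F = F.
Proof.
move=> fL hq h0 s F s1 cF; apply/funext => X.
apply/eqP; rewrite -subr_eq0; apply/eqP/cmod_eq0/eqP; rewrite eq_le cmod_ge0 andbT.
rewrite -[in X in _ - X](h0 F cF).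
have := @cder_MVT _ (fun t => L t F X) (fun _ => 0) 0 s; rewrite mulr0 mul0r; apply => t ts.
  have := flow_cder fL X cF (le_trans ts s1).
  by rewrite hq// (flow0 fL).
by rewrite cmod0.
Qed.

(** [flow] contains no semigroup law: that L (- s) inverts L s is itself deduced from [flow_id],
    which is then applied to L (- s) L' s, whose generator q' - q acts as 0 on the class. *)
Lemma flow_uniq L q L' q' : flow L q -> flow L' q' ->
  (forall F, cls F -> Qop q F = Qop q' F) ->
  (forall F, cls F -> L 0 F = F) -> (forall F, cls F -> L' 0 F = F) ->
  forall s F, `|s| <= 1 -> cls F -> L s F = L' s F.
Proof.
move=> fL fL' hq h0 h0' s F s1 cF.
have inv (t : R) G : `|t| <= 1 -> cls G -> L t (L (- t) G) = G.
  move=> t1; apply: (flow_id (flow_comp fL (flow_opp fL))) => //.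
    by move=> G' cG'; apply/funext => X; apply: big1 => l _; apply: big1 => j _; rewrite subrr mul0r.
  by move=> G' cG'; rewrite oppr0 !h0.
have key : L (- s) (L' s F) = F.
  apply: (flow_id (flow_comp (flow_opp fL) fL')) => //.
    move=> G cG; apply/funext => X.
    have := congr1 (fun f => f X) (hq G cG); rewrite /Qop => e.
    transitivity (- (\sum_l \sum_j q l j * partial l (partial j G) X) + \sum_l \sum_j q' l j * partial l (partial j G) X).
      rewrite -sumrN -big_split; apply: eq_bigr => l _; rewrite -sumrN -big_split.
      by apply: eq_bigr => j _; rewrite mulrDl mulNr.
    by rewrite e addNr.
  by move=> G cG; rewrite oppr0 h0' ?h0.
by rewrite -{1}key inv//; exact: (flow_cls fL').
Qed.

End Flow.

(** * Linear phases *)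

Section LinearPhase.
Context {R : realType}.

Lemma is_derive_lin (c b t : R) : is_derive t (1 : R) (fun s : R => c + s * b) b.
Proof.
have h1 := is_deriveM (is_derive_id t (1:R)) (is_derive_cst b t (1:R)).
apply: (@is_derive_eq _ _ _ _ _ _ _ _ (is_deriveD (is_derive_cst c t (1:R)) h1)).
by rewrite /GRing.scale /= mulr0 !add0r mulr1.
Qed.

Lemma expi_lip (t : R) : cmod (expi t - 1) <= 2 * `|t|.
Proof.
rewrite -(@expi0 R).
have := @cder_MVT _ (fun s : R => expi s) (fun s => 'i%C * expi s) 1 t; rewrite mulr1; apply => s _.
  by have := cder_expi (is_derive_id s (1:R)); rewrite mulr1.
by rewrite cmodM cmodi cmod_expi mulr1.
Qed.

Lemma expi_quad (t : R) : cmod (expi t - 1 - 'i%C * t%:C) <= 4 * t ^+ 2.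
Proof.
pose g (s : R) : R[i] := expi s - 'i%C * s%:C.
rewrite (_ : _ - _ - _ = g t - g 0); last by rewrite /g expi0 mulr0 subr0 addrAC.
rewrite (_ : 4 * t ^+ 2 = 2 * (2 * `|t|) * `|t|); last first.
  by rewrite -(real_normK (num_real t)); ring.
apply: (@cder_MVT _ g (fun s => 'i%C * (expi s - 1))) => s st.
  have h1 := cder_expi (is_derive_id s (1:R)).
  have h2 := cderM (cder_cst s (- 'i%C)) (@cder_real _ id s 1 (is_derive_id _ _)).
  apply: cder_eq; first (have := cderD h1 h2; congr cder).
    by apply/funext => u; rewrite /g mulNr.
  by rewrite mul0r add0r !mulr1; ring.
by rewrite cmodM cmodi mul1r (le_trans (expi_lip s))// ler_pM2l.
Qed.

Lemma dotv_line n (r x : 'rV[R]_n) j (t : R) : dotv r (x + t *: basis_vec j) = dotv r x + t * r ord0 j.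
Proof.
rewrite /dotv (bigD1 j)//= [in RHS](bigD1 j)//= !mxE !eqxx /= mulr1.
rewrite (eq_bigr (fun k => r ord0 k * x ord0 k)); first by ring.
by move=> k kj; rewrite !mxE eqxx /= (negbTE kj) mulr0 addr0.
Qed.

Lemma pder_expi_lin n (r x : 'rV[R]_n) j :
  pder j (fun x => expi (dotv r x)) x ('i%C * (r ord0 j)%:C * expi (dotv r x)).
Proof.
rewrite /pder; under eq_fun do rewrite dotv_line.
have := cder_expi (is_derive_lin (dotv r x) (r ord0 j) 0).
by rewrite mul0r addr0.
Qed.

Lemma cls_expi_lin n (r : 'rV[R]_n) : cls (fun x => expi (dotv r x)).
Proof.
exists 0 => k; exists (wt r ^+ k); elim: k => [|k IH].
  by split => // x; rewrite cmod_expi mulr1.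
apply: (@bndS _ _ _ _ _ (fun j x => 'i%C * (r ord0 j)%:C * expi (dotv r x))) => [x|j x|j].
- by rewrite cmod_expi mulr1.
- exact: pder_expi_lin.
- apply: bnd_leW (bndZ _ IH) => x; rewrite cmodM cmodi mul1r cmodC !mulr1 exprS.
  by rewrite ler_wpM2r// wt_abs.
Qed.

End LinearPhase.

(** * Gaussian integrals and the normalization constant *)

Section OscOne.
Context {R : realType}.
Let mu := @lebesgue_measure R.

Lemma row_mx0l n (u : 'rV[R]_0) (v : 'rV[R]_n) : row_mx u v = v.
Proof.
apply/rowP => j; rewrite !mxE; case: splitP => [[]//|k jk].
by congr (v _ _); apply/val_inj.
Qed.

(** The order of integration is kept, so this only regroups the iterated integral and involves no
    Fubini theorem. *)
Lemma cintegral_split m n (f : 'rV[R]_(m + n) -> R[i]) :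
  cintegral_rV f = cintegral_rV (fun u : 'rV[R]_m => cintegral_rV (fun v : 'rV[R]_n => f (row_mx u v))).
Proof.
elim: m f => [|m IH] f.
  by rewrite cintegral_rV0; congr cintegral_rV; apply/funext => v; rewrite row_mx0l.
rewrite !cintegral_rVS; congr cint1; apply/funext => t.
rewrite (IH (fun v => f (row_mx (const_mx t : 'rV[R]_1) v))).
congr cintegral_rV; apply/funext => u; congr cintegral_rV; apply/funext => v.
congr f; rewrite (@row_mxA _ 1 1 m n); exact: castmx_id.
Qed.

Lemma cint1Z (g : R -> R[i]) (c : R[i]) : cdom g -> cint1 (fun t => c * g t) = c * cint1 g.
Proof.
move=> hg.
have d0 : cdom (fun _ : R => 0 : R[i]).
  apply: (@cdom_of _ _ 0 0) => [t s|t]; first by rewrite subrr cmod0 mul0r.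
  by rewrite cmod0 mul0r.
have z : cint1 (fun _ : R => 0 : R[i]) = 0.
  have h := cint1_lin (-1) d0 d0.
  transitivity (cint1 (fun _ : R => 0 + (-1) * 0 : R[i])); last by rewrite h mulN1r subrr.
  by congr cint1; apply/funext => x; rewrite mulr0 addr0.
have := cint1_lin c d0 hg; rewrite z add0r => <-; congr cint1; apply/funext => t.
by rewrite add0r.
Qed.

Lemma cintegral_prod n (f : 'I_n -> R -> R[i]) (c : R[i]) : (forall k, cdom (f k)) ->
  cintegral_rV (fun x : 'rV[R]_n => c * \prod_k f k (x ord0 k)) = c * \prod_k cint1 (f k).
Proof.
elim: n f c => [|n IH] f c hf.
  by rewrite cintegral_rV0 !big_ord0.
rewrite cintegral_rVS big_ord_recl.
transitivity (cint1 (fun t => (c * \prod_(k < n) cint1 (f (lift ord0 k))) * f ord0 t)); last first.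
  by rewrite cint1Z// -mulrA (mulrC (cint1 _)).
congr cint1; apply/funext => t.
transitivity (cintegral_rV (fun v : 'rV[R]_n => (c * f ord0 t) * \prod_k f (lift ord0 k) (v ord0 k))).
  congr cintegral_rV; apply/funext => v; rewrite big_ord_recl mulrA; congr (_ * f _ _ * _).
    by rewrite mxE; case: splitP => // k _; rewrite mxE.
  apply: eq_bigr => k _; congr (f _ _); rewrite mxE; case: splitP => [j|j jk].
    by rewrite ord1.
  by congr (v _ _); apply/val_inj; case: jk.
by rewrite (IH (fun k => f (lift ord0 k)) (c * f ord0 t)); [exact: mulrAC|move=> k; exact: hf].
Qed.

(** Read off from the total mass of the normal density of variance 1 / b. *)
Lemma Rint_gauss (b : R) : 0 < b ->
  Rintegral mu setT (fun t => expR (- (b * t ^+ 2) / 2)) = Num.sqrt (2 * pi / b).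
Proof.
move=> b0; pose s := (Num.sqrt b)^-1.
have sb : 0 < Num.sqrt b by rewrite sqrtr_gt0.
have s0 : s != 0 by rewrite invr_eq0 gt_eqF.
have s2 : s ^+ 2 = b^-1 by rewrite exprVn sqr_sqrtr// ltW.
have h := @integral_normal_pdf R 0 s.
have e t : normal_pdf 0 s t = normal_peak s * expR (- (b * t ^+ 2) / 2).
  rewrite normal_pdfE//; congr (_ * _); rewrite /normal_fun subr0 s2; congr expR.
  by rewrite -mulr_natr; field; rewrite gt_eqF.
have p0 := normal_peak_gt0 s0.
have int : mu.-integrable [set: R] (EFin \o (fun t => normal_peak s * expR (- (b * t ^+ 2) / 2))).
  have := @integrable_normal_pdf R 0 s; congr integrable; apply/funext => t /=; by rewrite e.
have : Rintegral mu setT (fun t => normal_peak s * expR (- (b * t ^+ 2) / 2)) = 1.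
  rewrite /Rintegral (_ : integral _ _ _ = 1%E)// -h; apply: eq_integral => t _; by rewrite e.
have int' : mu.-integrable [set: R] (EFin \o (fun t => expR (- (b * t ^+ 2) / 2))).
  have := @integrableZl _ _ _ mu _ measurableT (normal_peak s)^-1 _ int; congr integrable.
  by apply/funext => t /=; rewrite -EFinM mulrA mulVf ?mul1r// gt_eqF.
rewrite RintegralZl// => /(congr1 (fun x => (normal_peak s)^-1 * x)).
rewrite mulrA mulVf ?gt_eqF// mul1r mulr1 => ->.
by rewrite /normal_peak invrK s2 -mulr_natl; congr Num.sqrt; field; rewrite gt_eqF.
Qed.

Definition gline (b y t : R) : R[i] := (expR (- (b * t ^+ 2) / 2))%:C * expi (- (y * t)).

Lemma is_derive_gauss (b t : R) : is_derive t (1:R) (fun t => expR (- (b * t ^+ 2) / 2)) (- (b * t) * expR (- (b * t ^+ 2) / 2)).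
Proof.
have hb : is_derive t (1:R) (fun t => - (b * t ^+ 2) / 2) (- (b * t)).
  have h1 := is_deriveM (is_derive_id t (1:R)) (is_derive_id t (1:R)).
  have h2 := is_deriveM (is_derive_cst (- b / 2) t (1:R)) h1.
  rewrite (_ : (fun t => _) = (fun t : R => (- b / 2) * (t * t))); last by apply/funext => u; rewrite expr2; ring.
  apply: (@is_derive_eq _ _ _ _ _ _ _ _ h2).
  by rewrite /GRing.scale /= !mulr1 mulr0 addr0; field.
have := is_derive1_comp (is_derive_expR _) hb.
by move=> h; apply: (is_derive_eq h); rewrite mulrC.
Qed.

Lemma cder_gline (b y t : R) : cder (gline b y) t ((- (b * t))%:C * gline b y t - 'i%C * y%:C * gline b y t).
Proof.
have h1 := cder_real (is_derive_gauss b t).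
have h2 : is_derive t (1:R) (fun t => - (y * t)) (- y).
  have h3 := is_derive_lin 0 (- y) t; have := h3; congr is_derive.
  by apply/funext => u; rewrite add0r mulrN mulrC.
apply: cder_eq (cderM h1 (cder_expi h2)) _.
rewrite /gline rmorphM /= (rmorphN _ y) /=; ring.
Qed.

Lemma cdom_gline (b y : R) : 0 < b -> cdom (gline b y).
Proof.
move=> b0.
(* From exp v >= 1 + v with v = b t^2 / 2: the product (1 + 2 / b) (1 + v) contains the terms 1 and
   t^2. *)
have hb t : cmod (gline b y t) <= (1 + 2 / b) * (1 + t ^+ 2)^-1.
  rewrite cmodM cmod_expi mulr1 cmodC ger0_norm ?expR_ge0// ler_pdivlMr ?oneDsqr_gt0'//.
  rewrite mulNr expRN mulrC ler_pdivrMr ?expR_gt0//.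
  apply: le_trans (ler_wpM2l _ (expR_ge1Dx _)); last by rewrite addr_ge0// divr_ge0// ltW.
  rewrite (_ : (1 + 2 / b) * (1 + b * t ^+ 2 / 2) = 1 + b * t ^+ 2 / 2 + 2 / b + t ^+ 2); last by field; rewrite gt_eqF.
  have h1 : 0 <= b * t ^+ 2 / 2 by apply: divr_ge0 => //; apply: mulr_ge0; rewrite ?sqr_ge0// ltW.
  have h2 : 0 <= 2 / b by apply: divr_ge0 => //; exact: ltW.
  lra.
split; split.
- by move=> t; exact: cder_continuous_Re (cder_gline b y t).
- by exists (1 + 2 / b) => t; exact: le_trans (Re_le_cmod _) (hb t).
- by move=> t; exact: cder_continuous_Im (cder_gline b y t).
- by exists (1 + 2 / b) => t; exact: le_trans (Im_le_cmod _) (hb t).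
Qed.

Lemma cint1_gauss (b : R) : 0 < b -> cint1 (gline b 0) = (Num.sqrt (2 * pi / b))%:C.
Proof.
move=> b0; rewrite /cint1 /gline; apply: complexP => /=.
  rewrite -Rint_gauss//; congr Rintegral; apply/funext => t.
  by rewrite mul0r oppr0 cos0 sin0 mulr0 subr0 mulr1.
rewrite (_ : (fun t => _) = (fun _ : R => 0)); last first.
  by apply/funext => t; rewrite mul0r oppr0 cos0 sin0 mulr0 mul0r addr0.
by rewrite /Rintegral integral0.
Qed.

Lemma gs_line1 (e t : R) : gs (e *: (const_mx t : 'rV[R]_1)) = (expR (- (e ^+ 2 * t ^+ 2) / 2))%:C.
Proof. by rewrite /gs big_ord1 !mxE exprMn. Qed.

(* The Fourier transform of a Gaussian solves phi' = - (y/b) phi. *)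
Lemma cint1_gline (e y : R) : 0 < e <= 1 ->
  cint1 (gline (e ^+ 2) y) = (Num.sqrt (2 * pi / e ^+ 2) * expR (- (e ^- 2 * y ^+ 2) / 2))%:C.
Proof.
move=> he; have /andP[e0 e1] := he; set b := e ^+ 2; have b0 : 0 < b by rewrite exprn_gt0.
pose H (y : R) (x : 'rV[R]_1) : R[i] := gs (e *: x) * expi (dotv (const_mx (- y)) x).
have rg : rapid (fun x : 'rV[R]_1 => gs (e *: x)).
  by rewrite -(dilE gs e); exact: dil_rapid gs_rapid.
have rH z : rapid (H z).
  have h := rapidM (cls_expi_lin (const_mx (- z) : 'rV[R]_1)) rg.
  by move=> p k; have [B hB] := h p k; exists B; apply: bnd_eqf hB => x; rewrite mulrC.
have eH z : cintegral_rV (H z) = cint1 (gline b z).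
  rewrite cintegral_rVS; congr cint1; apply/funext => t; rewrite cintegral_rV0 /H /gline.
  have -> : row_mx (const_mx t : 'rV[R]_1) (0 : 'rV[R]_0) = const_mx t.
    apply/rowP => j; rewrite !mxE; case: splitP => [k _|[]//]; by rewrite mxE.
  by rewrite gs_line1 /dotv big_ord1 !mxE (mulNr z).
pose phi (z : R) := cintegral_rV (H z).
have cx : cls (fun x : 'rV[R]_1 => (x ord0 ord0)%:C) by exact: cls_coord.
pose XH z (x : 'rV[R]_1) : R[i] := (x ord0 ord0)%:C * H z x.
have rXH z : rapid (XH z) by exact: rapidM.
(* The integral of the derivative of H vanishes, which expresses the first moment, hence phi',
   through phi. *)
have ibp z : (b%:C) * cintegral_rV (XH z) = - 'i%C * z%:C * phi z.
  have d x : pder ord0 (H z) x (- b%:C * XH z x + (- 'i%C * z%:C) * H z x).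
    have d1 := pder_dilate e 0 x (cls_pderivable ord0 (rapid_cls (@gs_rapid R 1))).
    rewrite (dilE gs) addr0 (pder_val (pder_gs ord0 (e *: x))) in d1.
    apply: pder_eq (pderM d1 (pder_expi_lin (const_mx (- z)) x ord0)) _.
    rewrite /XH /H /b !mxE (rmorphN (real_complex R) z) expr2 !rmorphM /=; ring.
  have [_ eq] := pder_pderivable d.
  have [B hB] := igr_rapid 2 (rH z).
  have := cintegral_partial ord0 hB; rewrite eq.
  have i1 : igr (fun x => - b%:C * XH z x) by apply/igrZ/igr_of_rapid.
  rewrite (cintegral_lin _ i1 (igr_of_rapid (rH z))) cintegralZ; last exact: igr_of_rapid.
  by move=> /eqP; rewrite mulNr addrC subr_eq0 => /eqP <-.
have dphi z : cder phi z (- (z / b)%:C * phi z).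
  have [B hB] := igr_rapid 0 (rapidM cx (rXH z)).
  have B0 := igr_B_ge0 hB.
  apply: (@cder_of_quad _ _ _ _ ((2 * pi) ^+ 1 * (4 * B))) => s s1.
  have -> : - (z / b)%:C * phi z = cintegral_rV (fun x => - 'i%C * XH z x).
    rewrite cintegralZ; last exact: igr_of_rapid.
    have bn : b%:C != 0 :> R[i] by rewrite (fmorph_eq0 (real_complex R)) gt_eqF.
    apply: (mulfI bn); rewrite [RHS]mulrCA ibp (rmorphM (real_complex R) z) (fmorphV (real_complex R)).
    have ii : 'i%C * 'i%C = -1 :> R[i] by rewrite -expr2 sqr_i.
    rewrite (_ : - 'i%C * (- 'i%C * z%:C * phi z) = ('i%C * 'i%C) * z%:C * phi z); last by ring.
    by rewrite ii; field.
  have -> : phi (z + s) - phi z - s%:C * cintegral_rV (fun x => - 'i%C * XH z x) =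
    cintegral_rV (fun x => H (z + s) x + (-1) * (H z x + s%:C * (- 'i%C * XH z x))).
    rewrite cintegral_lin; first last.
    - by apply: igr_lin; [exact: igr_of_rapid|apply/igrZ/igr_of_rapid].
    - exact: igr_of_rapid.
    rewrite cintegral_lin; first by rewrite mulN1r opprD addrA.
      exact: igr_of_rapid.
    by apply/igrZ/igr_of_rapid.
  rewrite -mulrA; apply: cintegral_le.
    apply: igr_lin; first exact: igr_of_rapid.
    by apply: igr_lin; [exact: igr_of_rapid|apply/igrZ/igr_of_rapid].
  move=> x; set t := x ord0 ord0.
  have eD : H (z + s) x = H z x * expi (- (s * t)).
    rewrite /H -mulrA -expiD; congr (_ * expi _); rewrite /dotv !big_ord1 !mxE -/t; ring.
  rewrite eD (_ : _ + _ = H z x * (expi (- (s * t)) - 1 - 'i%C * (- (s * t))%:C)); last first.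
    by rewrite /XH -/t (rmorphN _ (s * t)) rmorphM /=; ring.
  rewrite cmodM (le_trans (ler_wpM2l _ (expi_quad _)))// sqrrN exprMn.
  rewrite (_ : cmod _ * _ = 4 * (cmod (H z x) * t ^+ 2) * s ^+ 2); last by ring.
  rewrite [leRHS](_ : _ = 4 * (B * PW x) * s ^+ 2); last by ring.
  rewrite ler_wpM2r ?sqr_ge0// ler_pM2l//.
  have := bnd0 x hB; rewrite /XH !cmodM cmodC -/t => h.
  apply: le_trans h.
  by rewrite -(real_normK (num_real t)) expr2 mulrC mulrA.
(* Integrating factor: the exponential is exp (z^2 / (2 b)), and its product with phi has derivative
   0. *)
have const : forall z : R, phi z * (expR (- (- b^-1 * z ^+ 2) / 2))%:C = phi 0.
  move=> z; pose K z := phi z * (expR (- (- b^-1 * z ^+ 2) / 2))%:C.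
  have K0 : K 0 = phi 0 by rewrite /K expr0n /= mulr0 oppr0 mul0r expR0 mulr1.
  rewrite -K0; apply/eqP; rewrite -subr_eq0; apply/eqP/cmod_eq0/eqP; rewrite eq_le cmod_ge0 andbT.
  have := @cder_MVT _ K (fun _ => 0) 0 z; rewrite mulr0 mul0r; apply => t _; last by rewrite cmod0.
  apply: cder_eq (cderM (dphi t) (cder_real (is_derive_gauss (- b^-1) t))) _.
  set E := expR _; rewrite (_ : (- (- b^-1 * t) * E)%:C = (t / b)%:C * E%:C); first by ring.
  rewrite -rmorphM; congr (_%:C); congr (_ * _); ring.
rewrite -eH -/(phi y).
have := const y; rewrite {2}/phi eH cint1_gauss// => h.
rewrite (rmorphM (real_complex R)) /= -h -mulrA -rmorphM -expRD (_ : _ + _ = 0) ?expR0 ?mulr1//.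
by field; rewrite gt_eqF.
Qed.

(** The inner Fourier transform turns the regularized integral into a Gaussian one with parameter
    e^2 + e^(-2). The exact value is (2 pi)^D (1 + e^4)^(-D/2), and it lies within (2 pi)^D D e of
    the limit by Bernoulli's inequality. *)
Lemma osc1 D : osc (fun _ : 'rV[R]_(D + D) => 1) = ((2 * pi) ^+ D)%:C.
Proof.
have [C hC] := oscpP (cls_cst (1 : R[i]) : cls (fun _ : 'rV[R]_(D + D) => 1)).
have pi2 : 0 <= (2 * pi) ^+ D :> R by rewrite exprn_ge0// mulr_ge0// pi_ge0.
suff key (e : R) : 0 < e <= 1 ->
    cmod (cintegral_rV (fun Y : 'rV[R]_(D + D) => gs (e *: Y) * (eph Y * 1)) - ((2 * pi) ^+ D)%:C) <= (2 * pi) ^+ D * D%:R * e.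
  by apply: oscp_osc; exists ((2 * pi) ^+ D * D%:R).
move=> he; have /andP[e0 e1] := he.
have b0 : 0 < e ^+ 2 by rewrite exprn_gt0.
pose b := e ^+ 2 + e ^- 2; have bb : 0 < b by rewrite addr_gt0// invr_gt0.
pose c := Num.sqrt (2 * pi / e ^+ 2) * Num.sqrt (2 * pi / b).
have -> : cintegral_rV (fun Y : 'rV[R]_(D + D) => gs (e *: Y) * (eph Y * 1)) = (c ^+ D)%:C.
  rewrite cintegral_split.
  transitivity (cintegral_rV (fun u : 'rV[R]_D => ((Num.sqrt (2 * pi / e ^+ 2)) ^+ D)%:C * \prod_k gline b 0 (u ord0 k))).
    congr cintegral_rV; apply/funext => u.
    have es (w : 'rV[R]_D) : gs (e *: w) = \prod_k (expR (- (e ^+ 2 * w ord0 k ^+ 2) / 2))%:C.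
      rewrite /gs -rmorph_prod /= -expR_sum; congr (expR _)%:C.
      by rewrite -mulr_suml sumrN; congr (- _ / _); apply: eq_bigr => k _; rewrite mxE exprMn.
    transitivity (cintegral_rV (fun v : 'rV[R]_D => gs (e *: u) * \prod_k gline (e ^+ 2) (u ord0 k) (v ord0 k))).
      congr cintegral_rV; apply/funext => v.
      have -> : gs (e *: row_mx u v) = gs (e *: u) * gs (e *: v).
        have hs : \sum_j (e *: row_mx u v) ord0 j ^+ 2 = \sum_j (e *: u) ord0 j ^+ 2 + \sum_j (e *: v) ord0 j ^+ 2.
          by rewrite big_split_ord /=; congr (_ + _); apply: eq_bigr => k _; rewrite [in LHS]mxE [in RHS]mxE ?row_mxEl ?row_mxEr.
        rewrite /gs hs opprD mulrDl expRD; exact: (rmorphM (real_complex R)).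
      have -> : eph (row_mx u v) = \prod_k expi (- (u ord0 k * v ord0 k)).
        rewrite /eph /ph row_mxKl row_mxKr /dotv -sumrN.
        elim/big_ind2: _ => [|x1 x2 y1 y2 h1 h2|//]; first by rewrite expi0.
        by rewrite expiD h1 h2.
      by rewrite mulr1 -mulrA (es v) /gline big_split.
    rewrite (@cintegral_prod D (fun k => gline (e ^+ 2) (u ord0 k))); last by move=> k; exact: cdom_gline.
    rewrite (eq_bigr _ (fun k _ => cint1_gline (u ord0 k) he)) es -big_split /=.
    have -> : ((Num.sqrt (2 * pi / e ^+ 2)) ^+ D)%:C = \prod_(k < D) (Num.sqrt (2 * pi / e ^+ 2))%:C.
      by rewrite prodr_const card_ord (rmorphXn (real_complex R)).
    rewrite -big_split /=; apply: eq_bigr => k _.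
    rewrite /gline mul0r oppr0 expi0 mulr1 -!(rmorphM (real_complex R)) mulrCA -expRD.
    by congr ((_ * expR _)%:C); rewrite /b; ring.
  rewrite (@cintegral_prod D (fun _ => gline b 0)); last by move=> k; exact: cdom_gline.
  by rewrite (eq_bigr _ (fun k _ => cint1_gauss bb)) prodr_const card_ord -rmorphXn -rmorphM -exprMn.
pose r := Num.sqrt (1 + e ^+ 4)^-1.
have cr : c = 2 * pi * r.
  have p2 : 0 <= 2 * pi :> R by rewrite mulr_ge0// pi_ge0.
  rewrite /c -sqrtrM ?divr_ge0// ?(ltW b0)// /r.
  rewrite (_ : 2 * pi / e ^+ 2 * (2 * pi / b) = (2 * pi) ^+ 2 * (1 + e ^+ 4)^-1); last first.
    have e4 : 0 < e ^+ 4 by rewrite exprn_gt0.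
    by rewrite /b; field; rewrite !gt_eqF// addr_gt0.
  by rewrite sqrtrM ?sqr_ge0// sqrtr_sqr ger0_norm.
have e4 : 0 <= e ^+ 4 by rewrite exprn_ge0// ltW.
have r1 : r <= 1.
  by rewrite /r -[leRHS]sqrtr1 ler_sqrt// invf_le1 ?ltr_wpDr// lerDl.
have r0 : 1 - e <= r.
  have [e1'|e1'] := eqVneq e 1; first by rewrite e1' subrr sqrtr_ge0.
  have h0 : 0 <= 1 - e by rewrite subr_ge0.
  rewrite -[leLHS](ger0_norm h0) -sqrtr_sqr ler_sqrt ?invr_ge0 ?addr_ge0//.
  rewrite -[leRHS]mul1r ler_pdivlMr ?ltr_wpDr//.
  have e2 : e ^+ 2 <= e by rewrite expr2 ler_piMl// ltW.
  have e42 : e ^+ 4 <= e.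
    by rewrite -[leRHS]expr1 ler_wiXn2l// ltW.
  nra.
have bern : 1 - D%:R * e <= r ^+ D.
  apply: (@le_trans _ _ ((1 - e) ^+ D)).
    elim: D {C hC pi2 c cr} => [|m IH]; first by rewrite mul0r subr0 expr0.
    have h0 : 0 <= 1 - e by rewrite subr_ge0.
    rewrite exprS; apply: le_trans (ler_wpM2l h0 IH).
    rewrite -natr1; have : 0 <= m%:R :> R by []. 
    have := ltW e0; nra.
  by rewrite lerXn2r ?nnegrE ?subr_ge0// sqrtr_ge0.
have rD1 : r ^+ D <= 1 by rewrite exprn_ile1// sqrtr_ge0.
rewrite -(rmorphB (real_complex R)) cmodC cr exprMn distrC -{1}[(2 * pi) ^+ D]mulr1 -mulrBr normrM.
rewrite (ger0_norm pi2) -mulrA ler_wpM2l// ger0_norm ?subr_ge0//; lra.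
Qed.

End OscOne.

(** * The operators A_T and their generators *)

Section AT.
Context {R : realType} {n D : nat}.
Local Notation N := (D + D)%N.
Implicit Types (F G : 'rV[R]_n -> R[i]) (X : 'rV[R]_n) (Y : 'rV[R]_N) (T : 'M[R]_(N, n)).

Definition cD : R[i] := ((2 * pi) ^+ D)%:C.

Lemma cD_neq0 : cD != 0.
Proof. by rewrite (fmorph_eq0 (real_complex R)) expf_neq0// mulf_neq0// gt_eqF// pi_gt0. Qed.

Definition AT T F X : R[i] := cD^-1 * osc (fun Y => F (Y *m T + X)).

(** Collects the parameter X and the integration variable in one vector, so that the results on
    [oscs] apply to [AT]. *)
Definition shear T : 'M[R]_(n + N, n) := col_mx 1%:M T.

Lemma shearE T X Y : row_mx X Y *m shear T + 0 = Y *m T + X.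
Proof. by rewrite mul_row_col mulmx1 addr0 addrC. Qed.

Lemma AT_oscs T F : AT T F = fun X => cD^-1 * oscs (fun Z => F (Z *m shear T + 0)) X.
Proof.
apply/funext => X; congr (_ * _); apply: osc_ext => Y.
by rewrite shearE.
Qed.

Lemma cls_AT T F : cls F -> cls (AT T F).
Proof. by move=> h; rewrite AT_oscs; apply: clsZ; apply: cls_oscs; exact: cls_subst. Qed.

Lemma AT_lin T F G c : cls F -> cls G ->
  AT T (fun x => F x + c * G x) = (fun x => AT T F x + c * AT T G x).
Proof.
move=> hF hG; apply/funext => X; rewrite /AT osc_lin; [|exact: cls_subst..].
by rewrite mulrDr mulrCA.
Qed.

Lemma AT_partial T F i : cls F -> pderivable i (AT T F) /\ partial i (AT T F) = AT T (partial i F).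
Proof.
move=> cF; apply: pder_pderivable => X.
have h := pder_oscs i X (cls_subst (shear T) 0 cF).
have e : AT T (partial i F) X =
    cD^-1 * oscs (partial (lshift N i) (fun Z => F (Z *m shear T + 0))) X.
  apply: (congr1 (fun z => cD^-1 * z)); apply: osc_ext => Y.
  rewrite (partial_subst (lshift N i) (shear T) 0 (row_mx X Y) cF) shearE (bigD1 i)//= big1 ?addr0.
    by rewrite /shear col_mxEu mxE eqxx mul1r.
  by move=> j ji; rewrite /shear col_mxEu mxE eq_sym (negbTE ji) mul0r.
by rewrite e AT_oscs; exact: pderZ h.
Qed.

(** The weight V is arbitrary and is compared with a power of [wt] Y only along the affine map
    attached to the given X. This admits the weights in h z and keeps the constants independent of
    h. *)
Lemma AT_le M : exists2 C : R, 0 <= C & forall T F V (B : R) X, cls F ->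
  bnd (@KK D M).+1 V F -> (forall Y, V (Y *m T + X) <= B * wt Y ^+ M) ->
  cmod (AT T F X) <= C * opn T ^+ (@KK D M).+1 * B.
Proof.
have [C C0 hC] := @osc_le R D M.
exists (cmod cD^-1 * C); first by rewrite mulr_ge0.
move=> T F V B X cF hF hV.
have o0 : 0 <= opn T ^+ (@KK D M).+1 by rewrite exprn_ge0// (le_trans _ (opn_ge1 T)).
have h : bnd (@KK D M).+1 (fun Y => opn T ^+ (@KK D M).+1 * B * wt Y ^+ M) (fun Y => F (Y *m T + X)).
  apply: bnd_leW (bnd_subst T X cF hF) => Y; rewrite -[leRHS]mulrA.
  exact: ler_wpM2l.
have := hC _ _ (cls_subst T X cF) h.
move=> /(ler_wpM2l (cmod_ge0 cD^-1)); rewrite /AT cmodM => /le_trans; apply.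
by rewrite !mulrA.
Qed.

Lemma AT_const F X : AT 0 F X = F X.
Proof.
rewrite /AT (@osc_ext _ _ _ (fun Y => F X * 1)); last by move=> Y; rewrite mulmx0 add0r mulr1.
by rewrite oscZ ?osc1 -/cD; [rewrite mulrCA mulVf ?mulr1// cD_neq0|exact: cls_cst].
Qed.

Section Path.
Variables (T0 T1 : 'M[R]_(N, n)).
Definition Tp (s : R) := T0 + s *: T1.
Definition lin (j : 'I_n) Y : R[i] := \sum_i (T1 i j)%:C * (Y ord0 i)%:C.
(* The first-order Taylor error of the integrand along the path Tp, of size d ^+ 2. *)
Definition Rd (s d : R) F X Y : R[i] := F (Y *m Tp (s + d) + X) - F (Y *m Tp s + X)
  - d%:C * \sum_j lin j Y * partial j F (Y *m Tp s + X).
(** Bounds [opn] (Tp s) for all times |s| <= 2 allowed by [okp]. *)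
Definition tau : R := opn T0 + 2 * opn T1.

Lemma tau_ge1 : 1 <= tau.
Proof. by have := opn_ge1 T0; have := opn_ge1 T1; rewrite /tau; lra. Qed.

Lemma tau_ge0 : 0 <= tau. Proof. exact: le_trans tau_ge1. Qed.

Lemma opn1_tau : opn T1 <= tau.
Proof. by have := opn_ge1 T0; have := opn_ge1 T1; rewrite /tau; lra. Qed.

Lemma opn_tau s : `|s| <= 2 -> opn (Tp s) <= tau.
Proof.
move=> s2; apply: (@le_trans _ _ (opn T0 + `|s| * opn T1)); last first.
  by rewrite lerD2l ler_wpM2r// (le_trans _ (opn_ge1 T1)).
rewrite /opn -addrA lerD2l mulrDr mulr1 addrCA (le_trans _ (ler_wpDl _ (lexx _)))// mulr_sumr -big_split /=.
apply: ler_sum => i _; rewrite mulr_sumr -big_split /=; apply: ler_sum => j _.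
by rewrite !mxE -normrM ler_normD.
Qed.

Lemma row_tau s i : `|s| <= 2 -> \sum_l cmod (Tp s i l)%:C <= tau.
Proof.
move=> s2; apply: le_trans (opn_tau s2).
rewrite (eq_bigr (fun l => `|Tp s i l|)); last by move=> l _; rewrite cmodC.
rewrite /opn (bigD1 i)//= addrCA.
by rewrite lerDl addr_ge0//; apply: sumr_ge0 => k _; exact: sumr_ge0.
Qed.

Lemma row1_tau i : \sum_l cmod (T1 i l)%:C <= tau.
Proof.
apply: le_trans opn1_tau.
rewrite (eq_bigr (fun l => `|T1 i l|)); last by move=> l _; rewrite cmodC.
rewrite /opn (bigD1 i)//= addrCA.
by rewrite lerDl addr_ge0//; apply: sumr_ge0 => k _; exact: sumr_ge0.
Qed.

Lemma cls_lin j : cls (lin j).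
Proof. by apply: cls_sum => i; apply: clsZ; exact: cls_coord. Qed.

Lemma pder_lin k j Y : pder k (lin j) Y (T1 k j)%:C.
Proof.
apply: pder_eq; first (apply: pder_sum => i; apply: pderZ; exact: pder_coord).
rewrite (bigD1 k)//= eqxx mulr1 big1 ?addr0// => i ik.
by rewrite eq_sym (negbTE ik) mulr0.
Qed.

Lemma bnd_lin k j : bnd k (fun Y => tau * wt Y) (lin j).
Proof.
have h := @bnd_sum R N k _ (index_enum _) (fun i Y => cmod (T1 i j)%:C * wt Y)
  (fun i Y => (T1 i j)%:C * (Y ord0 i)%:C) (fun i => bndZ _ (bnd_coord k i)).
apply: bnd_leW h => Y; rewrite -mulr_suml ler_wpM2r//; apply: le_trans opn1_tau.
rewrite /opn (le_trans _ (ler_wpDl _ (lexx _)))//; apply: ler_sum => i _.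
by rewrite cmodC (bigD1 j)//= lerDl; exact: sumr_ge0.
Qed.

Lemma wt_Tp s X Y : `|s| <= 2 -> wt (Y *m Tp s + X) <= tau * wt Y * wt X.
Proof.
move=> s2; rewrite (le_trans (wtD _ _))// ler_wpM2r// (le_trans (wt_mul _ _))//.
by rewrite ler_wpM2r// opn_tau.
Qed.

(** A derivative in Y brings out a row of Tp (s + d) in one term and of Tp s in the others. The
    mismatch d T1 cancels the derivative of [lin] and otherwise meets the factor d, which leaves a
    term of order d^2. *)
Lemma pder_Rd s d F X Y k : cls F ->
  pder k (Rd s d F X) Y (\sum_l (Tp (s + d) k l)%:C * Rd s d (partial l F) X Y +
    (d ^+ 2)%:C * \sum_l (T1 k l)%:C * \sum_j lin j Y * partial j (partial l F) (Y *m Tp s + X)).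
Proof.
move=> cF.
have h1 := pder_subst k (Tp (s + d)) X Y cF.
have h2 := pder_subst k (Tp s) X Y cF.
have h3 j := pderM (pder_lin k j Y) (pder_subst k (Tp s) X Y (cls_partial j cF)).
apply: pder_eq (pderB (pderB h1 h2) (pderZ d%:C (pder_sum (index_enum _) h3))) _.
set x1 := Y *m Tp (s + d) + X; set x0 := Y *m Tp s + X.
have e1 l : (Tp (s + d) k l)%:C = (Tp s k l)%:C + d%:C * (T1 k l)%:C.
  by rewrite -rmorphM -rmorphD; congr (_%:C); rewrite !mxE mulrDl addrA.
rewrite big_split /=.
have -> : \sum_i lin i Y * (\sum_j (Tp s k j)%:C * partial j (partial i F) x0) =
  \sum_l (Tp s k l)%:C * \sum_j lin j Y * partial j (partial l F) x0.
  under eq_bigr do rewrite mulr_sumr.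
  rewrite exchange_big /=; apply: eq_bigr => l _; rewrite mulr_sumr; apply: eq_bigr => j _.
  by rewrite mulrCA cls_partialC.
rewrite -sumrB -big_split /= !mulr_sumr -sumrB -big_split /=; apply: eq_bigr => l _.
rewrite /Rd -/x1 -/x0 e1 rmorphXn /=; ring.
Qed.

Lemma bnd_Rd k M : exists2 C : R, 0 <= C & forall s d X F (B : R), `|s| <= 2 -> `|s + d| <= 2 -> `|d| <= 1 ->
  cls F -> bnd (k + 2) (fun x => B * wt x ^+ M) F ->
  bnd k (fun Y => C * B * d ^+ 2 * wt X ^+ M * wt Y ^+ (2 * M + 2)) (Rd s d F X).
Proof.
(* In Y, the exponent is M from the weight at the base point, M from the weight of the displacement
   and 2 from its squared length; each comes with a factor tau. *)
pose C0 := 4 * tau ^+ (2 * M + 2).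
have t0 := tau_ge0; have t1 := tau_ge1.
have e2 (x : R) : x ^+ (2 * M + 2) = x ^+ M * x ^+ M * x ^+ 2.
  by rewrite exprD mulnC exprM [(x ^+ M) ^+ 2]expr2.
have C00 : 0 <= C0 by rewrite mulr_ge0// exprn_ge0.
have base s d X F (B : R) Y : `|s| <= 2 -> `|d| <= 1 -> bnd 2 (fun x => B * wt x ^+ M) F ->
    cmod (Rd s d F X Y) <= C0 * B * d ^+ 2 * wt X ^+ M * wt Y ^+ (2 * M + 2).
  move=> s2 d1 hF; have B0 := bnd_B_ge0 hF.
  pose v := d *: (Y *m T1).
  have := bnd_lip2 (Y *m Tp s + X) v hF.
  have -> : Y *m Tp s + X + v = Y *m Tp (s + d) + X.
    by rewrite addrAC /v /Tp !mulmxDr -!scalemxAr scalerDl addrA.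
  have -> : \sum_j (v ord0 j)%:C * partial j F (Y *m Tp s + X) =
      d%:C * \sum_j lin j Y * partial j F (Y *m Tp s + X).
    rewrite mulr_sumr; apply: eq_bigr => j _; rewrite mulrA; congr (_ * _).
    rewrite !mxE rmorphM /= rmorph_sum /lin; congr (_ * _); apply: eq_bigr => i _.
    by rewrite rmorphM mulrC.
  move=> /le_trans; apply.
  have w1 : wt (Y *m T1) <= tau * wt Y.
    by rewrite (le_trans (wt_mul _ _))// ler_wpM2r// opn1_tau.
  have wv : wt v <= tau * wt Y by exact: le_trans (wtZ_le _ d1) w1.
  have sv : \sum_j `|v ord0 j| <= `|d| * (tau * wt Y).
    rewrite (eq_bigr (fun j => `|d| * `|(Y *m T1) ord0 j|)); last first.
      by move=> j _; rewrite mxE normrM.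
    by rewrite -mulr_sumr ler_wpM2l// (le_trans (wt_sum _)).
  apply: (@le_trans _ _ (4 * (B * ((tau * wt Y * wt X) ^+ M * (tau * wt Y) ^+ M)) * (`|d| * (tau * wt Y)) ^+ 2)).
    apply: ler_pM => //.
    - by rewrite !mulr_ge0.
    - by rewrite sqr_ge0.
    - rewrite ler_pM2l// ler_wpM2l//; apply: ler_pM => //.
        by rewrite lerXn2r ?nnegrE ?mulr_ge0// wt_Tp.
      by rewrite lerXn2r ?nnegrE ?mulr_ge0.
    - by rewrite lerXn2r ?nnegrE ?mulr_ge0.
  rewrite le_eqVlt; apply/orP; left; apply/eqP.
  rewrite [(`|d| * _) ^+ 2]exprMn real_normK ?num_real// !exprMn /C0 !e2; ring.
elim: k => [|k [C CC hC]].
  exists C0 => // s d X F B s2 sd d1 cF hF; split => // Y; exact: base.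
pose C2 := tau * (n%:R * (2 ^+ k * (tau * (tau ^+ k * tau ^+ M)))).
have C20 : 0 <= C2 by rewrite !mulr_ge0// ?exprn_ge0.
exists (C0 + (tau * C + C2)).
  by do ?[apply: addr_ge0 => // | apply: mulr_ge0 => //].
move=> s d X F B s2 sd d1 cF; rewrite addSn => hF; have B0 := bnd_B_ge0 hF.
have tC : 0 <= tau * C by exact: mulr_ge0.
have W0 Y : 0 <= B * d ^+ 2 * wt X ^+ M * wt Y ^+ (2 * M + 2).
  exact: mulr_ge0 (mulr_ge0 (mulr_ge0 B0 (sqr_ge0 d)) (wtX_ge0 X M)) (wtX_ge0 Y _).
have ass (a : R) Y : a * B * d ^+ 2 * wt X ^+ M * wt Y ^+ (2 * M + 2) =
   a * (B * d ^+ 2 * wt X ^+ M * wt Y ^+ (2 * M + 2)) by ring.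
apply: bndS => [Y|i Y|i]; [|exact: pder_Rd|].
  apply: le_trans (base s d X F B Y s2 d1 (bnd_lek _ hF)) _; first by rewrite addn2.
  rewrite !ass; apply: ler_wpM2r; first exact: W0.
  by rewrite lerDl; exact: addr_ge0 tC C20.
have p1 : bnd k (fun Y => \sum_l cmod (Tp (s + d) i l)%:C * (C * B * d ^+ 2 * wt X ^+ M * wt Y ^+ (2 * M + 2)))
   (fun Y => \sum_l (Tp (s + d) i l)%:C * Rd s d (partial l F) X Y).
  apply: bnd_sum => l; apply: bndZ; apply: hC => //; first exact: cls_partial.
  exact: bnd_partial.
have p2 : bnd k (fun Y => \sum_l cmod (T1 i l)%:C * \sum_(j < n) 2 ^+ k * (tau * wt Y * (opn (Tp s) ^+ k * (B * wt (Y *m Tp s + X) ^+ M))))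
   (fun Y => \sum_l (T1 i l)%:C * \sum_j lin j Y * partial j (partial l F) (Y *m Tp s + X)).
  apply: bnd_sum => l; apply: bndZ; apply: bnd_sum => j; apply: bndM; first exact: bnd_lin.
  have hjl : bnd k (fun x => B * wt x ^+ M) (partial j (partial l F)).
    by apply: bnd_partial; apply: bnd_partial; move: hF; rewrite addn2; exact: bnd_lek.
  exact: bnd_subst (Tp s) X (cls_partial j (cls_partial l cF)) hjl.
apply: bnd_leW (bndD p1 (bndZ _ p2)) => Y.
rewrite !ass [leRHS]mulrDl [in leRHS]mulrDl -!mulr_suml.
apply: ler_wpDl; first exact: mulr_ge0.
apply: lerD.
  rewrite -[leRHS]mulrA; apply: ler_wpM2r; last exact: row_tau.
  exact: mulr_ge0 CC (W0 Y).
rewrite cmodC ger0_norm ?sqr_ge0// sumr_const card_ord -[_ *+ n]mulr_natl -[n%:R * _ * _]mulrA.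
apply: (@le_trans _ _ (d ^+ 2 * (tau * (n%:R * (2 ^+ k * (tau * wt Y * (tau ^+ k * (B * (tau * wt Y * wt X) ^+ M)))))))).
  have o0 : 0 <= opn (Tp s) by exact: le_trans (opn_ge1 _).
  have ok1 : opn (Tp s) ^+ k <= tau ^+ k by rewrite lerXn2r ?nnegrE ?opn_tau.
  have wM : wt (Y *m Tp s + X) ^+ M <= (tau * wt Y * wt X) ^+ M.
    by rewrite lerXn2r ?nnegrE ?mulr_ge0// wt_Tp.
  have b0 : 0 <= B * wt (Y *m Tp s + X) ^+ M by exact: mulr_ge0.
  have inner : opn (Tp s) ^+ k * (B * wt (Y *m Tp s + X) ^+ M) <= tau ^+ k * (B * (tau * wt Y * wt X) ^+ M).
    by apply: ler_pM => //; [exact: exprn_ge0|exact: ler_wpM2l].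
  have i0 : 0 <= opn (Tp s) ^+ k * (B * wt (Y *m Tp s + X) ^+ M) by apply: mulr_ge0 => //; exact: exprn_ge0.
  have tw : 0 <= tau * wt Y by exact: mulr_ge0.
  have k2 : 0 <= 2 ^+ k :> R by exact: exprn_ge0.
  have s0 : 0 <= \sum_l cmod (T1 i l)%:C by exact: sumr_ge0.
  apply: (ler_wpM2l (sqr_ge0 d)); apply: (ler_pM s0 _ (row1_tau i)).
    exact: mulr_ge0 (ler0n _ n) (mulr_ge0 k2 (mulr_ge0 tw i0)).
  exact: ler_wpM2l (ler0n _ n) _ _ (ler_wpM2l k2 (ler_wpM2l tw inner)).
rewrite !exprMn [leLHS](_ : _ = C2 * (B * d ^+ 2 * wt X ^+ M * wt Y ^+ M.+1)); last first.
  by rewrite /C2 [wt Y ^+ M.+1]exprS; ring.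
apply: (ler_wpM2l C20); apply: ler_wpM2l.
  exact: mulr_ge0 (mulr_ge0 B0 (sqr_ge0 d)) (wtX_ge0 X M).
apply: wtX_leW.
by rewrite mul2n -addnn -addnA -addn1 leq_add2l// addn2 ltnW.
Qed.

(** The generator at time s: T1 i j comes from the motion along the path, and row [swap] i of Tp s
    from exchanging Y_i for a derivative. *)
Definition qT (s : R) (l j : 'I_n) : R[i] := - 'i%C * \sum_i (T1 i j)%:C * (Tp s (swap i) l)%:C.

(** Identifies the first-order term in the time increment: [osc_coord] turns Y_i into a derivative
    in the variable [swap] i, which the chain rule evaluates. *)
Lemma osc_lin_partial s F X : cls F ->
  cD^-1 * osc (fun Y => \sum_j lin j Y * partial j F (Y *m Tp s + X)) = AT (Tp s) (Qop (qT s) F) X.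
Proof.
move=> cF.
have c1 j := cls_partial j cF.
have c2 l j := cls_partial l (c1 j).
rewrite /AT; congr (_ * _).
rewrite osc_sum; last by move=> j; apply: clsM (cls_lin j) _; exact: cls_subst.
transitivity (\sum_j \sum_i (T1 i j)%:C * osc (fun Y => (Y ord0 i)%:C * partial j F (Y *m Tp s + X))).
  apply: eq_bigr => j _.
  have e i : cls (fun Y => (Y ord0 i)%:C * partial j F (Y *m Tp s + X)).
    by apply: clsM (cls_coord _) _; exact: cls_subst.
  rewrite (@osc_ext _ _ _ (fun Y => \sum_i (T1 i j)%:C * ((Y ord0 i)%:C * partial j F (Y *m Tp s + X)))).
    by rewrite osc_sum; [apply: eq_bigr => i _; rewrite oscZ|move=> i; exact: clsZ].
  by move=> Y; rewrite /lin mulr_suml; apply: eq_bigr => i _; rewrite mulrA.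
transitivity (\sum_j \sum_i (T1 i j)%:C * (- 'i%C * \sum_l (Tp s (swap i) l)%:C * osc (fun Y => partial l (partial j F) (Y *m Tp s + X)))).
  apply: eq_bigr => j _; apply: eq_bigr => i _; congr (_ * _).
  rewrite osc_coord; last exact: cls_subst.
  congr (_ * _).
  rewrite (@osc_ext _ _ (partial (swap i) (fun Y => partial j F (Y *m Tp s + X))) (fun Y => \sum_l (Tp s (swap i) l)%:C * partial l (partial j F) (Y *m Tp s + X))).
    rewrite osc_sum; last by move=> l; apply: clsZ; exact: cls_subst.
    by apply: eq_bigr => l _; rewrite oscZ//; exact: cls_subst.
  by move=> Y; rewrite (partial_subst (swap i) (Tp s) X Y (c1 j)).
rewrite /Qop osc_sum; last by move=> l; apply: cls_sum => j; apply: clsZ; exact: cls_subst.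
under [RHS]eq_bigr => l _ do (rewrite osc_sum; [|by move=> j; apply: clsZ; exact: cls_subst]).
rewrite exchange_big /=.
rewrite [RHS]exchange_big [LHS]exchange_big /=; apply: eq_bigr => j _.
transitivity (\sum_l \sum_i (T1 i j)%:C * (- 'i%C * ((Tp s (swap i) l)%:C * osc (fun Y => partial l (partial j F) (Y *m Tp s + X))))).
  by rewrite exchange_big /=; apply: eq_bigr => i _; rewrite !mulr_sumr.
apply: eq_bigr => l _; rewrite oscZ; last exact: cls_subst.
rewrite /qT mulr_sumr mulr_suml; apply: eq_bigr => i _; ring.
Qed.

(** The Taylor error of the family is the oscillatory integral of [Rd], hence O(d^2) by [bnd_Rd].
    Since the operators commute with derivatives, pointwise bounds suffice by [bfam_op]. *)
Lemma AT_flow (q : 'I_n -> 'I_n -> R[i]) : (forall s l j, qT s l j = q l j) ->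
  flow (fun s => AT (Tp s)) q.
Proof.
move=> hq; split.
- by move=> s F; exact: cls_AT.
- by move=> s F G c; exact: AT_lin.
- by move=> s i F cF; have [] := AT_partial (Tp s) i cF.
- move=> t H ht; apply: (@bfam_op _ _ (fun a => AT (Tp (t a)))) => [a F i cF|M]; first exact: AT_partial.
  have [C C0 hC] := AT_le M; exists (@KK D M).+1, M, (C * tau ^+ (@KK D M).+1 * tau ^+ M).
  move=> a oa F B cF hF X; have B0 := bnd_B_ge0 hF.
  have h := hC (Tp (t a)) F _ (B * (tau * wt X) ^+ M) X cF hF.
  apply: le_trans (h _) _.
    move=> Y; rewrite -mulrA -exprMn; apply: (ler_wpM2l B0).
    rewrite lerXn2r ?nnegrE ?mulr_ge0 ?tau_ge0//.
    by rewrite mulrAC wt_Tp// ht.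
  rewrite exprMn; have -> : C * tau ^+ (@KK D M).+1 * tau ^+ M * B * wt X ^+ M =
    C * tau ^+ (@KK D M).+1 * (B * (tau ^+ M * wt X ^+ M)) by ring.
  apply: ler_wpM2r.
    by apply: mulr_ge0 => //; apply: mulr_ge0; rewrite ?exprn_ge0 ?tau_ge0.
  apply: (ler_wpM2l C0); rewrite lerXn2r ?nnegrE ?tau_ge0 ?opn_tau ?ht//.
  exact: le_trans (opn_ge1 _).
pose E (a : R * R) F X := (a.2 ^- 2)%:C * (AT (Tp (a.1 + a.2)) F X - AT (Tp a.1) F X - a.2%:C * AT (Tp a.1) (Qop q F) X).
move=> H hH; apply: (@bfam_op _ _ E) hH => [a F i cF|M].
  have cQ := cls_Qop q cF.
  have [d1 e1] := AT_partial (Tp (a.1 + a.2)) i cF; have [d2 e2] := AT_partial (Tp a.1) i cF.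
  have [d3 e3] := AT_partial (Tp a.1) i cQ.
  apply: pder_pderivable => X.
  have [_ eQ] := partial_Qop q i cF.
  have := pderZ ((a.2 ^- 2)%:C) (pderB (pderB (d1 X) (d2 X)) (pderZ a.2%:C (d3 X))).
  by rewrite e1 e2 e3 eQ.
have [C C0 hC] := bnd_Rd (@KK D (2 * M + 2)).+1 M.
have [C' C'0 hC'] := @osc_le R D (2 * M + 2).
exists ((@KK D (2 * M + 2)).+1 + 2)%N, M, (cmod cD^-1 * (C' * C)).
move=> a oa F B cF hF X; have B0 := bnd_B_ge0 hF.
case: oa => s2 sd d0 d1.
have hb := hC a.1 a.2 X F B s2 sd d1 cF hF.
have cR : cls (Rd a.1 a.2 F X).
  apply: clsB; first by apply: clsB; exact: cls_subst.
  apply: clsZ; apply: cls_sum => j; apply: clsM (cls_lin j) _; apply: cls_subst; exact: cls_partial.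
have := hC' _ _ cR hb.
have -> : E a F X = (a.2 ^- 2)%:C * (cD^-1 * osc (Rd a.1 a.2 F X)).
  apply: (congr1 (fun z => (a.2 ^- 2)%:C * z)).
  have cs j : cls (fun Y => lin j Y * partial j F (Y *m Tp a.1 + X)).
    by apply: clsM (cls_lin j) _; apply: cls_subst; exact: cls_partial.
  have cS := cls_sum (index_enum 'I_n) cs.
  have c1 := cls_subst (Tp (a.1 + a.2)) X cF; have c0 := cls_subst (Tp a.1) X cF.
  have -> : Qop q F = Qop (qT a.1) F.
    by apply/funext => Z; apply: eq_bigr => l _; apply: eq_bigr => j _; rewrite hq.
  have eR : osc (Rd a.1 a.2 F X) = osc (fun Y => F (Y *m Tp (a.1 + a.2) + X)) - osc (fun Y => F (Y *m Tp a.1 + X))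
      - a.2%:C * osc (fun Y => \sum_j lin j Y * partial j F (Y *m Tp a.1 + X)).
    rewrite -(oscZ a.2%:C cS) -(oscB c1 c0).
    exact: oscB (clsB c1 c0) (clsZ a.2%:C cS).
  rewrite eR [cD^-1 * _]mulrBr [cD^-1 * (_ - _)]mulrBr (mulrCA cD^-1).
  by rewrite -(osc_lin_partial a.1 X cF).
move=> h; rewrite cmodM cmodC normfV normrX cmodM.
have dn : 0 < a.2 ^+ 2 by rewrite -(real_normK (num_real a.2)) exprn_gt0.
rewrite real_normK ?num_real// mulrC ler_pdivrMr//.
apply: le_trans (ler_wpM2l (cmod_ge0 _) h) _.
by rewrite le_eqVlt; apply/orP; left; apply/eqP; ring.
Qed.

End Path.

(** The columns of T are mutually orthogonal for the bilinear form obtained by polarizing y.eta. *)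
Definition isotropic T := forall l j, \sum_i T i j * T (swap i) l = 0.

(** Along the path s T the generator vanishes, and at s = 0 the operator is the identity by the
    value of [osc1]. This takes the place of Fourier inversion. *)
Lemma AT_isotropic T F : isotropic T -> cls F -> AT T F = F.
Proof.
move=> hT cF.
have f : flow (fun s => AT (Tp 0 T s)) (fun _ _ => 0).
  apply: AT_flow => s l j; rewrite /qT (_ : \sum_i _ = (s * \sum_i T i j * T (swap i) l)%:C).
    by rewrite hT mulr0 mulr0.
  rewrite mulr_sumr rmorph_sum; apply: eq_bigr => i _.
  by rewrite /Tp !mxE add0r -rmorphM mulrCA.
have sm : `|1 : R| <= 1 by rewrite normr1.
have Tp1 : Tp 0 T 1 = T by rewrite /Tp add0r scale1r.
have Tp0 : Tp 0 T 0 = 0 by rewrite /Tp add0r scale0r.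
have f0 : forall G, cls G -> AT (Tp 0 T 0) G = G.
  by move=> G cG; rewrite Tp0; apply/funext => X; exact: AT_const.
have q0 : forall G, cls G -> Qop (fun _ _ => 0) G = fun _ => 0 :> R[i].
  by move=> G cG; apply/funext => X; apply: big1 => l _; apply: big1 => j _; rewrite mul0r.
by have := flow_id f q0 f0 sm cF; rewrite Tp1.
Qed.

End AT.

(** * Weyl quantization and the Weyl product *)

Section Tens.
Context {R : realType} {p q : nat}.
Implicit Types (a : 'rV[R]_p -> R[i]) (b : 'rV[R]_q -> R[i]) (Z : 'rV[R]_(p + q)).

Definition tens a b Z : R[i] := a (lsubmx Z) * b (rsubmx Z).

Lemma lsubmx_mul Z : lsubmx Z = Z *m col_mx 1%:M 0 + 0.
Proof. by rewrite -{2}(hsubmxK Z) mul_row_col mulmx1 mulmx0 !addr0. Qed.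

Lemma rsubmx_mul Z : rsubmx Z = Z *m col_mx 0 1%:M + 0.
Proof. by rewrite -{2}(hsubmxK Z) mul_row_col mulmx1 mulmx0 addr0 add0r. Qed.

Lemma cls_lsub a : cls a -> cls (fun Z => a (lsubmx Z)).
Proof. by move=> h; apply: cls_eqf (cls_subst (col_mx 1%:M 0) 0 h) => Z; rewrite lsubmx_mul. Qed.

Lemma cls_rsub b : cls b -> cls (fun Z => b (rsubmx Z)).
Proof. by move=> h; apply: cls_eqf (cls_subst (col_mx 0 1%:M) 0 h) => Z; rewrite rsubmx_mul. Qed.

Lemma cls_tens a b : cls a -> cls b -> cls (tens a b).
Proof. by move=> ha hb; apply: clsM; [exact: cls_lsub|exact: cls_rsub]. Qed.

Lemma pder_lsub i a Z l : pder i a (lsubmx Z) l -> pder (lshift q i) (fun Z => a (lsubmx Z)) Z l.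
Proof.
rewrite -{2}(hsubmxK Z) /pder => h.
by under eq_fun do rewrite row_mx_lshift row_mxKl.
Qed.

Lemma pder_lsubr i a Z : pder (rshift p i) (fun Z => a (lsubmx Z)) Z 0.
Proof.
rewrite -(hsubmxK Z) /pder.
under eq_fun do rewrite row_mx_rshift row_mxKl; exact: cder_cst.
Qed.

Lemma pder_rsub i b Z l : pder i b (rsubmx Z) l -> pder (rshift p i) (fun Z => b (rsubmx Z)) Z l.
Proof.
rewrite -{2}(hsubmxK Z) /pder => h.
by under eq_fun do rewrite row_mx_rshift row_mxKr.
Qed.

Lemma pder_rsubl i b Z : pder (lshift q i) (fun Z => b (rsubmx Z)) Z 0.
Proof.
rewrite -(hsubmxK Z) /pder.
under eq_fun do rewrite row_mx_lshift row_mxKr; exact: cder_cst.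
Qed.

Lemma partial_tensl i a b : pderivable i a -> partial (lshift q i) (tens a b) = tens (partial i a) b.
Proof.
move=> ha; apply/funext => Z; apply: pder_val.
by apply: pder_eq (pderM (pder_lsub (ha _)) (pder_rsubl i b Z)) _; rewrite mulr0 addr0.
Qed.

Lemma partial_tensr i a b : pderivable i b -> partial (rshift p i) (tens a b) = tens a (partial i b).
Proof.
move=> hb; apply/funext => Z; apply: pder_val.
by apply: pder_eq (pderM (pder_lsubr i a Z) (pder_rsub (hb _))) _; rewrite mul0r add0r.
Qed.

End Tens.

(** * Weyl operators on Schwartz functions *)

Section Op.
Context {R : realType} {d : nat}.
Implicit Types (a b c : 'rV[R]_(d + d) -> R[i]) (u v : 'rV[R]_d -> R[i]) (x : 'rV[R]_d).

Definition TA : 'M[R]_(d + d) := block_mx (2^-1)%:M 0 0 1%:M.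
Definition TU : 'M[R]_(d + d, d) := col_mx 1%:M 0.

(* The Weyl operator after the substitution y -> x + y. *)
Definition Op a u x : R[i] :=
  (@cD R d)^-1 * osc (fun Y => a (Y *m TA + row_mx x 0) * u (Y *m TU + x)).

Lemma TAE (y xi x : 'rV[R]_d) : row_mx y xi *m TA + row_mx x 0 = row_mx (x + 2^-1 *: y) xi.
Proof.
by rewrite /TA mul_row_block mul_mx_scalar !mulmx0 mulmx1 addr0 add0r add_row_mx addr0 addrC.
Qed.

Lemma TUE (y xi x : 'rV[R]_d) : row_mx y xi *m TU + x = x + y.
Proof. by rewrite /TU mul_row_col mulmx1 mulmx0 addr0 addrC. Qed.

Lemma cls_Opint a u x : cls a -> cls u -> cls (fun Y => a (Y *m TA + row_mx x 0) * u (Y *m TU + x)).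
Proof. by move=> ha hu; apply: clsM; exact: cls_subst. Qed.

(** The map x -> ((x, 0), x): both the symbol and u are centred at x, so the operator is one [AT] of
    a tensor product restricted to this subspace. *)
Definition Xm : 'M[R]_(d, (d + d) + d) := row_mx (row_mx 1%:M 0) 1%:M.

Lemma Op_AT a u x : Op a u x = AT (row_mx TA TU) (tens a u) (x *m Xm + 0).
Proof.
apply: (congr1 (fun z => (@cD R d)^-1 * z)); apply: osc_ext => Y; rewrite /tens.
rewrite /Xm !mul_mx_row mulmx1 mulmx0 addr0 add_row_mx row_mxKl row_mxKr.
by [].
Qed.

Lemma cls_Op a u : cls a -> cls u -> cls (Op a u).
Proof.
move=> ha hu; apply: cls_eqf (cls_subst Xm 0 (cls_AT (row_mx TA TU) (cls_tens ha hu))) => x.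
by rewrite Op_AT.
Qed.

Lemma sum_Xm k (G : 'I_((d + d) + d) -> R[i]) :
  \sum_l (Xm k l)%:C * G l = G (lshift d (lshift d k)) + G (rshift (d + d) k).
Proof.
rewrite !big_split_ord /= (bigD1 k)//= [X in _ + X](bigD1 k)//= !big1.
- by rewrite !row_mxEl row_mxEr !mxE eqxx !mul1r !addr0.
- by move=> l lk; rewrite row_mxEr mxE eq_sym (negbTE lk) mul0r.
- by move=> l _; rewrite row_mxEl row_mxEr mxE mul0r.
- by move=> l lk; rewrite !row_mxEl mxE eq_sym (negbTE lk) mul0r.
Qed.

Lemma partial_Op a u k : cls a -> cls u ->
  partial k (Op a u) = (fun x => Op (partial (lshift d k) a) u x + Op a (partial k u) x).
Proof.
move=> ha hu; have cT := cls_tens ha hu; have cA := cls_AT (row_mx TA TU) cT.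
apply/funext => x; rewrite (funext (Op_AT a u)) (partial_subst k Xm 0 x cA).
have e l : partial l (AT (row_mx TA TU) (tens a u)) = AT (row_mx TA TU) (partial l (tens a u)).
  by have [] := AT_partial (row_mx TA TU) l cT.
rewrite (eq_bigr (fun l => (Xm k l)%:C * AT (row_mx TA TU) (partial l (tens a u)) (x *m Xm + 0))); last first.
  by move=> l _; rewrite e.
rewrite (sum_Xm k (fun l => AT (row_mx TA TU) (partial l (tens a u)) (x *m Xm + 0))).
rewrite (partial_tensl _ (cls_pderivable _ ha)) (partial_tensr _ (cls_pderivable _ hu)).
by rewrite (Op_AT _ u) (Op_AT a).
Qed.

(** Submultiplicativity of [wt] trades decay of u at x + y for decay in x and growth in Y, which the
    oscillatory integral tolerates. The order p + Ma also pays for the growth of the symbol in x. *)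
Lemma Op_le a u p : cls a -> rapid u -> exists B : R, forall x, cmod (Op a u x) <= B / wt x ^+ p.
Proof.
move=> ca ru; have cu := rapid_cls ru; have [Ma hMa] := ca.
have [C C0 hC] := @osc_le R d (Ma + (p + Ma)).
move: (@KK d (Ma + (p + Ma))).+1 hC => K hC.
have [Ba hBa] := hMa K; have [Bu hBu] := ru (p + Ma)%N K.
have Ba0 := bnd_B_ge0 hBa.
have Bu0 : 0 <= Bu by have := bnd_ge0 0 hBu; rewrite wt0 expr1n invr1 mulr1.
have oA : 0 <= opn TA by exact: le_trans (opn_ge1 _).
have oU : 0 <= opn TU by exact: le_trans (opn_ge1 _).
pose B1 := opn TA ^+ K * (Ba * opn TA ^+ Ma).
pose B2 := opn TU ^+ K * (Bu * opn TU ^+ (p + Ma)).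
exists (cmod (@cD R d)^-1 * (C * (2 ^+ K * (B1 * B2)))) => x.
have h1 : bnd K (fun Y => B1 * wt x ^+ Ma * wt Y ^+ Ma) (fun Y => a (Y *m TA + row_mx x 0)).
  apply: bnd_leW (bnd_subst TA (row_mx x 0) ca hBa) => Y.
  rewrite /B1 -!mulrA; apply: (ler_wpM2l (exprn_ge0 K oA)).
  apply: (ler_wpM2l Ba0); rewrite -!exprMn.
  apply: lerXn2r; rewrite ?nnegrE ?mulr_ge0//.
  apply: le_trans (wtD _ _) _; rewrite [wt x * _]mulrC mulrA; apply: ler_pM => //; first exact: wt_mul.
  by apply: le_trans (wt_row _ _) _; rewrite wt0 mulr1.
have h2 : bnd K (fun Y => B2 / wt x ^+ (p + Ma) * wt Y ^+ (p + Ma)) (fun Y => u (Y *m TU + x)).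
  apply: bnd_leW (bnd_subst TU x cu hBu) => Y.
  rewrite /B2 -!mulrA; apply: (ler_wpM2l (exprn_ge0 K oU)).
  apply: (ler_wpM2l Bu0); rewrite mulrA mulrAC ler_pdivlMr ?wtX_gt0//.
  rewrite mulrC ler_pdivrMr ?wtX_gt0// -!exprMn.
  apply: lerXn2r; rewrite ?nnegrE ?mulr_ge0//.
  rewrite {1}(_ : x = - (Y *m TU) + (Y *m TU + x)); last by rewrite addKr.
  by apply: le_trans (wtD _ _) _; rewrite wtN ler_wpM2r// wt_mul.
have h : bnd K (fun Y => (2 ^+ K * (B1 * B2)) / wt x ^+ p * wt Y ^+ (Ma + (p + Ma)))
   (fun Y => a (Y *m TA + row_mx x 0) * u (Y *m TU + x)).
  apply: bnd_eqW (bndM h1 h2) => Y; clear h1 h2; rewrite [wt x ^+ (p + Ma)]exprD [wt Y ^+ (Ma + _)]exprD.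
  move: (wt x ^+ p) (wt x ^+ Ma) (wtX_gt0 x p) (wtX_gt0 x Ma) (wt Y ^+ Ma) (wt Y ^+ (p + Ma)) (2 ^+ K) B1 B2 =>
    s t s0 t0 v w k e f.
  by field; rewrite !gt_eqF.
have := hC _ _ (cls_Opint x ca cu) h.
move=> /(ler_wpM2l (cmod_ge0 (@cD R d)^-1)); rewrite /Op cmodM => /le_trans; apply.
by rewrite !mulrA.
Qed.

Lemma rapid_Op a u : cls a -> rapid u -> rapid (Op a u).
Proof.
move=> ca ru p k; elim: k a u ca ru => [|k IH] a u ca ru.
  by have [B hB] := Op_le p ca ru; exists B.
have [B hB] := Op_le p ca ru.
have cu := rapid_cls ru.
have /choice[Bi hBi] : forall i, exists C : R, bnd k (fun x => C / wt x ^+ p) (partial i (Op a u)).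
  move=> i; rewrite (partial_Op i ca cu).
  have [B1 h1] := IH _ _ (cls_partial (lshift d i) ca) ru.
  have [B2 h2] := IH _ _ ca (rapid_partial i ru).
  by exists (B1 + B2); apply: bnd_eqW (bndD h1 h2) => x; rewrite mulrDl.
exists (`|B| + \sum_i `|Bi i|).
have s0 : 0 <= \sum_i `|Bi i| by exact: sumr_ge0.
apply: (@bndS _ _ _ _ _ (fun i => partial i (Op a u))) => [x|i|i].
- apply: le_trans (hB x) _; rewrite ler_wpM2r ?invr_ge0//.
  by apply: le_trans (ler_norm B) _; rewrite lerDl.
- by move=> x; exact: cls_pderivable (cls_Op ca cu) x.
- apply: bnd_leW (hBi i) => x; rewrite ler_wpM2r ?invr_ge0//.
  apply: le_trans (ler_norm (Bi i)) _; rewrite [in leRHS](bigD1 i)//= addrCA lerDl addr_ge0//.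
  exact: sumr_ge0.
Qed.

End Op.

Lemma rapid_cut {R : realType} {D} (chi G : 'rV[R]_(D + D) -> R[i]) : cls G -> rapid chi ->
  rapid (fun Y => chi Y * (eph Y * G Y)).
Proof.
move=> cG rc; have h := rapid_eph' (rapidM cG rc).
have -> : (fun Y => chi Y * (eph Y * G Y)) = (fun Y => eph Y * (G Y * chi Y)).
  by apply/funext => Y; rewrite [LHS]mulrC mulrA.
exact: h.
Qed.

(** * Identification with Weyl quantization *)

Section Weyl.
Context {R : realType} {d : nat}.
Implicit Types (a b c : 'rV[R]_(d + d) -> R[i]) (u v : 'rV[R]_d -> R[i]) (x : 'rV[R]_d).

Lemma is_osc_integral_uniq n (f : 'rV[R]_n -> R[i]) (v w : R[i]) :
  is_osc_integral f v -> is_osc_integral f w -> v = w.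
Proof.
have sg : schwartz (@gs R n) by apply/rapid_schwartz; exact: gs_rapid.
move=> /(_ _ sg gs0) /cvgrPdist_lt hv /(_ _ sg gs0) /cvgrPdist_lt hw.
apply/eqP; rewrite -subr_eq0; apply/eqP/cmod_eq0/eqP; rewrite eq_le cmod_ge0 andbT.
apply/ler_addgt0Pr => e e0; rewrite add0r.
have e2 : 0 < e / 2 by rewrite divr_gt0.
have [t [ht1 ht2]] := filter_ex (filterI (hv _ e2) (hw _ e2)).
move: ht1 ht2; rewrite /= !sub0r !normrN !ger0_norm ?cmod_ge0//.
set I := cintegral_rV _ => h1 h2.
rewrite (_ : v - w = (I - w) - (I - v)); last by rewrite opprB [I - w + _]addrC addrA subrK.
by apply: le_trans (cmodB _ _) _; rewrite [e]splitr lerD// ltW.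
Qed.

Lemma cvg0_of_lin (f : R -> R) (C : R) : (forall e : R, 0 < e <= 1 -> `|f e| <= C * e) ->
  f e @[e --> (0 : R)^'+] --> (0 : R).
Proof.
move=> h; apply/cvgrPdist_le => e e0.
have m0 : 0 < Num.min 1 (e / (1 + `|C|)) by rewrite lt_min ltr01 divr_gt0// ltr_wpDr.
near=> t; rewrite sub0r normrN.
have t0 : 0 < t by near: t; exact: nbhs_right_gt.
have : t < Num.min 1 (e / (1 + `|C|)) by near: t; exact: nbhs_right_lt.
rewrite lt_min => /andP[t1 t2].
apply: le_trans (h t _) _; first by rewrite t0 ltW.
apply: (@le_trans _ _ ((1 + `|C|) * t)).
  by apply: (ler_wpM2r (ltW t0)); apply: le_trans (ler_norm C) _; rewrite lerDr.
by move: (ltW t2); rewrite ler_pdivlMr ?ltr_wpDr// mulrC.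
Unshelve. all: by end_near. Qed.

(** Translating y by x turns the phase (x - y).xi into - y.xi, but also moves the cutoff; this is
    why [osc_spec] admits cutoffs with a shifted centre. *)
Lemma is_weyl_Op a u : cls a -> rapid u -> is_weyl a u (Op a u).
Proof.
move=> ca ru x chi /rapid_schwartz rc c1; have cu := rapid_cls ru.
have cG := cls_Opint x ca cu; set G := (fun Y => a _ * _) in cG.
set Y0 := row_mx x (0 : 'rV[R]_d).
have [C hC] := osc_spec Y0 cG rc c1.
apply: (@cvg0_of_lin _ C) => e e01; rewrite ger0_norm ?cmod_ge0//.
have -> : ((2 * pi) ^+ d)%:C * Op a u x = osc G by rewrite /Op mulVKf// cD_neq0.
apply: le_trans (hC e e01).
rewrite -(@cintegral_shift _ _ (fun Y => chi (e *: (Y + Y0)) * (eph Y * G Y)) (- Y0)); last first.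
  apply: igr_of_rapid.
  exact: rapid_cut cG (dil_rapid Y0 e01 rc).
rewrite le_eqVlt; apply/orP; left; apply/eqP; congr (cmod (cintegral_rV _ - _)).
apply/funext => Y /=; rewrite subrK -mulrA; congr (_ * _).
rewrite -(hsubmxK Y); move: (lsubmx Y) (rsubmx Y) => y xi; rewrite row_mxKl row_mxKr.
rewrite /G /Y0 opp_row_mx oppr0 add_row_mx addr0 TAE TUE /eph /ph row_mxKl row_mxKr.
rewrite [x + (y - x)]addrC subrK !mulrA; congr (expi _ * a (row_mx _ _) * u y).
  by rewrite /dotv -sumrN; apply: eq_bigr => k _; rewrite !mxE -mulNr opprB.
by apply/rowP => k; rewrite !mxE; field.
Qed.

Lemma is_weyl_eq a u v : cls a -> rapid u -> is_weyl a u v -> v = Op a u.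
Proof.
move=> ca ru h; apply/funext => x.
have := is_osc_integral_uniq (h x) (is_weyl_Op ca ru x).
by move/(congr1 (fun z => (@cD R d)^-1 * z)); rewrite !mulKf// cD_neq0.
Qed.

End Weyl.

(** * Isotropic paths *)

Section PathFlow.
Context {R : realType} {n D : nat}.
Implicit Types (T : 'M[R]_(D + D, n)) (F : 'rV[R]_n -> R[i]).

Lemma isotropic_u (A : 'M[R]_(D, n)) : isotropic (col_mx A 0).
Proof.
move=> l j; rewrite big_split_ord /= !big1 ?addr0// => k _;
  by rewrite ?swap_l ?swap_r col_mxEu col_mxEd mxE ?mul0r ?mulr0.
Qed.

Lemma isotropic_d (A : 'M[R]_(D, n)) : isotropic (col_mx 0 A).
Proof.
move=> l j; rewrite big_split_ord /= !big1 ?addr0// => k _;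
  by rewrite ?swap_l ?swap_r col_mxEu col_mxEd mxE ?mul0r ?mulr0.
Qed.

(** The coefficient of s in [qT] is the pairing of the columns of T1, so the generator keeps its
    value at s = 0. *)
Lemma path_flow T0 T1 : isotropic T1 -> flow (fun s => AT (Tp T0 T1 s)) (qT T0 T1 0).
Proof.
move=> hT; apply: AT_flow => s l j; rewrite /qT; congr (_ * _).
transitivity (\sum_i ((T1 i j)%:C * (Tp T0 T1 0 (swap i) l)%:C + (s * (T1 i j * T1 (swap i) l))%:C)).
  apply: eq_bigr => i _.
  by rewrite /Tp !mxE mul0r addr0 (rmorphD (real_complex R)) !(rmorphM (real_complex R)) /=; ring.
by rewrite big_split /= -(rmorph_sum (real_complex R)) -mulr_sumr hT mulr0 addr0.
Qed.

Lemma path_0 T0 T1 F : isotropic T0 -> cls F -> AT (Tp T0 T1 0) F = F.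
Proof. by rewrite /Tp scale0r addr0; exact: AT_isotropic. Qed.

Lemma AT0 T : AT T (fun _ => 0) = (fun _ => 0).
Proof. by apply/funext => X; rewrite /AT osc0 mulr0. Qed.

(** The operator of T0 - T1, reached by running the path backwards, is a left inverse: the
    generators cancel and both factors are the identity at time 0. *)
Lemma AT_inj T0 T1 F : isotropic T0 -> isotropic T1 -> cls F ->
  AT (T0 + T1) F = (fun _ => 0) -> F = (fun _ => 0).
Proof.
move=> h0 h1 cF hF; have f := path_flow T0 h1.
have sm : `|1 : R| <= 1 by rewrite normr1.
have q0 G : cls G -> Qop (fun l j => - qT T0 T1 0 l j + qT T0 T1 0 l j) G = fun _ => 0.
  by move=> cG; apply/funext => X; apply: big1 => l _; apply: big1 => j _; rewrite addNr mul0r.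
have f0 G : cls G -> AT (Tp T0 T1 (- 0)) (AT (Tp T0 T1 0) G) = G.
  by move=> cG; rewrite oppr0 !path_0.
have := flow_id (flow_comp (flow_opp f) f) q0 f0 sm cF.
by rewrite {2}/Tp scale1r hF AT0 => <-.
Qed.

End PathFlow.

(** * A symbol is determined by its Weyl operator *)

Section Injectivity.
Context {R : realType} {d : nat}.
Implicit Types (c : 'rV[R]_(d + d) -> R[i]) (u v : 'rV[R]_d -> R[i]) (x r : 'rV[R]_d).

(** On a plane wave of frequency r the operator acts as multiplication, up to averaging of the
    symbol: translating xi by r absorbs the oscillation in y. *)
Lemma osc_modulated c x r : cls c ->
  osc (fun Y => c (Y *m TA + row_mx x 0) * expi (dotv r (Y *m TU + x))) =
  expi (dotv r x) * osc (fun Y => c (Y *m TA + row_mx x r)).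
Proof.
move=> cc; have cG := cls_subst TA (row_mx x r) cc.
rewrite -oscZ//; set Y0 := row_mx (0 : 'rV[R]_d) r.
have [C hC] := osc_spec Y0 (clsZ (expi (dotv r x)) cG) gs_rapid gs0.
apply: oscp_osc; exists C => e e01; apply: le_trans (hC e e01).
have cF := cls_Opint x cc (cls_expi_lin r).
rewrite -(@cintegral_shift _ _ _ Y0); last first.
  apply: igr_of_rapid.
  exact: rapid_cut cF (gs_dil_rapid e01).
rewrite le_eqVlt; apply/orP; left; apply/eqP; congr (cmod (cintegral_rV _ - _)).
apply/funext => Y /=; congr (_ * _).
rewrite -(hsubmxK Y); move: (lsubmx Y) (rsubmx Y) => y xi.
have -> : row_mx y xi *m TA + row_mx x r = row_mx (x + 2^-1 *: y) (xi + r).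
  by rewrite -[row_mx x r](_ : row_mx x 0 + row_mx 0 r = _) ?addrA ?TAE add_row_mx ?addr0 ?add0r.
rewrite /Y0 add_row_mx addr0 TAE TUE /eph /ph !row_mxKl !row_mxKr.
have dD (z z1 z2 : 'rV[R]_d) : dotv z (z1 + z2) = dotv z z1 + dotv z z2.
  by rewrite /dotv -big_split; apply: eq_bigr => k _; rewrite mxE mulrDr.
have dC : dotv r y = dotv y r by apply: eq_bigr => k _; rewrite mulrC.
rewrite !dD opprD !expiD dC.
have h : expi (- dotv y r) * expi (dotv y r) = 1 by rewrite -expiD addNr expi0.
transitivity (expi (- dotv y r) * expi (dotv y r) * (expi (- dotv y xi) * (expi (dotv r x) * c (row_mx (x + 2^-1 *: y) (xi + r))))).
  move: (expi _) (expi _) (expi _) (expi _) (c _) => e1 e2 e3 e4 e5; ring.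
by rewrite h mul1r.
Qed.

(** A plane wave is not a Schwartz function; its product with a dilated Gaussian is, and gives 0 by
    hypothesis. The difference is O(e) at the cost of one power of the weight, hence the exponent M
    + 1. *)
Lemma osc_of_Op0 c x r : cls c -> (forall u x, rapid u -> Op c u x = 0) ->
  osc (fun Y => c (Y *m TA + row_mx x 0) * expi (dotv r (Y *m TU + x))) = 0.
Proof.
move=> cc h; have cE := cls_expi_lin r; have cG := cls_Opint x cc cE.
set G := (fun Y => _) in cG *.
have [M hM] := cG.
have [C C0 hC] := @osc_le R d (M + 1).
move: (@KK d (M + 1)).+1 hC => K hC; have [B hB] := hM K; have B0 := bnd_B_ge0 hB.
have [A A0 hA] := dil_bnd1 (0 : 'rV[R]_d) K gs_rapid gs0.
apply/cmod_eq0/eqP; rewrite eq_le cmod_ge0 andbT.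
pose U : R := opn (@TU R d) ^+ K * (A * (opn (@TU R d) * wt x)).
apply: (@le_small _ _ _ (C * (2 ^+ K * (B * U)))) => e e01; rewrite add0r.
have cg : cls (fun t : 'rV[R]_d => gs (e *: (t + 0)) - 1).
  by apply: clsB (cls_cst _); apply: rapid_cls; exact: dil_rapid gs_rapid.
have cgY := cls_subst TU x cg.
have U0 : 0 <= opn (@TU R d) by exact: le_trans (opn_ge1 _).
have e0 : 0 <= e by case/andP: e01 => /ltW.
have h2 : bnd K (fun Y => U * e * wt Y) (fun Y => gs (e *: (Y *m TU + x + 0)) - 1).
  apply: bnd_leW (bnd_subst TU x cg (hA e e01)) => Y.
  have -> : U * e * wt Y = opn (@TU R d) ^+ K * (A * e * (opn (@TU R d) * wt Y * wt x)) by rewrite /U; ring.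
  apply: (ler_wpM2l (exprn_ge0 K U0)); apply: (ler_wpM2l (mulr_ge0 A0 e0)).
  by apply: le_trans (wtD _ _) _; rewrite ler_wpM2r// wt_mul.
have hb : bnd K (fun Y => (2 ^+ K * (B * U) * e) * wt Y ^+ (M + 1)) (fun Y => G Y * (gs (e *: (Y *m TU + x + 0)) - 1)).
  apply: bnd_eqW (bndM hB h2) => Y; clear h2; rewrite [wt Y ^+ (M + 1)]exprD expr1.
  move: (wt Y ^+ M) (wt Y) (2 ^+ K) U => a1 a2 a3 a4; ring.
have := hC _ _ (clsM cG cgY) hb; rewrite mulrA; apply: le_trans.
have ru : rapid (fun t : 'rV[R]_d => expi (dotv r t) * gs (e *: (t + 0))).
  by apply: rapidM cE _; exact: dil_rapid gs_rapid.
have := h _ x ru; rewrite /Op => /eqP; rewrite mulf_eq0 invr_eq0 (negbTE (cD_neq0)) orFb => /eqP hz.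
have cH := cls_Opint x cc (rapid_cls ru).
rewrite (@osc_ext _ _ (fun Y => G Y * _) (fun Y => c (Y *m TA + row_mx x 0) * (expi (dotv r (Y *m TU + x)) * gs (e *: (Y *m TU + x + 0))) - G Y)).
  by rewrite (oscB cH cG) hz sub0r cmodN.
by move=> Y; rewrite /G mulrBr mulr1 mulrA.
Qed.

Lemma Op_inj c : cls c -> (forall u x, rapid u -> Op c u x = 0) -> c = (fun _ => 0).
Proof.
move=> cc h.
apply: (@AT_inj _ _ _ (col_mx 0 (row_mx 0 1%:M)) (col_mx (row_mx (2^-1)%:M 0) 0) c) => //.
- exact: isotropic_d.
- exact: isotropic_u.
have -> : col_mx 0 (row_mx 0 1%:M) + col_mx (row_mx (2^-1)%:M 0) 0 = TA :> 'M[R]_(d + d, d + d).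
  by rewrite add_col_mx addr0 add0r.
apply/funext => X; rewrite -(hsubmxK X); move: (lsubmx X) (rsubmx X) => x r.
have := osc_of_Op0 x r cc h; rewrite osc_modulated// => /eqP.
rewrite mulf_eq0 => /orP[/eqP e0|/eqP hz].
  by have := cmod_expi (dotv r x); rewrite e0 cmod0 => /esym/eqP; rewrite oner_eq0.
by rewrite /AT hz mulr0.
Qed.

End Injectivity.

(** * Generators as quadratic forms *)

Section Quadratic.
Context {R : realType} {n : nat}.
Implicit Types (q : 'I_n -> 'I_n -> R[i]) (p : 'rV[R]_n) (F : 'rV[R]_n -> R[i]).

Definition bil q p p' : R[i] := \sum_l \sum_j q l j * ((p ord0 l)%:C * (p' ord0 j)%:C).

Lemma bil_basis q l j : bil q (basis_vec l) (basis_vec j) = q l j.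
Proof.
rewrite /bil (bigD1 l)//= (bigD1 j)//= !big1 ?addr0.
- by rewrite /basis_vec !mxE !eqxx !mulr1.
- by move=> k kl; apply: big1 => m _; rewrite /basis_vec !mxE (negbTE kl) mul0r mulr0.
- by move=> k kj; rewrite /basis_vec !mxE (negbTE kj) !mulr0.
Qed.

Lemma bilDl q p1 p2 p' : bil q (p1 + p2) p' = bil q p1 p' + bil q p2 p'.
Proof.
rewrite /bil -big_split; apply: eq_bigr => l _; rewrite -big_split; apply: eq_bigr => j _ /=.
by rewrite mxE (rmorphD (real_complex R)) /= mulrDl mulrDr.
Qed.

Lemma bilDr q p' p1 p2 : bil q p' (p1 + p2) = bil q p' p1 + bil q p' p2.
Proof.
rewrite /bil -big_split; apply: eq_bigr => l _; rewrite -big_split; apply: eq_bigr => j _ /=.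
by rewrite mxE (rmorphD (real_complex R)) /= mulrDr mulrDr.
Qed.

(* Partial derivatives commute, so only the symmetric part of q matters. *)
Lemma Qop_quad q q' F : (forall p, bil q p p = bil q' p p) -> cls F -> Qop q F = Qop q' F.
Proof.
move=> h cF; have sym l j : q l j + q j l = q' l j + q' j l.
  have := h (basis_vec l + basis_vec j); rewrite !bilDl !bilDr !bil_basis.
  have := h (basis_vec l); have := h (basis_vec j); rewrite !bil_basis => -> ->.
  by rewrite -!addrA => /addrI; rewrite !addrA => /addIr.
apply/funext => X; rewrite /Qop.
have dbl (q0 : 'I_n -> 'I_n -> R[i]) : \sum_l \sum_j q0 l j * partial l (partial j F) X =
    2^-1 * \sum_l \sum_j (q0 l j + q0 j l) * partial l (partial j F) X.
  have e : \sum_l \sum_j q0 l j * partial l (partial j F) X = \sum_l \sum_j q0 j l * partial l (partial j F) X.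
    rewrite exchange_big; apply: eq_bigr => l _; apply: eq_bigr => j _.
    by rewrite (cls_partialC j l cF).
  have -> : \sum_l \sum_j (q0 l j + q0 j l) * partial l (partial j F) X =
    \sum_l \sum_j q0 l j * partial l (partial j F) X + \sum_l \sum_j q0 j l * partial l (partial j F) X.
    rewrite -big_split; apply: eq_bigr => l _; rewrite -big_split; apply: eq_bigr => j _ /=.
    by rewrite mulrDl.
  by rewrite -e; move: (\sum_l _) => S; field.
rewrite dbl [RHS]dbl; congr (_ * _); apply: eq_bigr => l _; apply: eq_bigr => j _.
by rewrite sym.
Qed.

Lemma dotv_row m1 m2 (x y : 'rV[R]_m1) (z w : 'rV[R]_m2) :
  dotv (row_mx x z) (row_mx y w) = dotv x y + dotv z w.
Proof.
rewrite /dotv big_split_ord /=; congr (_ + _); apply: eq_bigr => k _.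
  by rewrite !row_mxEl.
by rewrite !row_mxEr.
Qed.

(** On a covector p the generator is -i times the phase pairing of p T1^T with p T0^T. Comparing
    generators thereby reduces to comparing dot products. *)
Lemma bil_qT D (T0 T1 : 'M[R]_(D + D, n)) p : bil (qT T0 T1 0) p p =
  - 'i%C * (\sum_i (p *m T1^T) ord0 i * (p *m T0^T) ord0 (swap i))%:C.
Proof.
rewrite /bil /qT.
transitivity (\sum_l \sum_j \sum_i - 'i%C * ((p ord0 j * T1 i j)%:C * (p ord0 l * T0 (swap i) l)%:C)).
  apply: eq_bigr => l _; apply: eq_bigr => j _; rewrite -mulrA mulr_suml mulr_sumr.
  apply: eq_bigr => i _; congr (_ * _); rewrite /Tp scale0r addr0 !(rmorphM (real_complex R)) /=.
  by rewrite mulrACA [_%:C * (p ord0 j)%:C]mulrC [_%:C * (p ord0 l)%:C]mulrC; ring.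
rewrite (rmorph_sum (real_complex R)) mulr_sumr.
under eq_bigr do rewrite exchange_big.
rewrite exchange_big; apply: eq_bigr => i _ /=.
rewrite (rmorphM (real_complex R)) !mxE /= (rmorph_sum (real_complex R)) mulr_suml mulr_sumr exchange_big.
apply: eq_bigr => j _; rewrite (rmorph_sum (real_complex R)) mulr_sumr mulr_sumr.
by apply: eq_bigr => l _; rewrite !mxE.
Qed.

Lemma bil_qT_ud D (A B : 'M[R]_(D, n)) p :
  bil (qT (col_mx 0 B) (col_mx A 0) 0) p p = - 'i%C * (dotv (p *m A^T) (p *m B^T))%:C.
Proof.
rewrite bil_qT; congr (_ * _%:C); rewrite big_split_ord /= !tr_col_mx !trmx0 !mul_mx_row !mulmx0.
rewrite [X in _ + X]big1 ?addr0; last by move=> i _; rewrite row_mxEr mxE mul0r.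
by apply: eq_bigr => i _; rewrite swap_l row_mxEl row_mxEr.
Qed.

Lemma bil_qT_du D (A B : 'M[R]_(D, n)) p :
  bil (qT (col_mx B 0) (col_mx 0 A) 0) p p = - 'i%C * (dotv (p *m A^T) (p *m B^T))%:C.
Proof.
rewrite bil_qT; congr (_ * _%:C); rewrite big_split_ord /= !tr_col_mx !trmx0 !mul_mx_row !mulmx0.
rewrite [X in X + _]big1 ?add0r; last by move=> i _; rewrite row_mxEl mxE mul0r.
by apply: eq_bigr => i _; rewrite swap_r row_mxEl row_mxEr.
Qed.

End Quadratic.

(** * Composition of Weyl operators as an identity of generators *)

Section Composition.
Context {R : realType} {d : nat}.
Implicit Types (a b : 'rV[R]_(d + d) -> R[i]) (u : 'rV[R]_d -> R[i]) (x y : 'rV[R]_d).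

(** Half of a standard symplectic matrix; sign and factor are those for which the generator of
    [moyal] is i sigma(D)/2 ([Qop_sigmaD]). *)
Definition J : 'M[R]_(d + d) := block_mx 0 (- 2^-1)%:M (2^-1)%:M 0.
Definition M0 : 'M[R]_((d + d) + (d + d)) := col_mx (row_mx 1%:M 0) 0.
Definition M1 : 'M[R]_((d + d) + (d + d)) := col_mx 0 (row_mx 0 J).

(* With the integration variables (w, v), (w, v) *m (M0 + M1) = (w, v J), i.e.
   moyal a b z = (2 pi)^(-2d) int e^(-i w.v) a(z + w) b(z + v J) dw dv. *)
Definition moyal a b (z : 'rV[R]_(d + d)) : R[i] := AT (M0 + M1) (tens a b) (row_mx z z).

Let n5 := (((d + d) + (d + d)) + d)%N.

Definition r5 (s1 s2 s3 s4 s5 : R) : 'M[R]_(d, n5) :=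
  row_mx (row_mx (row_mx s1%:M s2%:M) (row_mx s3%:M s4%:M)) s5%:M.

Definition v5 (y1 y2 y3 y4 y5 : 'rV[R]_d) : 'rV[R]_n5 :=
  row_mx (row_mx (row_mx y1 y2) (row_mx y3 y4)) y5.

Lemma r5_mul y s1 s2 s3 s4 s5 : y *m r5 s1 s2 s3 s4 s5 = v5 (s1 *: y) (s2 *: y) (s3 *: y) (s4 *: y) (s5 *: y).
Proof. by rewrite /r5 /v5 !mul_mx_row !mul_mx_scalar. Qed.

Lemma v5D y1 y2 y3 y4 y5 z1 z2 z3 z4 z5 :
  v5 y1 y2 y3 y4 y5 + v5 z1 z2 z3 z4 z5 = v5 (y1 + z1) (y2 + z2) (y3 + z3) (y4 + z4) (y5 + z5).
Proof. by rewrite /v5 !add_row_mx. Qed.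

Lemma v5_trmul y1 y2 y3 y4 y5 s1 s2 s3 s4 s5 : v5 y1 y2 y3 y4 y5 *m (r5 s1 s2 s3 s4 s5)^T =
  s1 *: y1 + s2 *: y2 + (s3 *: y3 + s4 *: y4) + s5 *: y5.
Proof. by rewrite /r5 /v5 !tr_row_mx !tr_scalar_mx !mul_row_col !mul_mx_scalar. Qed.

Lemma v5P (p : 'rV[R]_n5) : exists y1 y2 y3 y4 y5, p = v5 y1 y2 y3 y4 y5.
Proof.
exists (lsubmx (lsubmx (lsubmx p))), (rsubmx (lsubmx (lsubmx p))), (lsubmx (rsubmx (lsubmx p))),
  (rsubmx (rsubmx (lsubmx p))), (rsubmx p).
by rewrite /v5 !hsubmxK.
Qed.

(* On F = a (x) b (x) u, with X = (x, 0, x, 0, x): the paths TL, TL' realize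
   a^w (b^w u), the paths TR, TR' realize (moyal a b)^w u. *)
Definition TL0 : 'M[R]_(d + d, n5) := col_mx 0 (r5 0 1 0 0 0).
Definition TL1 : 'M[R]_(d + d, n5) := col_mx (r5 2^-1 0 1 0 1) 0.
Definition TL0' : 'M[R]_(d + d, n5) := col_mx 0 (r5 0 0 0 1 0).
Definition TL1' : 'M[R]_(d + d, n5) := col_mx (r5 0 0 2^-1 0 1) 0.
Definition TR0 : 'M[R]_(d + d, n5) := col_mx 0 (r5 0 1 0 1 0).
Definition TR1 : 'M[R]_(d + d, n5) := col_mx (r5 2^-1 0 2^-1 0 1) 0.
Definition TR0' : 'M[R]_((d + d) + (d + d), n5) := col_mx (col_mx (r5 1 0 0 0 0) (r5 0 1 0 0 0)) 0.
Definition TR1' : 'M[R]_((d + d) + (d + d), n5) := col_mx 0 (col_mx (r5 0 0 0 (- 2^-1) 0) (r5 0 0 2^-1 0 0)).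

Lemma compose_AT (F : 'rV[R]_n5 -> R[i]) : cls F ->
  AT (TL0 + TL1) (AT (TL0' + TL1') F) = AT (TR0 + TR1) (AT (TR0' + TR1') F).
Proof.
move=> cF.
have fL := flow_comp (path_flow TL0 (isotropic_u _ : isotropic TL1)) (path_flow TL0' (isotropic_u _ : isotropic TL1')).
have fR := flow_comp (path_flow TR0 (isotropic_u _ : isotropic TR1)) (path_flow TR0' (isotropic_d _ : isotropic TR1')).
have sm : `|1 : R| <= 1 by rewrite normr1.
have hL G : cls G -> AT (Tp TL0 TL1 0) (AT (Tp TL0' TL1' 0) G) = G.
  by move=> cG; rewrite !path_0//; exact: isotropic_d.
have hR G : cls G -> AT (Tp TR0 TR1 0) (AT (Tp TR0' TR1' 0) G) = G.
  move=> cG; rewrite (path_0 TR1' (isotropic_u _ : isotropic TR0') cG) path_0//; exact: isotropic_d.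
suff hq : forall G, cls G -> Qop (fun l j => qT TL0 TL1 0 l j + qT TL0' TL1' 0 l j) G =
    Qop (fun l j => qT TR0 TR1 0 l j + qT TR0' TR1' 0 l j) G.
  by have := flow_uniq fL fR hq hL hR sm cF; rewrite /Tp !scale1r.
move=> G cG; apply: Qop_quad cG => p.
have bD (q q' : 'I_n5 -> 'I_n5 -> R[i]) : bil (fun l j => q l j + q' l j) p p = bil q p p + bil q' p p.
  rewrite /bil -big_split; apply: eq_bigr => l _; rewrite -big_split; apply: eq_bigr => j _ /=.
  by rewrite mulrDl.
rewrite !bD (bil_qT_du (col_mx (r5 0 0 0 (- 2^-1) 0) (r5 0 0 2^-1 0 0)) (col_mx (r5 1 0 0 0 0) (r5 0 1 0 0 0))).
rewrite (bil_qT_ud (r5 2^-1 0 1 0 1) (r5 0 1 0 0 0)) (bil_qT_ud (r5 0 0 2^-1 0 1) (r5 0 0 0 1 0)).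
rewrite (bil_qT_ud (r5 2^-1 0 2^-1 0 1) (r5 0 1 0 1 0)).
rewrite -!mulrDr -!(rmorphD (real_complex R)); apply: (congr1 (fun z : R => - 'i%C * z%:C)) => /=.
(* Both sides are (y1/2 + y3 + y5).y2 + (y3/2 + y5).y4: on the right, the pairing by [J] removes the
   term y1.y4/2 and doubles y3.y2/2. *)
have [y1 [y2 [y3 [y4 [y5 ->]]]]] := v5P p.
rewrite !tr_col_mx !mul_mx_row dotv_row !v5_trmul /dotv -!big_split /=.
by apply: eq_bigr => k _; rewrite !mxE; field.
Qed.

End Composition.

(** * Existence and uniqueness of the Weyl product *)

Section Product.
Context {R : realType} {d : nat}.
Implicit Types (a b c : 'rV[R]_(d + d) -> R[i]) (u : 'rV[R]_d -> R[i]) (x y : 'rV[R]_d).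

Lemma cls_moyal a b : cls a -> cls b -> cls (moyal a b).
Proof.
move=> ca cb; apply: cls_eqf (cls_subst (row_mx 1%:M 1%:M) 0 (cls_AT (M0 + M1) (cls_tens ca cb))) => z.
by rewrite mul_mx_row mulmx1 addr0.
Qed.

Lemma Op_Op_AT a b u x : cls a -> cls b -> cls u ->
  Op a (Op b u) x = AT (TL0 + TL1) (AT (TL0' + TL1') (tens (tens a b) u)) (v5 x 0 x 0 x).
Proof.
move=> ca cb cu.
(* The inner matrix displaces only the arguments of b and u, so the value of a is a constant factor
   of the integral. *)
have inner y1 y2 y3 : AT (TL0' + TL1') (tens (tens a b) u) (v5 y1 y2 y3 0 y3) = a (row_mx y1 y2) * Op b u y3.
  rewrite /Op mulrCA /AT; apply: (congr1 (fun z => (@cD R d)^-1 * z)).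
  rewrite -(oscZ _ (cls_Opint y3 cb cu)); apply: osc_ext => Y.
  rewrite -(hsubmxK Y); move: (lsubmx Y) (rsubmx Y) => y xi; rewrite TAE TUE.
  rewrite /TL0' /TL1' add_col_mx addr0 add0r mul_row_col !r5_mul !v5D /tens /v5 !row_mxKl !row_mxKr.
  rewrite !scale0r !scale1r !addr0 !add0r mulrA; congr (_ * b (row_mx _ _) * u _); exact: addrC.
rewrite [LHS]/Op [RHS]/AT; apply: (congr1 (fun z => (@cD R d)^-1 * z)); apply: osc_ext => Y.
rewrite -(hsubmxK Y); move: (lsubmx Y) (rsubmx Y) => y xi; rewrite TAE TUE -inner.
congr (AT _ _ _).
rewrite /TL0 /TL1 add_col_mx addr0 add0r mul_row_col !r5_mul !v5D.
by rewrite !scale0r !scale1r !addr0 !add0r (addrC x) [x + y]addrC.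
Qed.

Lemma Op_moyal_AT a b u x : cls a -> cls b -> cls u ->
  Op (moyal a b) u x = AT (TR0 + TR1) (AT (TR0' + TR1') (tens (tens a b) u)) (v5 x 0 x 0 x).
Proof.
move=> ca cb cu.
(* Here the inner matrix displaces only the arguments of a and b, both based at (y1, y2), so u
   factors out and the diagonal value [moyal] a b remains. *)
have inner y1 y2 y3 : AT (TR0' + TR1') (tens (tens a b) u) (v5 y1 y2 y1 y2 y3) =
    moyal a b (row_mx y1 y2) * u y3.
  rewrite /moyal /AT [RHS]mulrC [RHS]mulrCA; apply: (congr1 (fun z => (@cD R (d + d))^-1 * z)).
  have ct := cls_subst (M0 + M1) (row_mx (row_mx y1 y2) (row_mx y1 y2)) (cls_tens ca cb).
  rewrite -(oscZ _ ct); apply: osc_ext => Y.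
  rewrite -(hsubmxK Y) -(hsubmxK (lsubmx Y)) -(hsubmxK (rsubmx Y)).
  move: (lsubmx (lsubmx Y)) (rsubmx (lsubmx Y)) (lsubmx (rsubmx Y)) (rsubmx (rsubmx Y)) => w1 w2 t1 t2.
  rewrite /TR0' /TR1' add_col_mx addr0 add0r !mul_row_col !r5_mul !v5D /tens /v5 !row_mxKl !row_mxKr.
  rewrite /M0 /M1 add_col_mx addr0 add0r mul_row_col !mul_mx_row mulmx1 !mulmx0 /J mul_row_block.
  rewrite !mulmx0 !mul_mx_scalar !add_row_mx !row_mxKl !row_mxKr.
  by rewrite !scale0r !scale1r !addr0 !add0r !add_row_mx mulrC.
rewrite [LHS]/Op [RHS]/AT; apply: (congr1 (fun z => (@cD R d)^-1 * z)); apply: osc_ext => Y.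
rewrite -(hsubmxK Y); move: (lsubmx Y) (rsubmx Y) => y xi; rewrite TAE TUE -inner.
congr (AT _ _ _).
rewrite /TR0 /TR1 add_col_mx addr0 add0r mul_row_col !r5_mul !v5D.
by rewrite !scale0r !scale1r !addr0 !add0r (addrC x) [x + y]addrC.
Qed.

Lemma Op_moyal a b u : cls a -> cls b -> rapid u -> Op (moyal a b) u = Op a (Op b u).
Proof.
move=> ca cb ru; have cu := rapid_cls ru; apply/funext => x.
rewrite (Op_moyal_AT x ca cb cu) (Op_Op_AT x ca cb cu).
by rewrite (compose_AT (cls_tens (cls_tens ca cb) cu)).
Qed.

Lemma is_weyl_product_moyal a b : cls a -> cls b -> is_weyl_product a b (moyal a b).
Proof.
move=> ca cb; split; first by apply/cls_weyl; exact: cls_moyal.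
move=> u /rapid_schwartz ru; have rb := rapid_Op cb ru; have ra := rapid_Op ca rb.
exists (Op b u), (Op a (Op b u)); split; [exact/rapid_schwartz|exact/rapid_schwartz| | |].
- exact: is_weyl_Op.
- exact: is_weyl_Op.
- by rewrite -Op_moyal//; apply: is_weyl_Op => //; exact: cls_moyal.
Qed.

Lemma Op_B c c' u x : cls c -> cls c' -> cls u ->
  Op (fun z => c z - c' z) u x = Op c u x - Op c' u x.
Proof.
move=> cc cc' cu; rewrite /Op -mulrBr.
rewrite -(oscB (cls_Opint x cc cu) (cls_Opint x cc' cu)); congr (_ * osc _).
by apply/funext => Y; rewrite mulrBl.
Qed.

Lemma is_weyl_product_uniq a b c : cls a -> cls b -> is_weyl_product a b c -> c = moyal a b.
Proof.
move=> ca cb [/cls_weyl cc h]; have cm := cls_moyal ca cb.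
have h0 : (fun z => c z - moyal a b z) = (fun _ => 0).
  apply: Op_inj; first exact: clsB.
  move=> u x ru; rewrite Op_B//; last exact: rapid_cls.
  have [v [w [/rapid_schwartz rv _ hv hw hc]]] := h u (proj1 (rapid_schwartz u) ru).
  by rewrite Op_moyal// -(is_weyl_eq cb ru hv) -(is_weyl_eq ca rv hw) (is_weyl_eq cc ru hc) subrr.
by apply/funext => z; apply/eqP; rewrite -subr_eq0; apply/eqP; exact: (congr1 (fun f => f z) h0).
Qed.

End Product.

(** * Taylor expansion and symbol estimates *)

Section Taylor.
Context {R : realType} {n : nat}.
Variables (L : R -> ('rV[R]_n -> R[i]) -> 'rV[R]_n -> R[i]) (q : 'I_n -> 'I_n -> R[i]).
Hypotheses (fL : flow L q) (L0 : forall F, cls F -> L 0 F = F).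
Implicit Types (F : 'rV[R]_n -> R[i]) (X : 'rV[R]_n).

Lemma cls_iterQ N F : cls F -> cls (iter N (Qop q) F).
Proof. by move=> cF; elim: N => //= N; exact: cls_Qop. Qed.

Lemma cder_monomial j (c : R[i]) (s : R) :
  cder (fun t => (t ^+ j.+1)%:C * (j.+1`!%:R^-1 * c)) s ((s ^+ j)%:C * (j`!%:R^-1 * c)).
Proof.
have h : is_derive s 1 (fun t : R => t ^+ j.+1) (j.+1%:R * s ^+ j).
  have := is_deriveX j.+1 (is_derive_id s (1 : R)); rewrite exprfctE => hX.
  apply: (@is_derive_eq _ _ _ _ _ _ _ _ hX).
  by rewrite /GRing.scale /= mulr1 mulr_natl.
apply: cder_eq (cderM (cder_real h) (cder_cst s _)) _; rewrite mulr0 addr0.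
have f0 : (j`!%:R : R[i]) != 0 by rewrite pnatr_eq0 -lt0n fact_gt0.
have s0 : (j.+1%:R : R[i]) != 0 by rewrite pnatr_eq0.
rewrite factS natrM invfM (rmorphM (real_complex R)) (rmorph_nat (real_complex R)) /=.
move: (j.+1%:R : R[i]) (j`!%:R : R[i]) ((s ^+ j)%:C) s0 f0 => x y z x0 y0.
by field; apply/andP; split.
Qed.

Definition taylor N F X s : R[i] := \sum_(0 <= j < N) (s ^+ j)%:C * (j`!%:R^-1 * iter j (Qop q) F X).

(** The time derivative of the remainder of order N + 1 for F is the remainder of order N for Q F,
    and at s = 0 the remainder vanishes. Each step uses [cder_MVT] once, which accounts for 2 ^
    N. *)
Lemma flow_taylor N F X (B s : R) : cls F ->
  (forall t, `|t| <= 1 -> cmod (L t (iter N (Qop q) F) X) <= B) -> `|s| <= 1 ->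
  cmod (L s F X - taylor N F X s) <= 2 ^+ N * B.
Proof.
elim: N F B s => [|N IH] F B s cF hB s1.
  by rewrite /taylor big_geq// subr0 expr0 mul1r; exact: hB.
have B0 : 0 <= B by apply: le_trans (hB 0 _); rewrite ?normr0.
have cQ := cls_Qop q cF.
have hQ t : `|t| <= 1 -> cmod (L t (Qop q F) X - taylor N (Qop q F) X t) <= 2 ^+ N * B.
  by apply: IH cQ _ => r r1; have := hB r r1; rewrite iterSr.
have e t : taylor N.+1 F X t = F X + \sum_(0 <= j < N) (t ^+ j.+1)%:C * (j.+1`!%:R^-1 * iter j (Qop q) (Qop q F) X).
  rewrite /taylor big_nat_recl// expr0 mul1r fact0 invr1 mul1r; congr (_ + _).
  by apply: eq_bigr => j _; rewrite iterSr.
have hd t : `|t| <= `|s| -> cder (fun t => L t F X - taylor N.+1 F X t) t (L t (Qop q F) X - taylor N (Qop q F) X t).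
  move=> ts; have dL := flow_cder fL X cF (le_trans ts s1).
  have dS : cder (fun t => taylor N.+1 F X t) t (taylor N (Qop q F) X t).
    have -> : (fun t => taylor N.+1 F X t) = (fun t => F X +
        \sum_(0 <= j < N) (t ^+ j.+1)%:C * (j.+1`!%:R^-1 * iter j (Qop q) (Qop q F) X)).
      by apply/funext.
    rewrite -[taylor N _ X t]add0r; apply: cderD (cder_cst t _) _.
    rewrite /taylor; elim: (index_iota 0 N) => [|j r IHr].
      by under eq_fun do rewrite big_nil; rewrite big_nil; exact: cder_cst.
    by under eq_fun do rewrite big_cons; rewrite big_cons; apply: cderD (cder_monomial j _ t) IHr.
  have := cderD dL (cderM (cder_cst t (-1)) dS).
  by rewrite mul0r add0r mulN1r; under eq_fun do rewrite mulN1r.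
have h0 : L 0 F X - taylor N.+1 F X 0 = 0.
  rewrite L0// e big1 ?addr0 ?subrr// => j _.
  by rewrite expr0n (rmorph0 (real_complex R)) mul0r.
have := cder_MVT hd (fun t ht => hQ t (le_trans ht s1)).
rewrite h0 subr0 => /le_trans; apply.
have P0 : 0 <= 2 * (2 ^+ N * B) by do ?[apply: mulr_ge0 => //|apply: exprn_ge0].
by rewrite exprS -[leRHS]mulrA; exact: ler_piMr.
Qed.

Lemma partial_iterQ i N F : cls F -> partial i (iter N (Qop q) F) = iter N (Qop q) (partial i F).
Proof.
by move=> cF; elim: N => //= N <-; have [_ ->] := partial_Qop q i (cls_iterQ N cF).
Qed.

Lemma Qop_sum (I : Type) (r : seq I) (c : I -> R[i]) (G : I -> 'rV[R]_n -> R[i]) : (forall k, cls (G k)) ->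
  Qop q (fun x => \sum_(k <- r) c k * G k x) = (fun x => \sum_(k <- r) c k * Qop q (G k) x).
Proof.
move=> cG; apply/funext => x; rewrite /Qop.
have e l j : partial l (partial j (fun x => \sum_(k <- r) c k * G k x)) x = \sum_(k <- r) c k * partial l (partial j (G k)) x.
  have -> : partial j (fun x => \sum_(k <- r) c k * G k x) = (fun x => \sum_(k <- r) c k * partial j (G k) x).
    apply/funext => y; apply: pder_val; apply: pder_sum => k; apply: pderZ.
    exact: (cls_pderivable j (cG k) y).
  apply: pder_val; apply: pder_sum => k; apply: pderZ.
  exact: (cls_pderivable l (cls_partial j (cG k)) x).
transitivity (\sum_l \sum_j \sum_(k <- r) c k * (q l j * partial l (partial j (G k)) x)).
  apply: eq_bigr => l _; apply: eq_bigr => j _; rewrite e mulr_sumr; apply: eq_bigr => k _.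
  by rewrite mulrCA.
under eq_bigr do rewrite exchange_big; rewrite exchange_big; apply: eq_bigr => k _ /=.
by rewrite mulr_sumr; apply: eq_bigr => l _; rewrite mulr_sumr.
Qed.

Lemma iterQ_sum N (I : Type) (r : seq I) (c : I -> R[i]) (G : I -> 'rV[R]_n -> R[i]) : (forall k, cls (G k)) ->
  iter N (Qop q) (fun x => \sum_(k <- r) c k * G k x) = (fun x => \sum_(k <- r) c k * iter N (Qop q) (G k) x).
Proof.
move=> cG; elim: N => //= N ->; apply: Qop_sum => k; exact: cls_iterQ.
Qed.

(* For N = 0 this is the flow itself, so that one estimate covers a # b and all remainders. *)
Definition remainder N F X : R[i] := L 1 F X - \sum_(0 <= j < N) j`!%:R^-1 * iter j (Qop q) F X.

Lemma remainder_taylor N F X : remainder N F X = L 1 F X - taylor N F X 1.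
Proof. by congr (_ - _); apply: eq_bigr => j _; rewrite expr1n mul1r. Qed.

Lemma cls_remainder N F : cls F -> cls (remainder N F).
Proof.
move=> cF; apply: clsB; first exact: (flow_cls fL).
by apply: cls_sum => j; apply: clsZ; exact: cls_iterQ.
Qed.

Lemma partial_remainder i N F : cls F -> partial i (remainder N F) = remainder N (partial i F).
Proof.
move=> cF; apply/funext => X; apply: pder_val; apply: pderB.
  by rewrite -(flow_partial fL)//; exact: (cls_pderivable i (flow_cls fL 1 cF) X).
apply: pder_sum => j; apply: pderZ; rewrite -partial_iterQ//.
exact: (cls_pderivable i (cls_iterQ j cF) X).
Qed.

End Taylor.

(** * The generator i sigma(D)/2 *)

Section MoyalGenerator.
Context {R : realType} {d : nat}.
Local Notation n := (d + d)%N.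
Implicit Types (a b : 'rV[R]_n -> R[i]) (F : 'rV[R]_(n + n) -> R[i]) (X : 'rV[R]_(n + n)).

Definition qM : 'I_(n + n) -> 'I_(n + n) -> R[i] := qT (@M0 R d) M1 0.

Let mx0E p1 p2 (i : 'I_p1) (j : 'I_p2) : (0 : 'M[R]_(p1, p2)) i j = 0.
Proof. by rewrite mxE. Qed.

Lemma qM_r i j : qM (rshift n i) j = 0.
Proof.
rewrite /qM /qT /Tp scale0r addr0 big1 ?mulr0// => k _.
case: (split_ordP k) => k' ->; first by rewrite swap_l /M1 col_mxEu mx0E mul0r.
by rewrite swap_r /M0 col_mxEu row_mxEr mx0E mulr0.
Qed.

Lemma qM_ll i j : qM (lshift n i) (lshift n j) = 0.
Proof.
rewrite /qM /qT big1 ?mulr0// => k _.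
case: (split_ordP k) => k' ->; first by rewrite /M1 col_mxEu mx0E mul0r.
by rewrite /M1 col_mxEd row_mxEl mx0E mul0r.
Qed.

Lemma qM_lr i j : qM (lshift n i) (rshift n j) = - 'i%C * (J i j)%:C.
Proof.
rewrite /qM /qT /Tp scale0r addr0; congr (_ * _); rewrite big_split_ord /= [X in X + _]big1 ?add0r; last first.
  by move=> k _; rewrite swap_l /M1 col_mxEu mx0E mul0r.
rewrite (bigD1 i)//= big1 ?addr0.
  by rewrite swap_r /M0 /M1 col_mxEd row_mxEr col_mxEu row_mxEl [1%:M _ _]mxE eqxx mulr1.
by move=> k ki; rewrite swap_r /M0 col_mxEu row_mxEl [1%:M _ _]mxE (negbTE ki) mulr0.
Qed.

(** Only the block coupling the first factor to the second survives: each term differentiates a once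
    and b once, and this yields the gain of two orders per iteration. *)
Lemma Qop_qM F X : Qop qM F X =
  \sum_i \sum_j - 'i%C * (J i j)%:C * partial (lshift n i) (partial (rshift n j) F) X.
Proof.
rewrite /Qop big_split_ord /= [X in _ + X]big1 ?addr0; last first.
  by move=> i _; apply: big1 => j _; rewrite qM_r mul0r.
apply: eq_bigr => i _; rewrite big_split_ord /= [X in X + _]big1 ?add0r; last first.
  by move=> j _; rewrite qM_ll mul0r.
by apply: eq_bigr => j _; rewrite qM_lr.
Qed.

Lemma Qop_tens a b : cls a -> cls b -> Qop qM (tens a b) =
  (fun X => \sum_(k : 'I_n * 'I_n) (- 'i%C * (J k.1 k.2)%:C) * tens (partial k.1 a) (partial k.2 b) X).
Proof.
move=> ca cb; apply/funext => X; rewrite Qop_qM pair_big /=; apply: eq_bigr => k _.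
rewrite (partial_tensr _ (cls_pderivable _ cb)).
by rewrite (partial_tensl _ (cls_pderivable _ ca)).
Qed.

Lemma sum_diag m (x : R[i]) (i : 'I_m) (G : 'I_m -> R[i]) (r : R) :
  \sum_j x * ((r%:M : 'M[R]_m) i j)%:C * G j = x * r%:C * G i.
Proof.
rewrite (bigD1 i)//= big1 ?addr0; first by rewrite mxE eqxx.
by move=> j ji; rewrite mxE eq_sym (negbTE ji) mulr0 mul0r.
Qed.

Lemma sum_J (G : 'I_n -> 'I_n -> R[i]) : \sum_i \sum_j - 'i%C * (J i j)%:C * G i j =
  'i%C / 2 * (\sum_k G (lshift d k) (rshift d k) - \sum_k G (rshift d k) (lshift d k)).
Proof.
rewrite big_split_ord /= mulrDr; congr (_ + _).
  rewrite mulr_sumr; apply: eq_bigr => k _; rewrite big_split_ord /= [X in X + _]big1 ?add0r; last first.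
    by move=> j _; rewrite /J block_mxEul mx0E mulr0 mul0r.
  under eq_bigr do rewrite /J block_mxEur.
  rewrite sum_diag.
  by rewrite (rmorphN (real_complex R)) mulrNN (fmorphV (real_complex R)) (rmorph_nat (real_complex R)).
rewrite mulrN mulr_sumr -sumrN; apply: eq_bigr => k _; rewrite big_split_ord /= [X in _ + X]big1 ?addr0; last first.
  by move=> j _; rewrite /J block_mxEdr mx0E mulr0 mul0r.
under eq_bigr do rewrite /J block_mxEdl.
rewrite sum_diag.
by rewrite (fmorphV (real_complex R)) (rmorph_nat (real_complex R)) !mulNr.
Qed.

Lemma sigmaDE F X : cls F -> sigmaD F X =
  \sum_k partial (ix_y k) (partial (ix_theta k) F) X - \sum_k partial (ix_eta k) (partial (ix_t k) F) X.
Proof.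
move=> cF; have hD k l : Dop k (Dop l F) X = - partial k (partial l F) X.
  rewrite {1}/Dop (pder_val (pderZ (- 'i%C) (cls_pderivable k (cls_partial l cF) X))).
  by rewrite mulrA mulrNN -expr2 sqr_i mulN1r.
rewrite /sigmaD addrC -sumrN; congr (_ + _); last first.
  by rewrite -sumrN; apply: eq_bigr => k _; exact: hD.
by apply: eq_bigr => k _; rewrite hD opprK.
Qed.

Lemma Qop_sigmaD F : cls F -> Qop qM F = (fun X => 'i%C / 2 * sigmaD F X).
Proof.
move=> cF; apply/funext => X; rewrite (sigmaDE X cF).
exact: etrans (Qop_qM F X) (sum_J (fun i j => partial (lshift n i) (partial (rshift n j) F) X)).
Qed.

Lemma cls_dilate (e : R) F : cls F -> cls (dilate e F).
Proof.
by move=> cF; apply: cls_eqf (cls_subst e%:M 0 cF) => X; rewrite mul_mx_scalar addr0.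
Qed.

Lemma partial_dilate i (e : R) F : cls F -> partial i (dilate e F) = (fun X => e%:C * dilate e (partial i F) X).
Proof.
move=> cF; apply/funext => X; apply: pder_val.
by have := pder_dilate e 0 X (cls_pderivable i cF); rewrite !addr0 /dilate dilE.
Qed.

Lemma Qop_dilate (e : R) (c : R[i]) F : cls F ->
  Qop qM (fun X => c * dilate e F X) = (fun X => c * (e ^+ 2)%:C * dilate e (Qop qM F) X).
Proof.
move=> cF; apply/funext => X; rewrite /Qop /dilate mulr_sumr; apply: eq_bigr => l _.
rewrite mulr_sumr; apply: eq_bigr => j _.
have -> : partial j (fun X => c * F (e *: X)) = (fun X => c * e%:C * dilate e (partial j F) X).
  apply/funext => Y; apply: pder_val; rewrite -mulrA; apply: pderZ.
  have := cls_pderivable j (cls_dilate e cF) Y; rewrite (partial_dilate j e cF); exact.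
have cj := cls_partial j cF.
have -> : partial l (fun X => c * e%:C * dilate e (partial j F) X) X = c * e%:C * (e%:C * partial l (partial j F) (e *: X)).
  apply: pder_val; apply: pderZ.
  by have := cls_pderivable l (cls_dilate e cj) X; rewrite (partial_dilate l e cj).
by rewrite expr2 (rmorphM (real_complex R)) /=; ring.
Qed.

(** sigma(D) is homogeneous of degree 2, so the dilation by 1 / h produces h^(-2 j), which the
    prefactor h^(2 j) cancels. *)
Lemma moyal_termE j (h : R) a b z : h != 0 -> cls a -> cls b ->
  moyal_term j h a b z = j`!%:R^-1 * iter j (Qop qM) (tens a b) (row_mx z z).
Proof.
move=> h0 ca cb; have cT := cls_tens ca cb; rewrite /moyal_term /isigmaD_pow.
have it : iter j (fun G Y => 'i%C / 2 * sigmaD G Y) (dilate h^-1 (tens a b)) =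
    (fun X => ((h^-1) ^+ (2 * j))%:C * dilate h^-1 (iter j (Qop qM) (tens a b)) X).
  elim: j => [|j IH]; first by apply/funext => X; rewrite muln0 expr0 mul1r.
  have cj := cls_iterQ qM j cT.
  rewrite iterS IH -(Qop_sigmaD (clsZ _ (cls_dilate _ cj))) (Qop_dilate _ _ cj) iterS.
  by apply/funext => X; rewrite -(rmorphM (real_complex R)) -exprD -mulnSr.
rewrite (_ : tensor a b = tens a b)// it mulrA /dilate scalerA mulVf// scale1r.
rewrite mulrA [_%:C * _]mulrC -!mulrA [_%:C * (_%:C * _)]mulrA -(rmorphM (real_complex R)).
by rewrite -exprMn mulfV// expr1n mul1r.
Qed.

End MoyalGenerator.

(** * Symbol weights and Peetre's inequality *)

Section SymbolEstimates.
Context {R : realType}.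

(** For mu >= 0 this is submultiplicativity of [wt]; for mu < 0 the same inequality is used for x =
    (x + w) - w and inverted. *)
Lemma peetre n (mu : R) : exists M : nat, forall x w : 'rV[R]_n,
  wt (x + w) `^ mu <= wt x `^ mu * wt w ^+ M.
Proof.
have [M hM] := @wt_powR_le R n `|mu|; exists M => x w.
apply: (@le_trans _ _ (wt x `^ mu * wt w `^ `|mu|)); last by rewrite ler_wpM2l// powR_ge0.
have nn (y : 'rV[R]_n) : wt y \is Num.nneg by rewrite nnegrE.
have key (nu : R) (y v : 'rV[R]_n) : 0 <= nu -> wt (y + v) `^ nu <= wt y `^ nu * wt v `^ nu.
  by move=> nu0; rewrite -powRM//; apply: ge0_ler_powR (wtD _ _) => //; rewrite nnegrE mulr_ge0.
have [m0|m0] := leP 0 mu; first by rewrite ger0_norm// key.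
rewrite ltr0_norm//; have n0 : 0 <= - mu by rewrite oppr_ge0 ltW.
have e (y : 'rV[R]_n) : wt y `^ mu = (wt y `^ (- mu))^-1 by rewrite -powRN opprK.
have pos (y : 'rV[R]_n) : 0 < wt y `^ (- mu) by rewrite powR_gt0// wt_gt0.
have := key (- mu) (x + w) (- w) n0; rewrite addrK wtN => h.
by rewrite !e ler_pdivlMl// ler_pdivrMr// mulrC.
Qed.

Context {d : nat}.
Local Notation n := (d + d)%N.
Implicit Types (a b : R -> 'rV[R]_n -> R[i]) (h : R) (z : 'rV[R]_n) (s w : seq 'I_n).

(* The weight of the l-th derivatives of a symbol in G_h^m. *)
Definition sw h z (m : R) (l : nat) : R := h ^+ l * wt (h *: z) `^ (m - l%:R).

Lemma sw_ge0 h z m l : 0 < h <= 1 -> 0 <= sw h z m l.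
Proof. by case/andP => h0 _; rewrite mulr_ge0 ?powR_ge0// exprn_ge0// ltW. Qed.

Lemma sw_le h z m k l : 0 < h <= 1 -> (k <= l)%N -> sw h z m l <= sw h z m k.
Proof.
case/andP => h0 h1 kl; rewrite /sw ler_pM ?powR_ge0 ?exprn_ge0 ?(ltW h0)//.
  by rewrite ler_wiXn2l// ltW.
by rewrite ler_powR// lerD2l lerN2 ler_nat.
Qed.

Lemma Gsym_words m a k : Gsym m a -> exists2 B : R, 0 <= B & forall s, (size s <= k)%N ->
  forall h z, 0 < h <= 1 -> cmod (partials s (a h) z) <= B * sw h z m (size s).
Proof.
move=> [sa ha].
have [] := @words_bound R n (fun s B => forall h z, 0 < h <= 1 ->
  cmod (partials s (a h) z) <= B * sw h z m (size s)) k.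
- move=> s B C BC hB h z h01; apply: le_trans (hB h z h01) _.
  by rewrite ler_wpM2r// sw_ge0.
- move=> s _; have [C C0 hC] := ha (fun k => count_mem k s).
  have [C' C'0 hC'] := @powR_eqv R n (m - (size s)%:R).
  exists (C * C') => h z h01; rewrite (smooth_partials_dmulti s (sa h h01)).
  have := hC h z h01; rewrite mabs_count => /le_trans; apply.
  have [h0 _] := andP h01.
  rewrite /sw -!mulrA; apply: (ler_wpM2l (ltW C0)); rewrite mulrCA.
  apply: ler_wpM2l; first by rewrite exprn_ge0// ltW.
  exact: (hC' (h *: z)).1.
- move=> B hB; exists `|B| => // s sk h z h01; apply: le_trans (hB s sk h z h01) _.
  by rewrite ler_wpM2r ?sw_ge0// ler_norm.
Qed.

Lemma Gsym_cls m a h : Gsym m a -> 0 < h <= 1 -> cls (a h).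
Proof.
move=> ga h01; have [M hM] := @wt_powR_le R n m; have [sa _] := ga.
exists M => k.
have h2 alpha : exists D : R, forall z, cmod (dmulti alpha (a h) z) <= D * wt z ^+ M.
  have [B B0 hB] := Gsym_words (mabs alpha) ga; exists B => z.
  rewrite dmulti_word; apply: le_trans (hB _ _ h z h01) _; first by rewrite size_word.
  apply: (ler_wpM2l B0); apply: le_trans (sw_le z m h01 (leq0n _)) _.
  rewrite /sw expr0 mul1r subr0; apply: le_trans (hM _) _.
  case/andP: h01 => h0 h1.
  by rewrite lerXn2r ?nnegrE// wtZ_le// gtr0_norm.
by have [|B hB] := @smooth_bnd R n (a h) (fun x => wt x ^+ M) k _ (sa h h01) h2; [by []|exists B].
Qed.

(** Derivatives beyond the l-th only lower the weight, as h <= 1 and [wt] >= 1, so the weight of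
    order l serves all k further orders. *)
Lemma Gsym_bnd m a k l : Gsym m a -> exists2 C : R, 0 <= C & forall h s, 0 < h <= 1 -> size s = l ->
  bnd k (fun z => C * sw h z m l) (partials s (a h)).
Proof.
move=> ga; have [sa _] := ga; have [B B0 hB] := Gsym_words (k + l) ga; exists B => // h s h01 sl.
apply: bnd_words => [t i|t tk z].
  by rewrite -partials_cat; exact: smooth_pderivable (sa h h01).
rewrite -partials_cat; apply: le_trans (hB _ _ h z h01) _; first by rewrite size_cat sl leq_add2r.
by apply: (ler_wpM2l B0); apply: sw_le => //; rewrite size_cat sl leq_addl.
Qed.

Lemma Gsym_of_words m a : (forall h, 0 < h <= 1 -> cls (a h)) ->
  (forall k, exists C : R, forall h w z, 0 < h <= 1 -> size w = k ->
    cmod (partials w (a h) z) <= C * sw h z m k) -> Gsym m a.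
Proof.
move=> ca hw; split=> [h h01|alpha]; first exact/cls_smooth/ca.
have [C hC] := hw (mabs alpha); have [C' C'0 hC'] := @powR_eqv R n (m - (mabs alpha)%:R).
have C1 : 0 < `|C| + 1 by rewrite ltr_wpDl.
exists ((`|C| + 1) * C'); first exact: mulr_gt0.
move=> h z h01; rewrite dmulti_word; apply: le_trans (hC h _ z h01 (size_word alpha)) _.
have [h0 _] := andP h01.
apply: (@le_trans _ _ ((`|C| + 1) * sw h z m (mabs alpha))).
  by rewrite ler_wpM2r ?sw_ge0// (le_trans (ler_norm C))// lerDl.
rewrite /sw -!mulrA; apply: (ler_wpM2l (ltW C1)); rewrite [leRHS]mulrCA.
apply: ler_wpM2l; first by rewrite exprn_ge0// ltW.
exact: (hC' (h *: z)).2.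
Qed.

End SymbolEstimates.

(** * Estimates for the Weyl product and its remainders *)

Section MoyalEstimates.
Context {R : realType} {d : nat}.
Local Notation n := (d + d)%N.
Implicit Types (a b : R -> 'rV[R]_n -> R[i]) (f g : 'rV[R]_n -> R[i]) (h t : R) (z : 'rV[R]_n).
Implicit Types (s w : seq 'I_n).

Lemma bnd_tens k (V W : 'rV[R]_n -> R) f g : cls f -> cls g -> bnd k V f -> bnd k W g ->
  bnd k (fun Z => (2 ^+ k * (opn (col_mx 1%:M 0 : 'M[R]_(n + n, n)) ^+ k * opn (col_mx 0 1%:M : 'M[R]_(n + n, n)) ^+ k)) * (V (lsubmx Z) * W (rsubmx Z)))
    (tens f g).
Proof.
move=> cf cg hf hg.
apply: bnd_eqf (bnd_eqW _ (bndM (bnd_subst (col_mx 1%:M 0) 0 cf hf) (bnd_subst (col_mx 0 1%:M) 0 cg hg))) => Z.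
  by rewrite /tens -lsubmx_mul -rsubmx_mul.
rewrite -lsubmx_mul -rsubmx_mul -[RHS]mulrA; congr (_ * _); exact: mulrACA.
Qed.

(** Peetre's inequality moves both weights to the point h z; the loss is a power of [wt] (h v) with
    v a displacement linear in Y. Since h <= 1 this is at most a power of [wt] Y, uniformly in h and
    t. *)
Lemma AT_tens_le (mu nu : R) : exists K, exists2 C : R, 0 <= C & forall h t z f g (A B : R),
  0 < h <= 1 -> `|t| <= 1 -> 0 <= A -> 0 <= B -> cls f -> cls g ->
  bnd K (fun z => A * wt (h *: z) `^ mu) f -> bnd K (fun z => B * wt (h *: z) `^ nu) g ->
  cmod (AT (Tp M0 M1 t) (tens f g) (row_mx z z)) <=
    C * (A * B * (wt (h *: z) `^ mu * wt (h *: z) `^ nu)).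
Proof.
have [P hP] := @peetre R n mu; have [Q hQ] := @peetre R n nu.
have [C C0 hC] := @AT_le R (n + n) n (P + Q).
move: (@KK n (P + Q)).+1 hC => K hC; exists K.
pose E : R := 2 ^+ K * (opn (col_mx 1%:M 0 : 'M[R]_(n + n, n)) ^+ K * opn (col_mx 0 1%:M : 'M[R]_(n + n, n)) ^+ K).
pose ta := tau (@M0 R d) M1.
have ta0 : 0 <= ta by exact: tau_ge0.
have o0 p1 p2 (T : 'M[R]_(p1, p2)) : 0 <= opn T ^+ K by rewrite exprn_ge0// (le_trans _ (opn_ge1 _)).
have E0 : 0 <= E by rewrite !mulr_ge0// exprn_ge0.
exists (C * ta ^+ K * (E * ta ^+ (P + Q))); first by rewrite !mulr_ge0// exprn_ge0.
move=> h t z f g A B h01 t1 A0 B0 cf cg hf hg.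
have t2 : `|t| <= 2 by apply: le_trans t1 _; rewrite ler1n.
have hb := bnd_tens cf cg hf hg; rewrite -/E in hb.
pose w1 := wt (h *: z) `^ mu; pose w2 := wt (h *: z) `^ nu.
have w10 : 0 <= w1 by exact: powR_ge0.
have w20 : 0 <= w2 by exact: powR_ge0.
have D0 : 0 <= E * (A * B * (w1 * w2)) * ta ^+ (P + Q).
  by do ?[apply: mulr_ge0 => //|apply: exprn_ge0].
apply: le_trans (hC (Tp M0 M1 t) _ _ (E * (A * B * (w1 * w2)) * ta ^+ (P + Q)) (row_mx z z) (cls_tens cf cg) hb _) _.
  move=> Y.
  have sm (v : 'rV[R]_n) : wt v <= ta * wt Y -> wt (h *: v) <= ta * wt Y.
    by case/andP: h01 => h0 h1; apply: le_trans; rewrite wtZ_le// gtr0_norm.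
  have wT : wt (Y *m Tp M0 M1 t) <= ta * wt Y.
    by apply: le_trans (wt_mul _ _) _; rewrite ler_wpM2r// opn_tau.
  have l1 : wt (lsubmx (Y *m Tp M0 M1 t)) <= ta * wt Y.
    by apply: le_trans wT; rewrite -{2}(hsubmxK (Y *m Tp M0 M1 t)) wt_row_l.
  have l2 : wt (rsubmx (Y *m Tp M0 M1 t)) <= ta * wt Y.
    by apply: le_trans wT; rewrite -{2}(hsubmxK (Y *m Tp M0 M1 t)) wt_row_r.
  have el : lsubmx (Y *m Tp M0 M1 t + row_mx z z) = z + lsubmx (Y *m Tp M0 M1 t).
    by rewrite -{1}(hsubmxK (Y *m Tp M0 M1 t)) add_row_mx row_mxKl addrC.
  have er : rsubmx (Y *m Tp M0 M1 t + row_mx z z) = z + rsubmx (Y *m Tp M0 M1 t).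
    by rewrite -{1}(hsubmxK (Y *m Tp M0 M1 t)) add_row_mx row_mxKr addrC.
  rewrite el er !scalerDr.
  have tY : 0 <= ta * wt Y by exact: mulr_ge0.
  have i1 : wt (h *: z + h *: lsubmx (Y *m Tp M0 M1 t)) `^ mu <= w1 * (ta * wt Y) ^+ P.
    by apply: le_trans (hP _ _) _; apply: (ler_wpM2l w10); rewrite lerXn2r ?nnegrE// sm.
  have i2 : wt (h *: z + h *: rsubmx (Y *m Tp M0 M1 t)) `^ nu <= w2 * (ta * wt Y) ^+ Q.
    by apply: le_trans (hQ _ _) _; apply: (ler_wpM2l w20); rewrite lerXn2r ?nnegrE// sm.
  have := ler_pM (mulr_ge0 A0 (powR_ge0 _ _)) (mulr_ge0 B0 (powR_ge0 _ _)) (ler_wpM2l A0 i1) (ler_wpM2l B0 i2).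
  move/(ler_wpM2l E0) => /le_trans; apply; rewrite !exprMn !exprD.
  rewrite le_eqVlt; apply/orP; left; apply/eqP.
  move: (ta ^+ P) (ta ^+ Q) (wt Y ^+ P) (wt Y ^+ Q) E w1 w2 {hb D0 E0 w10 w20 i1 i2} => e1 e2 e3 e4 e5 e6 e7.
  ring.
rewrite -/w1 -/w2.
have ok : opn (Tp (@M0 R d) M1 t) ^+ K <= ta ^+ K.
  by apply: lerXn2r; rewrite ?nnegrE ?opn_tau//; exact: le_trans (opn_ge1 _).
apply: (@le_trans _ _ (C * ta ^+ K * (E * (A * B * (w1 * w2)) * ta ^+ (P + Q)))).
  by apply: (ler_wpM2r D0); exact: ler_wpM2l.
rewrite le_eqVlt; apply/orP; left; apply/eqP.
move: (ta ^+ K) (ta ^+ (P + Q)) E w1 w2 {hb D0 E0 w10 w20 ok} => e1 e2 e3 e4 e5; ring.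
Qed.

Variables (m1 m2 : R) (a b : R -> 'rV[R]_n -> R[i]).
Hypotheses (ga : Gsym m1 a) (gb : Gsym m2 b).

Definition tw s1 s2 h := tens (partials s1 (a h)) (partials s2 (b h)).

Lemma cls_tw s1 s2 h : 0 < h <= 1 -> cls (tw s1 s2 h).
Proof. by move=> h01; apply: cls_tens; apply: cls_partials; apply: Gsym_cls h01; [exact: ga|exact: gb]. Qed.

Lemma AT_tw_le l1 l2 : exists2 C : R, 0 <= C & forall h t z s1 s2, 0 < h <= 1 -> `|t| <= 1 ->
  size s1 = l1 -> size s2 = l2 ->
  cmod (AT (Tp M0 M1 t) (tw s1 s2 h) (row_mx z z)) <= C * sw h z (m1 + m2) (l1 + l2).
Proof.
have [K [C C0 hC]] := AT_tens_le (m1 - l1%:R) (m2 - l2%:R).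
have [A A0 hA] := Gsym_bnd K l1 ga; have [B B0 hB] := Gsym_bnd K l2 gb.
exists (C * (A * B)); first by rewrite !mulr_ge0.
move=> h t z s1 s2 h01 t1 e1 e2; have [h0 _] := andP h01.
have hl l : 0 <= h ^+ l by rewrite exprn_ge0// ltW.
have ca : cls (partials s1 (a h)) by apply: cls_partials; exact: Gsym_cls ga h01.
have cb : cls (partials s2 (b h)) by apply: cls_partials; exact: Gsym_cls gb h01.
have b1 : bnd K (fun z => A * h ^+ l1 * wt (h *: z) `^ (m1 - l1%:R)) (partials s1 (a h)).
  by apply: bnd_eqW (hA h s1 h01 e1) => x; rewrite /sw mulrA.
have b2 : bnd K (fun z => B * h ^+ l2 * wt (h *: z) `^ (m2 - l2%:R)) (partials s2 (b h)).
  by apply: bnd_eqW (hB h s2 h01 e2) => x; rewrite /sw mulrA.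
apply: le_trans (hC h t z _ _ _ _ h01 t1 (mulr_ge0 A0 (hl l1)) (mulr_ge0 B0 (hl l2)) ca cb b1 b2) _.
have wn : wt (h *: z) != 0 by rewrite gt_eqF.
rewrite -powRD; last by rewrite wn implybT.
rewrite /sw (_ : m1 - l1%:R + (m2 - l2%:R) = m1 + m2 - (l1 + l2)%:R); last by rewrite natrD; ring.
rewrite exprD le_eqVlt; apply/orP; left; apply/eqP.
move: (h ^+ l1) (h ^+ l2) (wt _ `^ _) => x1 x2 x3; ring.
Qed.

(** Each [Qop] [qM] lengthens both words by one letter, which contributes h^2 and lowers the order
    by 2. *)
Lemma iterQ_tw_le N l1 l2 : exists2 C : R, 0 <= C & forall h t z s1 s2, 0 < h <= 1 -> `|t| <= 1 ->
  size s1 = l1 -> size s2 = l2 ->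
  cmod (AT (Tp M0 M1 t) (iter N (Qop qM) (tw s1 s2 h)) (row_mx z z))
    <= C * sw h z (m1 + m2) (l1 + l2 + 2 * N).
Proof.
elim: N l1 l2 => [|N IH] l1 l2; first by have [C C0 hC] := AT_tw_le l1 l2; exists C => // *; rewrite muln0 addn0; exact: hC.
have [C C0 hC] := IH l1.+1 l2.+1.
pose c (k : 'I_n * 'I_n) : R[i] := - 'i%C * (J k.1 k.2)%:C.
exists (\sum_k cmod (c k) * C); first by apply: sumr_ge0 => k _; exact: mulr_ge0.
move=> h t z s1 s2 h01 t1 e1 e2.
have ca : cls (partials s1 (a h)) by apply: cls_partials; exact: Gsym_cls ga h01.
have cb : cls (partials s2 (b h)) by apply: cls_partials; exact: Gsym_cls gb h01.
have cG (k : 'I_n * 'I_n) : cls (tw (k.1 :: s1) (k.2 :: s2) h) by exact: cls_tw.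
have eQ : Qop qM (tw s1 s2 h) = (fun X => \sum_k c k * tw (k.1 :: s1) (k.2 :: s2) h X).
  exact: Qop_tens ca cb.
have f := path_flow (@M0 R d) (isotropic_d _ : isotropic (@M1 R d)).
rewrite iterSr eQ (iterQ_sum qM N (index_enum _) c cG).
rewrite (flow_sum f t (index_enum _) (fun k => clsZ (c k) (cls_iterQ qM N (cG k)))).
apply: le_trans (cmod_sum _ _ _) _; rewrite mulr_suml; apply: ler_sum => k _.
rewrite (flowZ f t (c k) (cls_iterQ qM N (cG k))) cmodM -mulrA; apply: ler_wpM2l => //.
apply: le_trans (hC h t z (k.1 :: s1) (k.2 :: s2) h01 t1 _ _) _; rewrite /= ?e1 ?e2//.
by rewrite (_ : l1.+1 + l2.+1 + 2 * N = l1 + l2 + 2 * N.+1)%N// mulnS addnA addSn addnS addn2.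
Qed.

Definition rem N : ('rV[R]_(n + n) -> R[i]) -> 'rV[R]_(n + n) -> R[i] :=
  remainder (fun t => AT (Tp (@M0 R d) M1 t)) qM N.

Let flowM : flow (fun t => AT (Tp (@M0 R d) M1 t)) qM.
Proof. exact: path_flow (isotropic_d _). Qed.

Lemma rem_tw_le N l1 l2 : exists C : R, forall h z s1 s2, 0 < h <= 1 ->
  size s1 = l1 -> size s2 = l2 ->
  cmod (rem N (tw s1 s2 h) (row_mx z z)) <= C * sw h z (m1 + m2) (l1 + l2 + 2 * N).
Proof.
have [C C0 hC] := iterQ_tw_le N l1 l2; exists (2 ^+ N * C) => h z s1 s2 h01 e1 e2.
have F0 (F : 'rV[R]_(n + n) -> R[i]) : cls F -> AT (Tp M0 M1 0) F = F.
  by move=> cF; apply: path_0 => //; exact: isotropic_u.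
rewrite /rem remainder_taylor -mulrA.
apply: (flow_taylor flowM F0 (cls_tw s1 s2 h01)); last by rewrite normr1.
by move=> t t1; exact: hC.
Qed.

Lemma sum_diag_mx i (G : 'I_(n + n) -> R[i]) :
  \sum_j ((row_mx 1%:M 1%:M : 'M[R]_(n, n + n)) i j)%:C * G j = G (lshift n i) + G (rshift n i).
Proof.
rewrite big_split_ord /= (bigD1 i)//= [X in _ + _ + X](bigD1 i)//= !big1.
- by rewrite row_mxEl row_mxEr !mxE eqxx !mul1r !addr0.
- by move=> j ji; rewrite row_mxEr mxE eq_sym (negbTE ji) mul0r.
- by move=> j ji; rewrite row_mxEl mxE eq_sym (negbTE ji) mul0r.
Qed.

Lemma partial_diag (F : 'rV[R]_(n + n) -> R[i]) i z : cls F ->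
  pder i (fun z => F (row_mx z z)) z
    (partial (lshift n i) F (row_mx z z) + partial (rshift n i) F (row_mx z z)).
Proof.
move=> cF; have e (y : 'rV[R]_n) : row_mx y y = y *m (row_mx 1%:M 1%:M) + 0.
  by rewrite mul_mx_row mulmx1 addr0.
have := pder_subst i (row_mx 1%:M 1%:M) 0 z cF; under eq_fun do rewrite -e; rewrite -e.
move/pder_eq; apply; exact: (sum_diag_mx i (fun j => partial j F (row_mx z z))).
Qed.

(** Indexed by two words so that the family is closed under derivatives in z: on the diagonal, a
    derivative falls either on a or on b and lengthens one of the words. *)
Definition remz N s1 s2 h z := rem N (tw s1 s2 h) (row_mx z z).

Lemma cls_remz N s1 s2 h : 0 < h <= 1 -> cls (remz N s1 s2 h).
Proof.
move=> h01; have cr := cls_remainder flowM N (cls_tw s1 s2 h01).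
by apply: cls_eqf (cls_subst (row_mx 1%:M 1%:M) 0 cr) => z; rewrite mul_mx_row mulmx1 addr0.
Qed.

Lemma partial_remz N s1 s2 h i : 0 < h <= 1 ->
  partial i (remz N s1 s2 h) = (fun z => remz N (i :: s1) s2 h z + remz N s1 (i :: s2) h z).
Proof.
move=> h01; have cT := cls_tw s1 s2 h01.
have ca : cls (partials s1 (a h)) by apply: cls_partials; exact: Gsym_cls ga h01.
have cb : cls (partials s2 (b h)) by apply: cls_partials; exact: Gsym_cls gb h01.
apply/funext => z; rewrite (pder_val (partial_diag i z (cls_remainder flowM N cT))).
rewrite !(partial_remainder flowM _ N cT).
by rewrite (partial_tensl _ (cls_pderivable i ca)) (partial_tensr _ (cls_pderivable i cb)).
Qed.

Lemma partialsD w f g : cls f -> cls g ->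
  partials w (fun z => f z + g z) = (fun z => partials w f z + partials w g z).
Proof.
move=> cf cg; elim: w => //= i w ->; apply/funext => z; apply: pder_val; apply: pderD.
  exact: cls_pderivable (cls_partials w cf) z.
exact: cls_pderivable (cls_partials w cg) z.
Qed.

Lemma partialsZ w (c : R[i]) f : cls f -> partials w (fun z => c * f z) = (fun z => c * partials w f z).
Proof.
move=> cf; elim: w => //= i w ->; apply/funext => z; apply: pder_val; apply: pderZ.
exact: cls_pderivable (cls_partials w cf) z.
Qed.

Lemma partials_remz_le N k l1 l2 : exists C : R, forall h w z s1 s2, 0 < h <= 1 ->
  size w = k -> size s1 = l1 -> size s2 = l2 ->
  cmod (partials w (remz N s1 s2 h) z) <= C * sw h z (m1 + m2) (k + (l1 + l2 + 2 * N)).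
Proof.
elim: k l1 l2 => [|k IH] l1 l2.
  have [C hC] := rem_tw_le N l1 l2; exists C => h w z s1 s2 h01 /size0nil -> e1 e2.
  exact: hC.
have [C hC] := IH l1.+1 l2; have [C' hC'] := IH l1 l2.+1.
exists (C + C') => h w z s1 s2 h01; case/lastP: w => // w i; rewrite size_rcons => -[ew] e1 e2.
rewrite partials_rcons (partial_remz N s1 s2 i h01) partialsD; [|exact: cls_remz..].
apply: le_trans (cmodD _ _) _; rewrite mulrDl; apply: lerD.
  apply: le_trans (hC h w z (i :: s1) s2 h01 ew _ e2) _; first by rewrite /= e1.
  by rewrite !addSn !addnS.
apply: le_trans (hC' h w z s1 (i :: s2) h01 ew e1 _) _; first by rewrite /= e2.
by rewrite addnS !addSn addnS.
Qed.

Lemma Gsym_remz N : Gsym (m1 + m2 - (2 * N)%:R)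
  (fun h z => ((h ^+ (2 * N))^-1)%:C * remz N [::] [::] h z).
Proof.
apply: Gsym_of_words => [h h01|k]; first by apply: clsZ; exact: cls_remz.
have [C hC] := partials_remz_le N k 0 0; exists C => h w z h01 ew.
have [h0 _] := andP h01; have hp : 0 < h ^+ (2 * N) by exact: exprn_gt0.
rewrite partialsZ; last exact: cls_remz.
rewrite cmodM cmodC ger0_norm ?invr_ge0 ?(ltW hp)// ler_pdivrMl//.
apply: le_trans (hC h w z [::] [::] h01 ew erefl erefl) _; rewrite !add0n /sw exprD.
rewrite (_ : m1 + m2 - (k + 2 * N)%:R = m1 + m2 - (2 * N)%:R - k%:R); last by rewrite natrD; ring.
move: (h ^+ k) (h ^+ (2 * N)) (wt _ `^ _) => x1 x2 x3.
by rewrite le_eqVlt; apply/orP; left; apply/eqP; ring.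
Qed.

Lemma remz_moyal N h z : 0 < h <= 1 ->
  moyal (a h) (b h) z - \sum_(0 <= j < N) moyal_term j h (a h) (b h) z = remz N [::] [::] h z.
Proof.
move=> h01; have [h0 _] := andP h01.
have ca := Gsym_cls ga h01; have cb := Gsym_cls gb h01.
rewrite /remz /rem /remainder /Tp scale1r; congr (_ - _).
by apply: eq_bigr => j _; rewrite (moyal_termE j z _ ca cb)// gt_eqF.
Qed.

End MoyalEstimates.

Lemma Gsym_eq (R : realType) (d : nat) (m : R) (a a' : R -> 'rV[R]_(d + d) -> R[i]) :
  (forall h, 0 < h <= 1 -> a h = a' h) -> Gsym m a -> Gsym m a'.
Proof.
move=> e [sa ha]; split=> [h h01|alpha]; first by rewrite -e//; exact: sa.
by have [C C0 hC] := ha alpha; exists C => // h z h01; rewrite -e//; exact: hC.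
Qed.

(** The product enters through its defining property: existence is one clause, and the expansion is
    proved for every c having that property, all of which equal [moyal] for h in (0, 1]. *)
Theorem theoremA5 (R : realType) (d : nat) (m n : R)
    (a b : R -> 'rV[R]_(d + d) -> R[i]) (ha : Gsym m a) (hb : Gsym n b) :
  (exists c : R -> 'rV[R]_(d + d) -> R[i],
     forall h : R, 0 < h <= 1 -> is_weyl_product (a h) (b h) (c h)) /\
  (forall c : R -> 'rV[R]_(d + d) -> R[i],
     (forall h : R, 0 < h <= 1 -> is_weyl_product (a h) (b h) (c h)) ->
     Gsym (m + n) c /\
     forall N : nat, (1 <= N)%N ->
       hGsym (2 * N) (m + n - (2 * N)%:R)
         (fun h z => c h z - \sum_(0 <= j < N) moyal_term j h (a h) (b h) z)).
Proof.
have ca h : 0 < h <= 1 -> cls (a h) := Gsym_cls ha.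
have cb h : 0 < h <= 1 -> cls (b h) := Gsym_cls hb.
split.
  exists (fun h => moyal (a h) (b h)) => h h01.
  by apply: is_weyl_product_moyal; [exact: ca|exact: cb].
move=> c hc.
have ec h : 0 < h <= 1 -> c h = moyal (a h) (b h).
  by move=> h01; apply: is_weyl_product_uniq (hc h h01); [exact: ca|exact: cb].
split.
  (* At N = 0 the sum is empty and the factor h^0 is 1, so the remainder estimate is the membership
     of the product itself. *)
  have := Gsym_remz ha hb 0%N; rewrite muln0 subr0; apply: Gsym_eq => h h01.
  apply/funext => z; rewrite expr0 invr1 mul1r -(remz_moyal ha hb 0%N z h01).
  by rewrite big_geq// subr0 ec.
(* The witness is h^(-2 N) times the remainder; multiplication by h^(2 N) restores it because h >
   0. *)
move=> N _; eexists; first exact: Gsym_remz ha hb N.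
move=> h z h01 /=; rewrite ec// (remz_moyal ha hb N z h01) mulrA -(rmorphM (real_complex R)).
have [h0 _] := andP h01.
by rewrite divff ?mul1r// expf_neq0// gt_eqF.
Qed.
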